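(* There exist numerical constants $C_R$ and $C_K$ such that the following holds. Let $n_1\ge n_2$, let $\mathbf{M}\in\mathbb{R}^{n_1\times n_2}$ have rank $r$ with singular value decomposition $\mathbf{M}=\sum_{k=1}^r\sigma_k\mathbf{u}_k\mathbf{v}_k^\intercal$, and suppose that $\mathbf{M}$ satisfies the $h$ linear equality constraints $\langle \mathbf{A}^{(l)},\mathbf{M}\rangle=b^{(l)}$ for all $l\in\{1,\dots,h\}$, where $\mathbf{A}^{(l)}\in\mathbb{R}^{n_1\times n_2}$ and $b^{(l)}\in\mathbb{R}$. Assume that, for constants $\mu_0>0$ and $\nu_0$, (i) $\max\{\mu(\mathcal{U}),\mu(\mathcal{V})\}\le\mu_0$, where $\mathcal{U}=\mathrm{span}(\mathbf{u}_1,\dots,\mathbf{u}_r)$, $\mathcal{V}=\mathrm{span}(\mathbf{v}_1,\dots,\mathbf{v}_r)$ and $\mu(\cdot)$ is the coherence; (ii) every entry of $\mathbf{E}=\sum_{k=1}^r\mathbf{u}_k\mathbf{v}_k^\intercal$ has absolute value at most $\nu_0\sqrt{r/(n_1n_2)}$. Suppose that a set $\Omega$ of $m$ entries of $\mathbf{M}$ is sampled uniformly at random. If $$m > \left(C_K e^2 \nu_0 \sqrt{\beta r n_1\log n_1}\,2^{\frac{2}{\beta \log n_1}+\frac{5}{2}}+2\sqrt{qn_1n_2\sqrt{\nu_{\mathcal{Q}^\perp}r}}\right)^2 - qn_1n_2,$$ $$m > \sqrt{10\mu_0 rn_1n_2}\left(C_R \sqrt{\beta rn_1\log n_1}+n_1n_2\sqrt{\mu_{\mathcal{Q}^\perp}q}\right)(1+\sqrt{q})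 - qn_1n_2,$$ $$m \ge 2^4C_R^2\beta \mu_0 r n_1 \log n_1 - qn_1n_2,$$ $$m \ge 2^4\mu_{\mathcal{Q}^\perp}\mu_0qn_1^2n_2^2 - qn_1n_2,$$ $$m \ge qn_1n_2\sqrt{\nu_{\mathcal{Q}^\perp}r} - qn_1n_2,$$ $$m \ge \max\{2,\beta\}\,n_1\log n_1$$ for some $\beta\ge 1$ and $q>0$, then with probability at least $1-6n_1^{-\beta}$ the solution to the problem $$\min_{\mathbf{X}\in\mathbb{R}^{n_1\times n_2}}\ \|\mathbf{X}\|_*\quad\text{s.t.}\quad X_{ij}=M_{ij}\ \ \forall (i,j)\in\Omega,\qquad \langle \mathbf{A}^{(l)},\mathbf{X}\rangle=b^{(l)}\ \ \forall l\in\{1,\dots,h\}$$ is unique and equal to $\mathbf{M}$.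
   Context: Notation: $\langle \mathbf{A},\mathbf{X}\rangle=\mathrm{trace}(\mathbf{A}^\intercal\mathbf{X})$; $\|\cdot\|_F$ is the Frobenius norm; $\|\cdot\|_*$ is the nuclear norm (sum of singular values); $\mathbf{e}_i$ denotes a standard basis vector (of the dimension dictated by context). For a subspace of matrices $\mathcal{X}$, $\mathcal{P}_{\mathcal{X}}$ is the orthogonal projection onto $\mathcal{X}$ with respect to $\langle\cdot,\cdot\rangle$ and $\mathcal{X}^\perp$ is the orthogonal complement. Sampling: $\Omega\subset\{1,\dots,n_1\}\times\{1,\dots,n_2\}$ is uniformly distributed among sets of $m$ locations (sampling without replacement). Coherence: for a subspace $\mathcal{U}\subset\mathbb{R}^n$ of dimension $r$ with orthogonal projection matrix $\mathbf{P}_{\mathcal{U}}$, $\mu(\mathcal{U}):=\frac{n}{r}\max_{1\le i\le n}\|\mathbf{P}_{\mathcal{U}}\mathbf{e}_i\|^2$. The subspace $\mathcal{T}$ associated with $\mathbf{M}$ is $\mathcal{T}:=\{\sum_{k=1}^r(\mathbf{u}_k\mathbf{x}_k^\intercal+\mathbf{y}_k\mathbf{v}_k^\intercal):\mathbf{x}_k\in\mathbb{R}^{n_2},\mathbf{y}_k\in\mathbb{R}^{n_1}\}$, so that $\mathcal{P}_{\mathcal{T}}(\mathbf{X})=\mathbf{P}_{\mathcal{U}}\mathbf{X}+\mathbf{X}\mathbf{P}_{\mathcal{V}}-\mathbf{P}_{\mathcal{U}}\mathbf{X}\mathbf{P}_{\mathcal{V}}$. The constraint space is $\mathcal{Q}:=\mathrm{span}(\mathbf{A}^{(1)},\dots,\mathbf{A}^{(h)})$,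 and $$\mu_{\mathcal{Q}^\perp}:=\frac{\sum_{i=1}^{n_1}\sum_{j=1}^{n_2}\|\mathcal{P}_{\mathcal{T}}\mathcal{P}_{\mathcal{Q}^\perp}(\mathbf{e}_i\mathbf{e}_j^\intercal)\|_F^2}{\sum_{i=1}^{n_1}\sum_{j=1}^{n_2}\|\mathcal{P}_{\mathcal{T}}(\mathbf{e}_i\mathbf{e}_j^\intercal)\|_F^2},\qquad \nu_{\mathcal{Q}^\perp}:=\frac1r\|\mathcal{P}_{\mathcal{Q}^\perp}(\mathbf{E})\|_F^2 .$$ *)

(* Defs.v *)
(* MathComp-Analysis; the real numbers are an arbitrary R : realType. *)
From HB Require Import structures.
From mathcomp Require Import all_boot all_order all_algebra.
From mathcomp Require Import polyrcf.
From mathcomp Require Import all_classical all_reals all_analysis.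

Set Implicit Arguments.
Unset Strict Implicit.
Unset Printing Implicit Defensive.

Import Order.TTheory GRing.Theory Num.Theory.

Local Open Scope classical_set_scope.
Local Open Scope ring_scope.

Section Matrices.
Variable R : realType.

Definition mxdot p q (A X : 'M[R]_(p, q)) : R := \tr (A^T *m X).

(* On column vectors this is the Euclidean norm. *)
Definition frob_norm p q (X : 'M[R]_(p, q)) : R := Num.sqrt (mxdot X X).

(* Square roots of the eigenvalues of X^T X, each repeated according to its
   multiplicity. As X^T X is symmetric, its characteristic polynomial splits
   over R, so there are q of them (zeros included). *)
Definition singular_values p q (X : 'M[R]_(p, q)) : seq R :=
  let chi := char_poly (X^T *m X) in
  flatten [seq nseq (mup x chi) (Num.sqrt x) | x <- rootsR chi].

Definition nuclear_norm p q (X : 'M[R]_(p, q)) : R :=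
  \sum_(s <- singular_values X) s.

Definition orthocomp p q (S : set 'M[R]_(p, q)) : set 'M[R]_(p, q) :=
  [set X | forall Z, S Z -> mxdot Z X = 0].

(* The orthogonal projection of X onto S, i.e. the Y in S such that X - Y is
   orthogonal to S. It exists and is unique whenever S is a linear subspace;
   the default value 0 only matters for other sets. *)
Definition oproj p q (S : set 'M[R]_(p, q)) (X : 'M[R]_(p, q)) : 'M[R]_(p, q) :=
  xget 0 [set Y | S Y /\ orthocomp S (X - Y)].

Definition std_basis n (i : 'I_n) : 'cV[R]_n := delta_mx i 0.

(* The maximum is taken from 0, which is harmless as the norms are >= 0. *)
Definition coherence n (W : {vspace 'cV[R]_n}) : R :=
  n%:R / (\dim W)%:R *
  \big[Num.max/0]_(i < n) frob_norm (oproj [set` W] (std_basis i)) ^+ 2.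

Definition orthonormal_family n r (u : 'I_r -> 'cV[R]_n) : Prop :=
  forall k l, mxdot (u k) (u l) = (k == l)%:R.

Section SVD.
Variables (n1 n2 r : nat).

Definition is_svd (M : 'M[R]_(n1, n2)) (sigma : 'I_r -> R)
    (u : 'I_r -> 'cV[R]_n1) (v : 'I_r -> 'cV[R]_n2) : Prop :=
  [/\ orthonormal_family u, orthonormal_family v,
      forall k, 0 < sigma k
    & M = \sum_(k < r) sigma k *: (u k *m (v k)^T)].

Variables (u : 'I_r -> 'cV[R]_n1) (v : 'I_r -> 'cV[R]_n2).

Definition svd_E : 'M[R]_(n1, n2) := \sum_(k < r) u k *m (v k)^T.

Definition svd_T : set 'M[R]_(n1, n2) :=
  [set X | exists (x : 'I_r -> 'cV[R]_n2) (y : 'I_r -> 'cV[R]_n1),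
     X = \sum_(k < r) (u k *m (x k)^T + y k *m (v k)^T)].

Variables (h : nat) (A : 'I_h -> 'M[R]_(n1, n2)).

Definition constraint_space : {vspace 'M[R]_(n1, n2)} := <<codom A>>%VS.

Definition Qperp : set 'M[R]_(n1, n2) := orthocomp [set` constraint_space].

Definition mu_Qperp : R :=
  (\sum_(i < n1) \sum_(j < n2)
     frob_norm (oproj svd_T
       (oproj Qperp (std_basis i *m (std_basis j)^T))) ^+ 2) /
  (\sum_(i < n1) \sum_(j < n2)
     frob_norm (oproj svd_T (std_basis i *m (std_basis j)^T)) ^+ 2).

Definition nu_Qperp : R := r%:R^-1 * frob_norm (oproj Qperp svd_E) ^+ 2.

Variables (b : 'I_h -> R) (M : 'M[R]_(n1, n2)).

Definition feasible (Omega : {set 'I_n1 * 'I_n2}) : set 'M[R]_(n1, n2) :=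
  [set X : 'M[R]_(n1, n2) |
     (forall i j, (i, j) \in Omega -> X i j = M i j) /\
     (forall l, mxdot (A l) X = b l)].

Definition minimizers (Omega : {set 'I_n1 * 'I_n2}) : set 'M[R]_(n1, n2) :=
  [set X : 'M[R]_(n1, n2) | feasible Omega X /\
     forall Y, feasible Omega Y -> nuclear_norm X <= nuclear_norm Y].

End SVD.

(* Probability of P when S is uniformly distributed among the m-element
   subsets of I; meaningful for m <= #|I|. *)
Definition unif_subset_prob (I : finType) (m : nat) (P : {set I} -> Prop) : R :=
  #|[set S : {set I} | (#|S| == m) && `[< P S >]]%SET|%:R /
  #|[set S : {set I} | #|S| == m]%SET|%:R.

End Matrices.

(* Main.v *)
(* M is the unique minimizer as soon as there is a dual certificate: a matrix Y in
   the span of the sampled entries and of the constraints with P_T Y = E and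
   |P_T^perp Y| < 1 in operator norm, together with injectivity of the measurements
   on T. Both follow once the weighted operator (P_Omega + q P_Q) / (p + q), with
   p = m / (n1 n2), is close to the identity on T and nearly fixes E; the
   certificate is then obtained from a Neumann series. The constraint part of the
   deviation is controlled by mu_Qperp and nu_Qperp through the Hilbert-Schmidt
   norm of P_T P_Qperp. The random part is controlled by matrix moments
   E tr Z^(2l) with l of order beta ln n1, bounded directly for sampling without
   replacement: exchanging a sampled index with an unsampled one is an
   exchangeable pair, and the mean value trace inequality for odd powers bounds
   E tr Z^(2l) by a variance proxy times a moment of order 2l - 2. *)
Require Import Defs.
From HB Require Import structures.
From mathcomp Require Import all_boot all_order all_algebra.
From mathcomp Require Import ring lra polyrcf complex spectral sesquilinear.
From mathcomp Require Import all_classical all_reals all_analysis.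

Set Implicit Arguments.
Unset Strict Implicit.
Unset Printing Implicit Defensive.

Import Order.TTheory GRing.Theory Num.Theory.

Local Open Scope classical_set_scope.
Local Open Scope ring_scope.

(** * Real symmetric matrices and trace inequalities *)

(** The certificate comes from one sampled operator rather than from independent batches. Beyond its
    leading term it is therefore known only in Frobenius norm, where [svd_E] has size [sqrt r]; the
    second sample-size condition pays for that factor. The difficulty in the moment bounds is that
    the variance proxy is itself random. For the operator on the tangent space the summands are
    positive, and the proxy is bounded by the very sum under study. The entries of [svd_E] carry
    signs, so the squares of their dilations are dominated by diagonal projections, and the centered
    sum of these obeys the positive bound. The two symmetric matrices met there need not commute;
    they are compared through the overlaps of their eigenbases. The moment order is chosen so that a
    constant factor [expR 2] in the deviation level beats both the dimension, at most of order
    [n1 ^ 2], and the target probability [n1 ^ (- beta)]. This is where the exponential factors in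
    the constants come from. *)

Lemma symmetric_eigenvalue (R : rcfType) n (A : 'M[R]_n.+1) :
  A^T = A -> exists a, eigenvalue A a.
Proof.
(* The complexification of [A] is Hermitian, so its spectral diagonal is real; being a root of the
   characteristic polynomial then descends along the embedding [f]. *)
move=> Asym; pose f := real_complex R; pose B := map_mx f A.
have Bh : B \is hermsymmx.
  apply: realsym_hermsym.
    by apply/is_hermitianmxP; rewrite expr0 scale1r map_mx_id // /B map_trmx Asym.
  apply/mxOverP => i j; rewrite mxE; apply/complex_realP; by exists (A i j).
have /hermitian_normalmx/orthomx_spectralP EB := Bh.
have /mxOverP/(_ ord0 ord0)/complex_realP[a Ea] := hermitian_spectral_diag_real Bh.
exists a; rewrite eigenvalue_root_char -(fmorph_root f) map_char_poly.
rewrite -eigenvalue_root_char; apply/eigenvalueP.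
exists (row 0 (spectralmx B)); last first.
  apply/eqP => /(congr1 (mulmx^~ (invmx (spectralmx B)))).
  rewrite -row_mul mulmxV ?spectral_unit // mul0mx => /rowP/(_ 0).
  by rewrite !mxE eqxx => /eqP; rewrite oner_eq0.
rewrite -/B {2}EB -!row_mul !mulmxA mulmxV ?spectral_unit // mul1mx.
by rewrite row_mul row_diag_mx -scalemxAl -rowE Ea.
Qed.

Lemma mulmx_tr_ge0 (R : realDomainType) n (x : 'rV[R]_n) :
  0 <= (x *m x^T) 0 0.
Proof. by rewrite mxE sumr_ge0 // => i _; rewrite mxE -expr2 sqr_ge0. Qed.

Lemma mulmx_tr_eq0 (R : realDomainType) n (x : 'rV[R]_n) :
  ((x *m x^T) 0 0 == 0) = (x == 0).
Proof.
apply/eqP/eqP => [|->]; last by rewrite mul0mx mxE.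
rewrite mxE => /eqP; rewrite psumr_eq0 => [/allP x0|i _]; last first.
  by rewrite mxE -expr2 sqr_ge0.
apply/rowP => i; rewrite mxE; apply/eqP.
by have := x0 i (mem_index_enum i); rewrite mxE -expr2 sqrf_eq0.
Qed.

Lemma orthogonal_completion (R : realFieldType) n (x : 'rV[R]_n.+1) :
  x *m x^T = 1%:M ->
  exists H : 'M[R]_n.+1, H *m H^T = 1%:M /\ delta_mx 0 0 *m H = x.
Proof.
move=> xx; pose e : 'rV[R]_n.+1 := delta_mx 0 0; pose w := x - e.
have [w0|w0] := eqVneq w 0.
  exists 1%:M; rewrite trmx1 !mulmx1; split=> //.
  by apply/esym/eqP; rewrite -subr_eq0 -/e -/w w0.
pose s := (w *m w^T) 0 0; have s0 : s != 0 by rewrite mulmx_tr_eq0.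
have ws : w *m w^T = s%:M by rewrite [LHS]mx11_scalar.
(* Householder reflection exchanging [x] and the first basis vector *)
exists (1%:M - (2 / s) *: (w^T *m w)).
have ew : e *m w^T = (- (s / 2))%:M.
  have ee : e *m e^T = 1%:M.
    by rewrite trmx_delta mul_delta_mx; apply/matrixP => i j; rewrite !ord1 !mxE.
  have xe : x *m e^T = (e *m x^T)^T by rewrite trmx_mul trmxK.
  rewrite [LHS]mx11_scalar; congr (_%:M).
  rewrite /s /w linearB /= !mulmxBl !mulmxBr ee xx xe !mxE /=; by field.
have wE : x = w + e by rewrite /w subrK.
clearbody s; clearbody w.
split; last first.
  rewrite -/e [LHS]mulmxBr mulmx1 -scalemxAr mulmxA ew mul_scalar_mx scalerA.
  rewrite mulrN mulrA divfK // divff ?pnatr_eq0 // scaleN1r opprK.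
  by rewrite addrC wE.
have -> : (1%:M - (2 / s) *: (w^T *m w))^T = 1%:M - (2 / s) *: (w^T *m w).
  by rewrite linearB /= trmx1 linearZ /= trmx_mul trmxK.
have VV : (w^T *m w) *m (w^T *m w) = s *: (w^T *m w).
  by rewrite mulmxA -(mulmxA w^T w) ws -scalemx1 -scalemxAr mulmx1 -scalemxAl.
rewrite mulmxBl mul1mx mulmxBr mulmx1 -scalemxAr -scalemxAl VV !scalerA.
have -> : 2 / s * (2 / s) * s = 2 / s + 2 / s by field.
by rewrite scalerDl [in X in _ - X]opprD [in X in _ - X]addrA subrr sub0r opprK subrK.
Qed.

(** Deflation. An orthogonal matrix whose first row is a unit eigenvector turns the first row of [A]
    into a multiple of a basis vector; symmetry clears the first column as well, and the remaining
    block falls under the induction hypothesis. *)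
Lemma symmetric_spectral (R : rcfType) n (A : 'M[R]_n) : A^T = A ->
  exists (U : 'M[R]_n) (d : 'rV[R]_n),
    U *m U^T = 1%:M /\ A = U^T *m diag_mx d *m U.
Proof.
elim: n A => [|n IH] A As.
  by exists 1%:M, 0; split; apply/matrixP => -[].
have [a /eigenvalueP[v vA v0]] := symmetric_eigenvalue As.
pose s := (v *m v^T) 0 0.
have s0 : 0 < s by rewrite lt_def mulmx_tr_ge0 mulmx_tr_eq0 v0.
pose x := (Num.sqrt s)^-1 *: v.
have xx : x *m x^T = 1%:M.
  rewrite /x linearZ /= -scalemxAr -scalemxAl scalerA -invfM -expr2.
  rewrite sqr_sqrtr 1?ltW // [v *m v^T]mx11_scalar -/s.
  by rewrite scale_scalar_mx mulVf ?gt_eqF.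
have xA : x *m A = a *: x by rewrite /x -scalemxAl vA !scalerA mulrC.
clearbody x; have [H [HH eH]] := orthogonal_completion xx.
have HtH : H^T *m H = 1%:M by apply: mulmx1C.
have xH : x *m H^T = delta_mx 0 0 by rewrite -eH -mulmxA HH mulmx1.
pose B : 'M[R]_(1 + n) := H *m A *m H^T.
have Bs : B^T = B by rewrite /B !trmx_mul trmxK As mulmxA.
have B0 : row 0 B = a *: delta_mx 0 0.
  by rewrite rowE /B !mulmxA eH xA -scalemxAl xH.
have l0 : lshift n (0 : 'I_1) = 0 :> 'I_(1 + n) by apply/val_inj.
have Bul : ulsubmx B = a%:M.
  apply/matrixP => i j; rewrite !ord1 !mxE l0.
  by move/rowP: B0 => /(_ 0); rewrite !mxE !eqxx mulr1.
have Bur : ursubmx B = 0.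
  apply/matrixP => i j; rewrite !ord1 !mxE l0.
  by move/rowP: B0 => /(_ (rshift 1 j)); rewrite !mxE /= mulr0.
have Bdl : dlsubmx B = 0 by rewrite -Bs -trmx_ursub Bur trmx0.
have [U [d [UU EU]]] : exists (U : 'M[R]_n) (d : 'rV[R]_n),
    U *m U^T = 1%:M /\ drsubmx B = U^T *m diag_mx d *m U.
  by apply: IH; rewrite trmx_drsub Bs.
have EB : B = block_mx 1%:M 0 0 U^T *m diag_mx (row_mx a%:M d)
   *m block_mx 1%:M 0 0 U.
  rewrite -[LHS]submxK Bul Bur Bdl EU diag_mx_row !mulmx_block.
  rewrite !(mulmx0, mul0mx, addr0, add0r, mulmx1, mul1mx).
  congr block_mx; apply/matrixP => i j; by rewrite !ord1 !mxE.
pose V : 'M[R]_(1 + n) := block_mx 1%:M 0 0 U.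
have Vt : V^T = block_mx 1%:M 0 0 U^T by rewrite tr_block_mx !trmx0 trmx1.
have VV : V *m V^T = 1%:M.
  rewrite Vt mulmx_block !(mulmx0, mul0mx, addr0, add0r, mulmx1) UU.
  by rewrite -scalar_mx_block.
rewrite -/V -Vt in EB.
exists ((V : 'M[R]_n.+1) *m H), (row_mx a%:M d : 'rV_(1 + n)); split.
  by rewrite trmx_mul mulmxA -(mulmxA _ H) HH mulmx1.
have -> : A = H^T *m (B : 'M[R]_n.+1) *m H.
  by rewrite /B !mulmxA HtH mul1mx -mulmxA HtH mulmx1.
by rewrite EB trmx_mul !mulmxA.
Qed.

Lemma diag_conj_exp (R : comNzRingType) n (U : 'M[R]_n) (d : 'rV[R]_n) k :
  U *m U^T = 1%:M ->
  (U^T *m diag_mx d *m U) ^+ k = U^T *m diag_mx (\row_i d 0 i ^+ k) *m U.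
Proof.
move=> UU; have UtU : U^T *m U = 1%:M by apply: mulmx1C.
elim: k => [|k IH].
  rewrite expr0 (_ : diag_mx _ = 1%:M) ?mulmx1 ?UtU //.
  by apply/matrixP => i j; rewrite !mxE expr0.
rewrite exprS IH -!mulmxE !mulmxA -(mulmxA _ U U^T) UU mulmx1.
rewrite -(mulmxA U^T) mulmx_diag.
by congr (_ *m diag_mx _ *m _); apply/rowP => i; rewrite !mxE exprS.
Qed.

(* The weights are the squared overlaps of two orthonormal eigenbases, so trace
   inequalities for a pair of symmetric matrices reduce to scalar ones. *)
Lemma trace_pow_joint (R : rcfType) n (A B : 'M[R]_n) :
  A^T = A -> B^T = B ->
  exists (w : 'I_n -> 'I_n -> R) (a b : 'I_n -> R),
    (forall i j, 0 <= w i j) /\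
    forall k l, \tr (A ^+ k *m B ^+ l) =
      \sum_i \sum_j w i j * (a i ^+ k * b j ^+ l).
Proof.
move=> /symmetric_spectral[U [a [UU ->]]] /symmetric_spectral[V [b [VV ->]]].
pose W := U *m V^T.
exists (fun i j => W i j ^+ 2), (a 0), (b 0); split=> [i j|k l].
  exact: sqr_ge0.
rewrite !diag_conj_exp // -!mulmxA mxtrace_mulC !mulmxA.
rewrite -(mulmxA (diag_mx _)) -/W -(mulmxA _ V) (_ : V *m U^T = W^T).
  apply: eq_bigr => i _; rewrite !mxE; apply: eq_bigr => j _.
  by rewrite mul_mx_diag mul_diag_mx !mxE; ring.
by rewrite trmx_mul trmxK.
Qed.

Lemma trace_pow_spectrum (R : rcfType) n (A : 'M[R]_n) : A^T = A ->
  exists a : 'I_n -> R, forall k, \tr (A ^+ k) = \sum_i a i ^+ k.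
Proof.
move=> /symmetric_spectral[U [a [UU ->]]]; exists (a 0) => k.
rewrite diag_conj_exp // mxtrace_mulC mulmxA UU mul1mx mxtrace_diag.
by apply: eq_bigr => i _; rewrite mxE.
Qed.

(** Adding the sum to its reversal pairs the exponents [i] and [n - i]; each pair is bounded because
    [(x ^ i - y ^ i) (x ^ (n - i) - y ^ (n - i)) >= 0] for nonnegative [x] and [y]. *)
Lemma sum_mixed_powers_le (R : realDomainType) (a b : R) n :
  (\sum_(i < n) a ^+ (n.-1 - i) * b ^+ i) *+ 2 <=
  (`|a| ^+ n.-1 + `|b| ^+ n.-1) *+ n.
Proof.
case: n => [|n] /=; first by rewrite big_ord0 mul0rn mulr0n.
have -> : (\sum_(i < n.+1) a ^+ (n - i) * b ^+ i) *+ 2 =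
    \sum_(i < n.+1) (a ^+ (n - i) * b ^+ i + a ^+ i * b ^+ (n - i)).
  rewrite mulr2n big_split /=; congr (_ + _).
  rewrite (reindex_inj rev_ord_inj); apply: eq_bigr => i _ /=.
  by rewrite subSS subKn // -ltnS.
rewrite -[in leRHS](card_ord n.+1) -sumr_const; apply: ler_sum => i _.
have lein : (i <= n)%N by rewrite -ltnS.
apply: (@le_trans _ _ (`|a| ^+ (n - i) * `|b| ^+ i + `|a| ^+ i * `|b| ^+ (n - i))).
  by apply: lerD; rewrite -!normrX -normrM ler_norm.
rewrite -subr_ge0.
have -> : `|a| ^+ n + `|b| ^+ n -
    (`|a| ^+ (n - i) * `|b| ^+ i + `|a| ^+ i * `|b| ^+ (n - i)) =
    (`|a| ^+ i - `|b| ^+ i) * (`|a| ^+ (n - i) - `|b| ^+ (n - i)).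
  by rewrite -{1 2}(subnKC lein) !exprD; ring.
case: (lerP `|a| `|b|) => [ab|/ltW ba].
  by apply: mulr_le0; rewrite subr_le0; apply: lerXn2r; rewrite ?nnegrE.
by apply: mulr_ge0; rewrite subr_ge0; apply: lerXn2r; rewrite ?nnegrE.
Qed.

(** Scalar mean value inequality. After [a - b] is factored out, the mixed powers have even total
    degree, so the absolute values in [sum_mixed_powers_le] disappear. *)
Lemma subr_odd_powers_le (R : realFieldType) (a b : R) p :
  (a - b) * (a ^+ p.*2.+1 - b ^+ p.*2.+1) <=
  p.*2.+1%:R / 2 * ((a - b) ^+ 2 * (a ^+ p.*2 + b ^+ p.*2)).
Proof.
rewrite subrXX mulrA -expr2.
rewrite mulrCA ler_wpM2l ?sqr_ge0 //.
have := sum_mixed_powers_le a b p.*2.+1.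
rewrite /= -!normrX !ger0_norm ?exprn_even_ge0 ?odd_double //.
rewrite -mulr_natr -[leRHS]mulr_natl => H.
rewrite mulrAC ler_pdivlMr // (le_trans _ H) //.
Qed.

Lemma trmx_exp (R : comPzRingType) n (A : 'M[R]_n) k : (A ^+ k)^T = A^T ^+ k.
Proof.
elim: k => [|k IH]; first by rewrite !expr0 trmx1.
by rewrite exprS exprSr -!mulmxE trmx_mul IH.
Qed.

Lemma mxtrace_exp_gram (R : comPzRingType) n (A X : 'M[R]_n) k :
  A^T = A -> \tr (X *m A ^+ k.*2) = \tr (A ^+ k *m X *m (A ^+ k)^T).
Proof.
move=> As; rewrite trmx_exp As -addnn exprD -mulmxE mulmxA.
by rewrite [LHS]mxtrace_mulC mulmxA.
Qed.

(** Monotonicity in the Loewner order, stated through quadratic forms. An even power is a Gram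
    product, so each trace is the sum of the forms at the rows of [A ^+ k]; no commutation is
    required. *)
Lemma trace_quad_le (R : realFieldType) n (A X Y : 'M[R]_n) k :
  A^T = A -> (forall x : 'rV_n, (x *m X *m x^T) 0 0 <= (x *m Y *m x^T) 0 0) ->
  \tr (X *m A ^+ k.*2) <= \tr (Y *m A ^+ k.*2).
Proof.
move=> As XY; rewrite !mxtrace_exp_gram //; apply: ler_sum => i _.
have E (Q : 'M[R]_n) : (A ^+ k *m Q *m (A ^+ k)^T) i i =
    (row i (A ^+ k) *m Q *m (row i (A ^+ k))^T) 0 0.
  by rewrite tr_row -!row_mul !mxE; apply: eq_bigr => j _; rewrite !mxE.
by rewrite !E.
Qed.

(** By cyclicity every word in the two expansions becomes a power of [A] followed by a power of [B].
    [trace_pow_joint] rewrites these as sums over pairs of eigenvalues with nonnegative weights,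
    where the scalar inequality applies term by term. *)
Lemma trace_subr_odd_powers_le (R : rcfType) n (A B : 'M[R]_n) p :
  A^T = A -> B^T = B ->
  \tr ((A - B) *m (A ^+ p.*2.+1 - B ^+ p.*2.+1)) <=
  p.*2.+1%:R / 2 * \tr ((A - B) *m (A - B) *m (A ^+ p.*2 + B ^+ p.*2)).
Proof.
move=> As Bs; have [w [a [b [w0 E]]]] := trace_pow_joint As Bs.
set k := p.*2.
have trN (X : 'M[R]_n) : \tr (- X) = - \tr X by rewrite raddfN.
pose S (f : 'I_n -> 'I_n -> R) := \sum_i \sum_j w i j * f i j.
have SD f g : S f + S g = S (fun i j => f i j + g i j).
  rewrite /S -big_split; apply: eq_bigr => i _ /=; rewrite -big_split.
  by apply: eq_bigr => j _ /=; rewrite mulrDr.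
have SZ c f : c * S f = S (fun i j => c * f i j).
  rewrite /S mulr_sumr; apply: eq_bigr => i _ /=; rewrite mulr_sumr.
  by apply: eq_bigr => j _ /=; rewrite mulrCA.
have SN f : - S f = S (fun i j => - f i j).
  by rewrite -mulN1r SZ; do 2!apply: eq_bigr => ? _; rewrite mulN1r.
have EA j : \tr (A ^+ j) = S (fun i l => a i ^+ j).
  rewrite -[A ^+ j]mulmx1 -[1%:M](expr0 B) E.
  by do 2!apply: eq_bigr => ? _; rewrite expr0 mulr1.
have EB j : \tr (B ^+ j) = S (fun i l => b l ^+ j).
  rewrite -[B ^+ j]mul1mx -[1%:M](expr0 A) E.
  by do 2!apply: eq_bigr => ? _; rewrite expr0 mul1r.
have -> : \tr ((A - B) *m (A ^+ k.+1 - B ^+ k.+1)) =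
    \tr (A ^+ k.+2) + \tr (B ^+ k.+2) - \tr (A ^+ 1 *m B ^+ k.+1)
    - \tr (A ^+ k.+1 *m B ^+ 1).
  rewrite mulmxBl !mulmxBr !(mxtraceD, trN) !expr1 [\tr (B *m A ^+ _)]mxtrace_mulC.
  by rewrite !mulmxE -!exprS; ring.
have -> : \tr ((A - B) *m (A - B) *m (A ^+ k + B ^+ k)) =
    \tr (A ^+ k.+2) + \tr (B ^+ k.+2) + \tr (A ^+ 2 *m B ^+ k)
    + \tr (A ^+ k *m B ^+ 2) - 2 * \tr (A ^+ 1 *m B ^+ k.+1)
    - 2 * \tr (A ^+ k.+1 *m B ^+ 1).
  rewrite mulmxDr !mulmxBl !mulmxBr !mulmxBl !(mxtraceD, trN).
  have -> : \tr (A *m B *m A ^+ k) = \tr (A ^+ k.+1 *m B ^+ 1).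
    by rewrite mxtrace_mulC mulmxA expr1 mulmxE -exprSr.
  have -> : \tr (B *m A *m A ^+ k) = \tr (A ^+ k.+1 *m B ^+ 1).
    by rewrite -mulmxA mxtrace_mulC expr1 !mulmxE -exprS.
  have -> : \tr (A *m B *m B ^+ k) = \tr (A ^+ 1 *m B ^+ k.+1).
    by rewrite -mulmxA expr1 !mulmxE -exprS.
  have -> : \tr (B *m A *m B ^+ k) = \tr (A ^+ 1 *m B ^+ k.+1).
    by rewrite -mulmxA mxtrace_mulC -mulmxA !mulmxE -exprSr expr1.
  have -> : \tr (B *m B *m A ^+ k) = \tr (A ^+ k *m B ^+ 2).
    by rewrite mxtrace_mulC expr2 mulmxE.
  have -> : \tr (B *m B *m B ^+ k) = \tr (B ^+ k.+2).
    by rewrite !mulmxE -mulrA -!exprS.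
  have -> : \tr (A *m A *m A ^+ k) = \tr (A ^+ k.+2).
    by rewrite !mulmxE -mulrA -!exprS.
  by rewrite !expr2 -!mulmxE; ring.
rewrite !EA !EB !E -!/(S _) !(SZ, SN, SD).
apply: ler_sum => i _; apply: ler_sum => j _; rewrite ler_wpM2l //.
have := subr_odd_powers_le (a i) (b j) p.
by rewrite -/k !exprS !expr0 => H; lra.
Qed.

(** * Moments of centered sums over uniform subsets *)

Definition swap (I : finType) (S : {set I}) (k l : I) : {set I} :=
  l |: (S :\ k).

Lemma card_swap (I : finType) (S : {set I}) k l :
  k \in S -> l \notin S -> #|swap S k l| = #|S|.
Proof.
by move=> kS lS; rewrite cardsU1 !inE (negPf lS) andbF [RHS](cardsD1 k) kS.
Qed.

Lemma swapK (I : finType) (S : {set I}) k l :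
  k \in S -> l \notin S -> swap (swap S k l) l k = S.
Proof.
move=> kS lS; apply/setP => i; rewrite !inE.
have [->|ik] := eqVneq i k; first by rewrite kS.
by have [->|] := eqVneq i l => //=; rewrite ?(negPf lS).
Qed.

(** Exchangeability: [(S, k, l) -> (swap S k l, l, k)] is an involution of the triples with [k] in
    [S] and [l] outside. *)
Lemma sum_swap (V : nmodType) (I : finType) m (F : {set I} -> I -> I -> V) :
  \sum_(S : {set I} | #|S| == m) \sum_(k in S) \sum_(l in ~: S) F S k l =
  \sum_(S : {set I} | #|S| == m) \sum_(k in S) \sum_(l in ~: S)
    F (swap S k l) l k.
Proof.
under [LHS]eq_bigr do rewrite pair_big_dep /=.
under [RHS]eq_bigr do rewrite pair_big_dep /=.
rewrite [LHS]pair_big_dep [RHS]pair_big_dep /=.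
pose h (x : {set I} * (I * I)) := (swap x.1 x.2.1 x.2.2, (x.2.2, x.2.1)).
pose P (x : {set I} * (I * I)) :=
  (#|x.1| == m) && ((x.2.1 \in x.1) && (x.2.2 \in ~: x.1)).
rewrite (reindex_onto h h) /=; last first.
  move=> [S [k l]] /= /andP[_]; rewrite inE => /andP[kS lS].
  by rewrite /h /= swapK.
apply: eq_bigl => -[S [k l]] /=.
apply/idP/idP.
  (* [reindex_onto] leaves the equation [h (h x) = x]; that [k] lies in [S] and [l] does not is read
     off from it. *)
  rewrite /h /= => /andP[/andP[cS /andP[_]]].
  rewrite inE => kN /eqP[ES].
  have kS : k \in S by rewrite -ES !inE eqxx.
  have kl : k != l by apply: contraNN kN => /eqP ->; rewrite !inE eqxx.
  have lS : l \notin S by rewrite -ES !inE eqxx /= orbF eq_sym.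
  by rewrite -(card_swap kS lS) cS kS inE lS.
move=> /andP[cS /andP[kS]]; rewrite inE => lS.
rewrite card_swap // cS /h /= swapK // eqxx !inE !eqxx /= andbT.
by rewrite orbF; apply: contraNneq lS => <-.
Qed.

Definition centered_sum (R : fieldType) (I : finType) (m d : nat)
    (Y : I -> 'M[R]_d) (S : {set I}) : 'M[R]_d :=
  \sum_(k in S) Y k - (m%:R / #|I|%:R) *: \sum_k Y k.

Lemma centered_sum_tr (R : fieldType) (I : finType) (m d : nat)
    (Y : I -> 'M[R]_d) (S : {set I}) :
  (forall k, (Y k)^T = Y k) -> (centered_sum m Y S)^T = centered_sum m Y S.
Proof.
move=> Ys; rewrite /centered_sum linearB /= linearZ /=.
have E (P : pred I) : (\sum_(k | P k) Y k)^T = \sum_(k | P k) Y k.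
  by rewrite linear_sum; apply: eq_bigr => i _; exact: Ys.
by rewrite !E.
Qed.

Lemma centered_sum_swap (R : fieldType) (I : finType) (m d : nat)
    (Y : I -> 'M[R]_d) (S : {set I}) k l :
  k \in S -> l \notin S ->
  centered_sum m Y S - centered_sum m Y (swap S k l) = Y k - Y l.
Proof.
move=> kS lS; rewrite /centered_sum opprB addrA subrK.
rewrite /swap big_setU1 ?inE ?(negPf lS) ?andbF //= (big_setD1 k kS) /=.
by rewrite opprD addrA addrAC addrK.
Qed.

(** With [N = #|I|], the double sum is [(N - m)] times the sum over [S] minus [m] times the sum
    outside [S], that is, [N] times the sum over [S] minus [m] times the full sum. *)
Lemma sum_swap_differences (R : numFieldType) (I : finType) (m d : nat)
    (Y : I -> 'M[R]_d) (S : {set I}) : #|S| = m -> (0 < #|I|)%N ->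
  \sum_(k in S) \sum_(l in ~: S) (Y k - Y l) =
  #|I|%:R *: centered_sum m Y S.
Proof.
move=> cS I0.
have I0' : #|I|%:R != 0 :> R by rewrite pnatr_eq0 -lt0n.
under eq_bigr do rewrite big_split /= sumr_const sumrN.
rewrite big_split /= sumr_const cS sumrMnl.
have E : \sum_(l in ~: S) Y l = \sum_k Y k - \sum_(k in S) Y k.
  rewrite (bigID (mem S) predT) /= addrC addrK.
  by apply: eq_bigl => i; rewrite inE.
rewrite E mulNrn mulrnBl opprB addrA -mulrnDr.
rewrite -{1}cS addnC cardsC /centered_sum scalerBr scalerA mulrC.
by rewrite divfK // !scaler_nat.
Qed.

Lemma mxtrace_gram_ge0 (R : realDomainType) m n (X : 'M[R]_(m, n)) :
  0 <= \tr (X *m X^T).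
Proof.
by apply: sumr_ge0 => i _; rewrite mxE sumr_ge0 // => j _; rewrite mxE -expr2 sqr_ge0.
Qed.

Lemma trace_sqr_exp_ge0 (R : realDomainType) n (A X : 'M[R]_n) k :
  A^T = A -> X^T = X -> 0 <= \tr (X *m X *m A ^+ k.*2).
Proof.
move=> As Xs; rewrite mxtrace_exp_gram // -{2}Xs mulmxA -mulmxA -trmx_mul.
exact: mxtrace_gram_ge0.
Qed.

(** Parallelogram identity: the discarded term is the nonnegative one with [(X + Y) *m (X + Y)]. *)
Lemma trace_sqrB_le (R : realDomainType) n (A X Y : 'M[R]_n) k :
  A^T = A -> X^T = X -> Y^T = Y ->
  \tr ((X - Y) *m (X - Y) *m A ^+ k.*2) <=
  2 * (\tr (X *m X *m A ^+ k.*2) + \tr (Y *m Y *m A ^+ k.*2)).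
Proof.
move=> As Xs Ys; have := @trace_sqr_exp_ge0 _ _ A (X + Y) k As.
rewrite linearD /= Xs Ys => /(_ erefl).
have -> : 2 * (\tr (X *m X *m A ^+ k.*2) + \tr (Y *m Y *m A ^+ k.*2)) =
    \tr ((X - Y) *m (X - Y) *m A ^+ k.*2) +
    \tr ((X + Y) *m (X + Y) *m A ^+ k.*2).
  have trN (Q : 'M[R]_n) : \tr (- Q) = - \tr Q by rewrite raddfN.
  rewrite !mulmxDl !mulmxDr !mulNmx !mulmxN !mulmxDl !mulNmx.
  by rewrite !(mxtraceD, trN); ring.
lra.
Qed.

(* Exchangeable pairs: for [k] in [S] and [l] outside, the differences [Y k - Y l]
   sum to [#|I|] times the centered sum, and swapping [k] and [l] changes the
   centered sum by exactly [Y k - Y l]; symmetrizing leaves only differences of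
   odd powers. *)
Lemma moment_recursion (R : rcfType) (I : finType) (m d : nat)
    (Y : I -> 'M[R]_d) p : (0 < #|I|)%N -> (forall k, (Y k)^T = Y k) ->
  \sum_(S : {set I} | #|S| == m) \tr (centered_sum m Y S ^+ p.*2.+2) <=
  p.*2.+1%:R * \sum_(S : {set I} | #|S| == m)
    \tr ((\sum_(k in S) Y k *m Y k + (m%:R / #|I|%:R) *: \sum_k Y k *m Y k)
         *m centered_sum m Y S ^+ p.*2).
Proof.
move=> I0 Ys; set Z := centered_sum m Y.
have Zs S : (Z S)^T = Z S by apply: centered_sum_tr.
have NI : 0 < #|I|%:R :> R by rewrite ltr0n.
pose T (F : {set I} -> I -> I -> R) :=
  \sum_(S : {set I} | #|S| == m) \sum_(k in S) \sum_(l in ~: S) F S k l.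
have TD F G : T F + T G = T (fun S k l => F S k l + G S k l).
  rewrite /T -big_split; apply: eq_bigr => S _; rewrite -big_split.
  by apply: eq_bigr => k _; rewrite -big_split.
have TZ c F : c * T F = T (fun S k l => c * F S k l).
  rewrite /T mulr_sumr; apply: eq_bigr => S _; rewrite mulr_sumr.
  by apply: eq_bigr => k _; rewrite mulr_sumr.
have Tsw F : T F = T (fun S k l => F (swap S k l) l k) := sum_swap m F.
have Tle F G :
    (forall (S : {set I}) k l, k \in S -> l \notin S -> F S k l <= G S k l) ->
    T F <= T G.
  move=> FG; apply: ler_sum => S _; apply: ler_sum => k kS.
  by apply: ler_sum => l; rewrite inE => lS; apply: FG.
pose G S k l := \tr ((Y k - Y l) *m Z S ^+ p.*2.+1).
pose H S k l := \tr ((Y k - Y l) *m (Y k - Y l) *m Z S ^+ p.*2).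
have GT : #|I|%:R * \sum_(S : {set I} | #|S| == m) \tr (Z S ^+ p.*2.+2) = T G.
  rewrite mulr_sumr /T; apply: eq_bigr => S /eqP cS.
  transitivity (\tr ((#|I|%:R *: Z S) *m Z S ^+ p.*2.+1)).
    by rewrite -scalemxAl mxtraceZ mulmxE -exprS.
  rewrite -sum_swap_differences // mulmx_suml raddf_sum /=.
  apply: eq_bigr => k _; rewrite mulmx_suml raddf_sum /=.
  by apply: eq_bigr.
have GH : T G <= p.*2.+1%:R / 2 * T H.
  have : T G + T G <= p.*2.+1%:R / 2 * (T H + T H).
    rewrite {2}[T G]Tsw {2}[T H]Tsw !TD TZ; apply: Tle => S k l kS lS.
    rewrite /G /H -[Y l - Y k]opprB mulNmx raddfN /= -raddfB -mulmxBr.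
    rewrite mulNmx mulmxN opprK -mxtraceD -mulmxDr.
    rewrite -(centered_sum_swap m Y kS lS).
    exact: trace_subr_odd_powers_le.
  by lra.
pose q S k := \tr (Y k *m Y k *m Z S ^+ p.*2).
have q0 S k : 0 <= q S k by apply: trace_sqr_exp_ge0.
(* Crude counting: [q S k] is repeated [#|~: S| <= #|I|] times, while [q S l] is repeated [m] times
   and its sum over the complement is extended to all indices. *)
have Hq : T H <= 2 * \sum_(S : {set I} | #|S| == m)
    (#|I|%:R * \sum_(k in S) q S k + m%:R * \sum_k q S k).
  apply: (@le_trans _ _ (2 * T (fun S k l => q S k + q S l))).
    by rewrite TZ; apply: Tle => S k l _ _; apply: trace_sqrB_le.
  rewrite ler_wpM2l //; apply: ler_sum => S /eqP cS.
  under eq_bigr do rewrite big_split /= sumr_const.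
  rewrite big_split /= sumr_const cS sumrMnl -[X in X + _ <= _]mulr_natl.
  rewrite -[X in _ + X <= _]mulr_natl; apply: lerD.
    rewrite ler_wpM2r ?sumr_ge0 // ler_nat; exact: max_card.
  rewrite ler_wpM2l // [leRHS](bigID (mem S)) /=.
  rewrite (eq_bigl (fun k => k \notin S)) ?lerDr ?sumr_ge0 // => k.
  by rewrite inE.
rewrite -(ler_pM2l NI) GT (le_trans GH) //.
apply: (le_trans (ler_wpM2l _ Hq)); first by rewrite divr_ge0.
rewrite mulrA divfK ?pnatr_eq0 // mulrCA ler_wpM2l //.
rewrite mulr_sumr le_eqVlt; apply/orP; left; apply/eqP.
apply: eq_bigr => S _.
rewrite mulmxDl mxtraceD -scalemxAl mxtraceZ mulrDr mulrA.
rewrite [in RHS]mulrCA mulfV ?gt_eqF // mulr1 !mulmx_suml !raddf_sum /=.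
by [].
Qed.

(** * Scalar inequalities that close the recursion, and the moment bounds *)

Lemma exprn_double_sqr (R : pzRingType) (x : R) p : x ^+ p.*2 = (x ^+ 2) ^+ p.
Proof. by rewrite -exprM mul2n. Qed.

(** Applied to each eigenvalue [a] of a centered sum. The last hypothesis bounds the linear factor
    by half a square at the level [L]. By homogeneity this persists for [|a| >= L]; below [L],
    everything is bounded by its value at [L]. The half of [a ^+ p.*2.+2] is absorbed afterwards by
    the moment on the left. *)
Lemma linear_power_young (R : realFieldType) (a c w L : R) p :
  0 <= c -> 0 <= w -> 0 < L -> c * (L + 2 * w) <= L ^+ 2 / 2 ->
  c * (a + 2 * w) * a ^+ p.*2 <= a ^+ p.*2.+2 / 2 + L ^+ p.*2.+2 / 2.
Proof.
move=> c0 w0 L0 H; rewrite -doubleS !exprn_double_sqr ![_ ^+ p.+1]exprS.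
have [La|aL] := lerP L `|a|.
  have a2 : c * (a + 2 * w) <= a ^+ 2 / 2.
    have H1 : c * (`|a| + 2 * w) <= `|a| ^+ 2 / 2.
      have aL : 1 <= `|a| / L by rewrite ler_pdivlMr // mul1r.
      have a0 : 0 <= `|a| / L by apply: le_trans aL.
      have := ler_wpM2l a0 H.
      have -> : `|a| / L * (L ^+ 2 / 2) = `|a| * L / 2.
        by field; rewrite gt_eqF.
      have : `|a| * L <= `|a| * `|a| by rewrite ler_wpM2l.
      have : c * (`|a| + 2 * w) <= `|a| / L * (c * (L + 2 * w)).
        have -> : `|a| / L * (c * (L + 2 * w)) = c * (`|a| + `|a| / L * (2 * w)).
          by field; rewrite gt_eqF.
        rewrite ler_wpM2l // lerD2l; have : 0 <= 2 * w by rewrite mulr_ge0.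
        by move=> w2; rewrite ler_peMl.
      by rewrite -expr2; lra.
    rewrite -normrX (ger0_norm (sqr_ge0 a)) in H1; apply: le_trans H1.
    by rewrite ler_wpM2l // lerD2r ler_norm.
  apply: (@le_trans _ _ (a ^+ 2 / 2 * (a ^+ 2) ^+ p)).
    by rewrite ler_wpM2r // exprn_ge0 ?sqr_ge0.
  rewrite mulrAC lerDl divr_ge0 // mulr_ge0 ?sqr_ge0 //.
  by rewrite exprn_ge0 ?sqr_ge0.
have aL2 : a ^+ 2 <= L ^+ 2.
  by rewrite -(ger0_norm (sqr_ge0 a)) normrX lerXn2r ?nnegrE // ltW.
apply: (@le_trans _ _ (L ^+ 2 / 2 * (L ^+ 2) ^+ p)); last first.
  rewrite mulrAC lerDr divr_ge0 // mulr_ge0 ?sqr_ge0 //.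
  by rewrite exprn_ge0 ?sqr_ge0.
apply: (@le_trans _ _ (L ^+ 2 / 2 * (a ^+ 2) ^+ p)).
  apply: ler_wpM2r; first by rewrite exprn_ge0 ?sqr_ge0.
  apply: (le_trans _ H); apply: ler_wpM2l => //.
  by rewrite lerD2r (le_trans (ler_norm a)) // ltW.
by rewrite ler_wpM2l ?divr_ge0 ?sqr_ge0 // lerXn2r ?nnegrE ?sqr_ge0.
Qed.

(** Separates an eigenvalue [z] of the sum from an eigenvalue [a] of its variance proxy. Comparing
    [z ^+ 2] with [X] gives half of the power of [z] or half of [X ^+ p.+1]. In turn
    [X <= 4 c max(V, |a|)], and when [|a| > V] the factor [(|a| / V) ^ (p + 1)] may be squared,
    which makes it an even power and hence usable under a trace. *)
Lemma product_power_young (R : realFieldType) (a z c w V : R) p :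
  0 <= c -> 0 <= w -> 0 < V -> 2 * w <= V ->
  c * (a + 2 * w) * z ^+ p.*2 <=
  z ^+ p.*2.+2 / 2 +
    (4 * c * V) ^+ p.+1 / 2 * (1 + a ^+ p.*2.+2 / V ^+ p.*2.+2).
Proof.
move=> c0 w0 V0 wV; pose X := 2 * c * (`|a| + 2 * w).
have X0 : 0 <= X by rewrite !mulr_ge0 // addr_ge0 // mulr_ge0.
have XV : X ^+ p.+1 <= (4 * c * V) ^+ p.+1 * (1 + a ^+ p.*2.+2 / V ^+ p.*2.+2).
  have r0 : 0 <= (4 * c * V) ^+ p.+1.
    by rewrite exprn_ge0 // !mulr_ge0 // ltW.
  have e0 : 0 <= a ^+ p.*2.+2 / V ^+ p.*2.+2.
    by rewrite -doubleS !exprn_double_sqr divr_ge0 // exprn_ge0 ?sqr_ge0.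
  have [aV|Va] := lerP `|a| V.
    apply: (@le_trans _ _ ((4 * c * V) ^+ p.+1)).
      rewrite lerXn2r ?nnegrE // /X; last by nra.
      by rewrite !mulr_ge0 // ltW.
    by rewrite ler_peMr // lerDl.
  have t1 : 1 <= `|a| / V by rewrite ler_pdivlMr // mul1r ltW.
  have -> : a ^+ p.*2.+2 / V ^+ p.*2.+2 = (`|a| / V) ^+ p.+1 * (`|a| / V) ^+ p.+1.
    rewrite -exprD addnn doubleS expr_div_n -normrX ger0_norm //.
    by rewrite exprn_even_ge0 //= negbK odd_double.
  have t2 : 1 <= (`|a| / V) ^+ p.+1 by rewrite exprn_ege1.
  apply: (@le_trans _ _ ((4 * c * V) ^+ p.+1 * (`|a| / V) ^+ p.+1)).
    rewrite -exprMn lerXn2r ?nnegrE //.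
      by rewrite !mulr_ge0 ?invr_ge0 // ltW.
    have -> : 4 * c * V * (`|a| / V) = 4 * c * `|a| by field; rewrite gt_eqF.
    by rewrite /X; nra.
  rewrite ler_wpM2l //.
  apply: (@le_trans _ _ ((`|a| / V) ^+ p.+1 * (`|a| / V) ^+ p.+1)).
    by rewrite ler_peMr // (le_trans _ t2).
  by rewrite lerDr.
apply: (@le_trans _ _ (z ^+ p.*2.+2 / 2 + X ^+ p.+1 / 2)); last first.
  by rewrite lerD2l [leRHS]mulrAC ler_wpM2r ?invr_ge0.
have aX : c * (a + 2 * w) <= X / 2.
  have -> : X / 2 = c * (`|a| + 2 * w) by rewrite /X; field.
  by rewrite ler_wpM2l // lerD2r ler_norm.
have z2 := sqr_ge0 z.
rewrite -doubleS !exprn_double_sqr.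
apply: (@le_trans _ _ (X / 2 * (z ^+ 2) ^+ p)).
  by rewrite ler_wpM2r // exprn_ge0.
rewrite mulrAC.
have [Xz|zX] := lerP X (z ^+ 2).
  apply: (@le_trans _ _ ((z ^+ 2) ^+ p.+1 / 2)); last first.
    by rewrite lerDl divr_ge0 // exprn_ge0.
  apply: ler_wpM2r; first by rewrite invr_ge0.
  by rewrite [(z ^+ 2) ^+ p.+1]exprS; apply: ler_wpM2r => //; rewrite exprn_ge0.
apply: (@le_trans _ _ (X ^+ p.+1 / 2)); last first.
  by rewrite lerDr divr_ge0 // exprn_ge0.
apply: ler_wpM2r; first by rewrite invr_ge0.
rewrite [X ^+ p.+1]exprS; apply: ler_wpM2l => //.
by rewrite lerXn2r ?nnegrE // ltW.
Qed.

Definition quad_form (R : pzSemiRingType) d (X : 'M[R]_d) (x : 'rV[R]_d) : R :=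
  (x *m X *m x^T) 0 0.

Lemma quad_formD (R : pzSemiRingType) d (X X' : 'M[R]_d) x :
  quad_form (X + X') x = quad_form X x + quad_form X' x.
Proof. by rewrite /quad_form mulmxDr mulmxDl mxE. Qed.

Lemma quad_formZ (R : comPzSemiRingType) d c (X : 'M[R]_d) x :
  quad_form (c *: X) x = c * quad_form X x.
Proof. by rewrite /quad_form -scalemxAr -scalemxAl mxE. Qed.

Lemma quad_form_sum (R : pzSemiRingType) d (J : finType) (P : pred J)
    (X : J -> 'M[R]_d) x :
  quad_form (\sum_(k | P k) X k) x = \sum_(k | P k) quad_form (X k) x.
Proof. by rewrite /quad_form mulmx_sumr mulmx_suml summxE. Qed.

Lemma quad_form1 (R : pzSemiRingType) d (x : 'rV[R]_d) :
  quad_form 1%:M x = (x *m x^T) 0 0.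
Proof. by rewrite /quad_form mulmx1. Qed.

Lemma sum_subsets_const (R : pzSemiRingType) (I : finType) m (x : R) :
  \sum_(S : {set I} | #|S| == m) x = #|[set S : {set I} | #|S| == m]%SET|%:R * x.
Proof.
by rewrite mulr_natl -sumr_const; apply: eq_bigl => S; rewrite inE.
Qed.

(** The mean of [D] enters twice, once from centering the sum over [S] and once from the
    deterministic half of the variance proxy; hence [2 * w]. *)
Lemma dominated_squares_trace_le (R : rcfType) (I : finType) (m d p : nat)
    (Y D : I -> 'M[R]_d) (c w : R) (S : {set I}) :
  (forall k, (Y k)^T = Y k) -> 0 <= c ->
  (forall k x, quad_form (Y k *m Y k) x <= c * quad_form (D k) x) ->
  (forall x, m%:R / #|I|%:R * quad_form (\sum_k D k) x <= w * quad_form 1%:M x) ->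
  \tr ((\sum_(k in S) Y k *m Y k + (m%:R / #|I|%:R) *: \sum_k Y k *m Y k)
         *m centered_sum m Y S ^+ p.*2) <=
  c * \tr ((centered_sum m D S + (2 * w)%:M) *m centered_sum m Y S ^+ p.*2).
Proof.
move=> Ys c0 YD Dw; rewrite -mxtraceZ scalemxAl.
apply: trace_quad_le => [|x]; first exact: centered_sum_tr.
rewrite -!/(quad_form _ _) /centered_sum quad_formZ !quad_formD -scaleN1r.
rewrite -scalemx1 !quad_formZ !quad_form_sum.
have mI0 : 0 <= m%:R / #|I|%:R :> R by rewrite divr_ge0.
have H1 : \sum_(k in S) quad_form (Y k *m Y k) x <=
    c * \sum_(k in S) quad_form (D k) x.
  by rewrite mulr_sumr; apply: ler_sum => k _; apply: YD.
have H2 : m%:R / #|I|%:R * \sum_k quad_form (Y k *m Y k) x <=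
    c * (m%:R / #|I|%:R * \sum_k quad_form (D k) x).
  rewrite mulrCA ler_wpM2l // mulr_sumr.
  by apply: ler_sum => k _; apply: YD.
have H3 := ler_wpM2l c0 (Dw x); rewrite quad_form_sum in H3.
by lra.
Qed.

(* For positive terms the variance proxy is again a centered sum, so the
   recursion closes on itself. *)
Lemma positive_moment_bound (R : rcfType) (I : finType) (m d p : nat)
    (Y : I -> 'M[R]_d) (B w L : R) :
  (0 < #|I|)%N -> (forall k, (Y k)^T = Y k) -> 0 <= B -> 0 <= w -> 0 < L ->
  (forall k x, quad_form (Y k *m Y k) x <= B * quad_form (Y k) x) ->
  (forall x, m%:R / #|I|%:R * quad_form (\sum_k Y k) x <= w * quad_form 1%:M x) ->
  p.*2.+1%:R * B * (L + 2 * w) <= L ^+ 2 / 2 ->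
  \sum_(S : {set I} | #|S| == m) \tr (centered_sum m Y S ^+ p.*2.+2) <=
  #|[set S : {set I} | #|S| == m]%SET|%:R * d%:R * L ^+ p.*2.+2.
Proof.
move=> I0 Ys B0 w0 L0 YB Yw HL; set K := #|_|.
set c := p.*2.+1%:R * B in HL; have c0 : 0 <= c by rewrite mulr_ge0.
set T := leLHS; suff : T <= T / 2 + K%:R * d%:R * L ^+ p.*2.+2 / 2 by lra.
apply: (le_trans (moment_recursion m p I0 Ys)).
have -> : K%:R * d%:R * L ^+ p.*2.+2 / 2 =
    \sum_(S : {set I} | #|S| == m) d%:R * L ^+ p.*2.+2 / 2.
  by rewrite sum_subsets_const !mulrA.
rewrite [T / 2]mulr_suml -big_split mulr_sumr; apply: ler_sum => S cS /=.
set Z := centered_sum m Y S; have Zs : Z^T = Z by apply: centered_sum_tr.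
have H := dominated_squares_trace_le p S Ys B0 YB Yw.
apply: (le_trans (ler_wpM2l (ler0n _ _) H)); rewrite mulrA -/c -/Z.
have [a Ea] := trace_pow_spectrum Zs.
have -> : \tr ((Z + (2 * w)%:M) *m Z ^+ p.*2) =
    \sum_i (a i + 2 * w) * a i ^+ p.*2.
  rewrite mulmxDl mxtraceD mul_scalar_mx mxtraceZ mulmxE -exprS !Ea.
  rewrite mulr_sumr -big_split; apply: eq_bigr => i _ /=.
  by rewrite [_ ^+ p.*2.+1]exprS [RHS]mulrDl.
have -> : d%:R * L ^+ p.*2.+2 / 2 = \sum_(i < d) L ^+ p.*2.+2 / 2.
  by rewrite sumr_const card_ord -[RHS]mulr_natl mulrA.
rewrite Ea mulr_suml -big_split mulr_sumr; apply: ler_sum => i _ /=.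
by rewrite mulrA; apply: linear_power_young.
Qed.

(** Here the squares of the [Y k] are controlled by other matrices [D k], so the proxy is a second
    centered sum whose moment is an input. The dimension is counted twice: once for the constant [1]
    in [product_power_young], once for the moment of [D] measured in units of [V]. *)
Lemma dominated_moment_bound (R : rcfType) (I : finType) (m d p : nat)
    (Y D : I -> 'M[R]_d) (A w V : R) :
  (0 < #|I|)%N -> (forall k, (Y k)^T = Y k) -> (forall k, (D k)^T = D k) ->
  0 <= A -> 0 <= w -> 0 < V -> 2 * w <= V ->
  (forall k x, quad_form (Y k *m Y k) x <= A * quad_form (D k) x) ->
  (forall x, m%:R / #|I|%:R * quad_form (\sum_k D k) x <= w * quad_form 1%:M x) ->
  let K := #|[set S : {set I} | #|S| == m]%SET|%:R : R in
  \sum_(S : {set I} | #|S| == m) \tr (centered_sum m D S ^+ p.*2.+2) <=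
    K * d%:R * V ^+ p.*2.+2 ->
  \sum_(S : {set I} | #|S| == m) \tr (centered_sum m Y S ^+ p.*2.+2) <=
    K * (2 * d%:R) * (4 * (p.*2.+1%:R * A) * V) ^+ p.+1.
Proof.
move=> I0 Ys Ds A0 w0 V0 wV YD Dw K HD.
set c := p.*2.+1%:R * A; have c0 : 0 <= c by rewrite mulr_ge0.
set W := (4 * c * V) ^+ p.+1.
have W0 : 0 <= W by rewrite exprn_ge0 // !mulr_ge0 // ltW.
set T := leLHS; suff : T <= T / 2 + K * (2 * d%:R) * W / 2 by lra.
pose TD := \sum_(S : {set I} | #|S| == m) \tr (centered_sum m D S ^+ p.*2.+2).
have V2 : 0 < V ^+ p.*2.+2 by rewrite exprn_gt0.
have HD' : TD / V ^+ p.*2.+2 <= K * d%:R by rewrite ler_pdivrMr.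
suff : T <= T / 2 + W / 2 * (K * d%:R + TD / V ^+ p.*2.+2).
  move=> /le_trans; apply; rewrite lerD2l.
  apply: (@le_trans _ _ (W / 2 * (K * d%:R + K * d%:R))).
    by rewrite ler_wpM2l ?divr_ge0 // lerD2l.
  by rewrite le_eqVlt; apply/orP; left; apply/eqP; field.
apply: (le_trans (moment_recursion m p I0 Ys)).
have -> : T / 2 + W / 2 * (K * d%:R + TD / V ^+ p.*2.+2) =
    \sum_(S : {set I} | #|S| == m) (\tr (centered_sum m Y S ^+ p.*2.+2) / 2
      + W / 2 * (d%:R + \tr (centered_sum m D S ^+ p.*2.+2) / V ^+ p.*2.+2)).
  rewrite big_split /= -mulr_suml -mulr_sumr big_split /= -mulr_suml.
  by rewrite sum_subsets_const.
rewrite mulr_sumr; apply: ler_sum => S cS /=.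
set Z := centered_sum m Y S; have Zs : Z^T = Z by apply: centered_sum_tr.
set X := centered_sum m D S; have Xs : X^T = X by apply: centered_sum_tr.
have H := dominated_squares_trace_le p S Ys A0 YD Dw.
apply: (le_trans (ler_wpM2l (ler0n _ _) H)); rewrite mulrA -/c -/Z -/X.
have [v [a [z [v0 E]]]] := trace_pow_joint Xs Zs.
pose Sv (f : 'I_d -> 'I_d -> R) := \sum_i \sum_j v i j * f i j.
have SD f g : Sv f + Sv g = Sv (fun i j => f i j + g i j).
  rewrite /Sv -big_split; apply: eq_bigr => i _ /=; rewrite -big_split.
  by apply: eq_bigr => j _ /=; rewrite mulrDr.
have SZ b f : b * Sv f = Sv (fun i j => b * f i j).
  rewrite /Sv mulr_sumr; apply: eq_bigr => i _ /=; rewrite mulr_sumr.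
  by apply: eq_bigr => j _ /=; rewrite mulrCA.
have Ez k : \tr (Z ^+ k) = Sv (fun i j => z j ^+ k).
  rewrite -[Z ^+ k]mul1mx -[1%:M](expr0 X) E.
  by do 2!apply: eq_bigr => ? _; rewrite expr0 mul1r.
have Ea k : \tr (X ^+ k) = Sv (fun i j => a i ^+ k).
  rewrite -[X ^+ k]mulmx1 -[1%:M](expr0 Z) E.
  by do 2!apply: eq_bigr => ? _; rewrite expr0 mulr1.
have Ed : d%:R = Sv (fun i j => 1).
  rewrite -[d%:R](mxtrace1 R d) -[1%:M](expr0 X) Ea.
  by do 2!apply: eq_bigr => ? _; rewrite expr0.
have -> : \tr ((X + (2 * w)%:M) *m Z ^+ p.*2) =
    Sv (fun i j => (a i + 2 * w) * z j ^+ p.*2).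
  rewrite mulmxDl mxtraceD mul_scalar_mx mxtraceZ -[X in X *m _]expr1 E Ez.
  rewrite -/(Sv _) SZ SD; apply: eq_bigr => i _; apply: eq_bigr => j _ /=.
  by rewrite expr1 [in RHS]mulrDl.
rewrite Ez Ea Ed ![Sv _ / _]mulrC !(SZ, SD).
apply: ler_sum => i _; apply: ler_sum => j _; apply: ler_wpM2l => //.
by have := product_power_young (a i) (z j) p c0 w0 V0 wV; rewrite -/W; lra.
Qed.

(** * Frobenius geometry and the nuclear norm *)

Lemma mxdotE (R : realType) p q (A X : 'M[R]_(p, q)) :
  mxdot A X = \sum_i \sum_j A i j * X i j.
Proof.
rewrite /mxdot /mxtrace exchange_big; apply: eq_bigr => j _ /=.
by rewrite mxE; apply: eq_bigr => i _; rewrite mxE.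
Qed.

Lemma mxdotC (R : realType) p q (A X : 'M[R]_(p, q)) : mxdot A X = mxdot X A.
Proof. by rewrite /mxdot -mxtrace_tr trmx_mul trmxK. Qed.

Lemma mxdotDl (R : realType) p q (A B X : 'M[R]_(p, q)) :
  mxdot (A + B) X = mxdot A X + mxdot B X.
Proof. by rewrite /mxdot linearD /= mulmxDl mxtraceD. Qed.

Lemma mxdotDr (R : realType) p q (A B X : 'M[R]_(p, q)) :
  mxdot X (A + B) = mxdot X A + mxdot X B.
Proof. by rewrite !(mxdotC X) mxdotDl. Qed.

Lemma mxdotZl (R : realType) p q c (A X : 'M[R]_(p, q)) :
  mxdot (c *: A) X = c * mxdot A X.
Proof. by rewrite /mxdot linearZ /= -scalemxAl mxtraceZ. Qed.

Lemma mxdotZr (R : realType) p q c (A X : 'M[R]_(p, q)) :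
  mxdot A (c *: X) = c * mxdot A X.
Proof. by rewrite !(mxdotC A) mxdotZl. Qed.

Lemma mxdotNl (R : realType) p q (A X : 'M[R]_(p, q)) :
  mxdot (- A) X = - mxdot A X.
Proof. by rewrite -scaleN1r mxdotZl mulN1r. Qed.

Lemma mxdotNr (R : realType) p q (A X : 'M[R]_(p, q)) :
  mxdot A (- X) = - mxdot A X.
Proof. by rewrite !(mxdotC A) mxdotNl. Qed.

Lemma mxdotBl (R : realType) p q (A B X : 'M[R]_(p, q)) :
  mxdot (A - B) X = mxdot A X - mxdot B X.
Proof. by rewrite mxdotDl mxdotNl. Qed.

Lemma mxdotBr (R : realType) p q (A B X : 'M[R]_(p, q)) :
  mxdot X (A - B) = mxdot X A - mxdot X B.
Proof. by rewrite mxdotDr mxdotNr. Qed.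

Lemma mxdot0l (R : realType) p q (X : 'M[R]_(p, q)) : mxdot 0 X = 0.
Proof. by rewrite -(scale0r 0) mxdotZl mul0r. Qed.

Lemma mxdot0r (R : realType) p q (X : 'M[R]_(p, q)) : mxdot X 0 = 0.
Proof. by rewrite mxdotC mxdot0l. Qed.

Lemma mxdot_suml (R : realType) p q (I : finType) (P : pred I)
    (A : I -> 'M[R]_(p, q)) X :
  mxdot (\sum_(i | P i) A i) X = \sum_(i | P i) mxdot (A i) X.
Proof.
by elim/big_rec2 : _ => [|i a b _ <-]; rewrite ?mxdot0l ?mxdotDl.
Qed.

Lemma mxdot_sumr (R : realType) p q (I : finType) (P : pred I)
    (A : I -> 'M[R]_(p, q)) X :
  mxdot X (\sum_(i | P i) A i) = \sum_(i | P i) mxdot X (A i).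
Proof. by rewrite mxdotC mxdot_suml; apply: eq_bigr => i _; rewrite mxdotC. Qed.

Lemma mxdot_mull (R : realType) p q s (A : 'M[R]_(p, q)) (B : 'M[R]_(q, s))
    (D : 'M[R]_(p, s)) :
  mxdot (A *m B) D = mxdot B (A^T *m D).
Proof. by rewrite /mxdot trmx_mul mulmxA. Qed.

Lemma mxdot_mulr (R : realType) p q s (A : 'M[R]_(p, q)) (B : 'M[R]_(q, s))
    (D : 'M[R]_(p, s)) :
  mxdot (A *m B) D = mxdot A (D *m B^T).
Proof. by rewrite /mxdot trmx_mul -mulmxA mxtrace_mulC mulmxA. Qed.

Lemma mxdot_tr (R : realType) p q (A B : 'M[R]_(p, q)) :
  mxdot A^T B^T = mxdot A B.
Proof. by rewrite /mxdot trmxK -mxtrace_tr trmx_mul trmxK mxtrace_mulC. Qed.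

Lemma mxdot_ge0 (R : realType) p q (A : 'M[R]_(p, q)) : 0 <= mxdot A A.
Proof.
by rewrite mxdotE; do 2!apply: sumr_ge0 => ? _; rewrite -expr2 sqr_ge0.
Qed.

Lemma mxdot_eq0 (R : realType) p q (A : 'M[R]_(p, q)) :
  (mxdot A A == 0) = (A == 0).
Proof.
apply/eqP/eqP => [|->]; last exact: mxdot0l.
rewrite mxdotE => /eqP; rewrite psumr_eq0 => [/allP A0|i _]; last first.
  by rewrite sumr_ge0 // => j _; rewrite -expr2 sqr_ge0.
apply/matrixP => i j; rewrite mxE; apply/eqP.
have /eqP := A0 i (mem_index_enum i).
move/eqP; rewrite psumr_eq0 => [/allP Ai|k _]; last by rewrite -expr2 sqr_ge0.
by have := Ai j (mem_index_enum j); rewrite -expr2 sqrf_eq0.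
Qed.

Lemma frob_norm_sqr (R : realType) p q (A : 'M[R]_(p, q)) :
  frob_norm A ^+ 2 = mxdot A A.
Proof. by rewrite /frob_norm sqr_sqrtr // mxdot_ge0. Qed.

Lemma frob_norm_ge0 (R : realType) p q (A : 'M[R]_(p, q)) : 0 <= frob_norm A.
Proof. exact: sqrtr_ge0. Qed.

Lemma frob_norm_le (R : realType) p q (A : 'M[R]_(p, q)) t : 0 <= t ->
  (frob_norm A <= t) = (mxdot A A <= t ^+ 2).
Proof.
by move=> t0; rewrite -frob_norm_sqr ler_pXn2r ?nnegrE ?frob_norm_ge0.
Qed.

Lemma frob_norm_eq0 (R : realType) p q (A : 'M[R]_(p, q)) :
  (frob_norm A == 0) = (A == 0).
Proof. by rewrite -mxdot_eq0 -frob_norm_sqr sqrf_eq0. Qed.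

Lemma frob_normZ (R : realType) p q c (A : 'M[R]_(p, q)) :
  frob_norm (c *: A) = `|c| * frob_norm A.
Proof.
by rewrite /frob_norm mxdotZl mxdotZr mulrA -expr2 sqrtrM ?sqr_ge0 // sqrtr_sqr.
Qed.

Lemma frob_normN (R : realType) p q (A : 'M[R]_(p, q)) :
  frob_norm (- A) = frob_norm A.
Proof. by rewrite -scaleN1r frob_normZ normrN1 mul1r. Qed.

Lemma frob_norm0 (R : realType) p q : frob_norm (0 : 'M[R]_(p, q)) = 0.
Proof. by apply/eqP; rewrite frob_norm_eq0. Qed.

Lemma mxdot_sqr_le (R : realType) p q (A B : 'M[R]_(p, q)) :
  mxdot A B ^+ 2 <= mxdot A A * mxdot B B.
Proof.
have [->|B0] := eqVneq B 0; first by rewrite !mxdot0r expr0n mulr0.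
have BB : 0 < mxdot B B by rewrite lt_def mxdot_eq0 B0 mxdot_ge0.
have := mxdot_ge0 (mxdot B B *: A - mxdot A B *: B).
rewrite !(mxdotBl, mxdotBr, mxdotZl, mxdotZr) (mxdotC B A) => H.
rewrite -subr_ge0 -(pmulr_rge0 _ BB); lra.
Qed.

Lemma mxdot_le (R : realType) p q (A B : 'M[R]_(p, q)) :
  mxdot A B <= frob_norm A * frob_norm B.
Proof.
rewrite (le_trans (ler_norm _)) // -[leLHS]sqrtr_sqr /frob_norm -sqrtrM ?mxdot_ge0 //.
by rewrite ler_wsqrtr // mxdot_sqr_le.
Qed.

Lemma frob_normD (R : realType) p q (A B : 'M[R]_(p, q)) :
  frob_norm (A + B) <= frob_norm A + frob_norm B.
Proof.
rewrite frob_norm_le ?addr_ge0 ?frob_norm_ge0 // !(mxdotDl, mxdotDr) (mxdotC B A).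
have := mxdot_le A B; rewrite sqrrD !frob_norm_sqr; lra.
Qed.

Lemma frob_norm_mulmx (R : realType) p q s (A : 'M[R]_(p, q)) (B : 'M[R]_(q, s)) :
  frob_norm (A *m B) <= frob_norm A * frob_norm B.
Proof.
rewrite frob_norm_le ?mulr_ge0 ?frob_norm_ge0 // exprMn !frob_norm_sqr.
rewrite [leLHS]mxdotE.
have -> : mxdot A A * mxdot B B = \sum_i \sum_j
    mxdot (row i A) (row i A) * mxdot (col j B) (col j B).
  rewrite !mxdotE [X in _ * X]exchange_big big_distrlr /=.
  apply: eq_bigr => i _; apply: eq_bigr => j _; rewrite !mxdotE big_ord1.
  congr (_ * _); first by apply: eq_bigr => k _; rewrite !mxE.
  by apply: eq_bigr => k _; rewrite big_ord1 !mxE.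
apply: ler_sum => i _; apply: ler_sum => j _; rewrite -expr2.
have -> : (A *m B) i j = mxdot (row i A) (col j B)^T.
  rewrite mxdotE big_ord1 mxE.
  by apply: eq_bigr => k _; rewrite !mxE.
by rewrite (le_trans (mxdot_sqr_le _ _)) // mxdot_tr.
Qed.

Lemma mxdot_mxvec (R : realType) p q (A B : 'M[R]_(p, q)) :
  mxdot (mxvec A) (mxvec B) = mxdot A B.
Proof.
rewrite !mxdotE big_ord1 (reindex _ (curry_mxvec_bij p q)) pair_bigA /=.
by apply: eq_bigr => -[i j] _; rewrite !mxvecE.
Qed.

Lemma frob_norm_mxvec (R : realType) p q (A : 'M[R]_(p, q)) :
  frob_norm (mxvec A) = frob_norm A.
Proof. by rewrite /frob_norm mxdot_mxvec. Qed.

Lemma frob_norm_orthogonal (R : realType) n (U : 'M[R]_n) (x : 'cV[R]_n) :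
  U *m U^T = 1%:M -> frob_norm (U *m x) = frob_norm x.
Proof.
by move=> /mulmx1C UU; rewrite /frob_norm mxdot_mull mulmxA UU mul1mx.
Qed.

(** * Singular values and the nuclear norm *)

Lemma char_poly_spectral (R : fieldType) n (U : 'M[R]_n) (d : 'rV[R]_n) :
  U *m U^T = 1%:M ->
  char_poly (U^T *m diag_mx d *m U) = \prod_i ('X - (d 0 i)%:P).
Proof.
move=> UU; have UtU : U^T *m U = 1%:M by apply: mulmx1C.
have -> : \prod_i ('X - (d 0 i)%:P) = char_poly (diag_mx d).
  rewrite char_poly_trig ?diag_mx_is_trig //.
  by apply: eq_bigr => i _; rewrite mxE eqxx mulr1n.
rewrite /char_poly /char_poly_mx !map_mxM /=.
have UUp : map_mx polyC U *m map_mx polyC U^T = 1%:M.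
  by rewrite -map_mxM UU map_mx1.
have UtUp : map_mx polyC U^T *m map_mx polyC U = 1%:M.
  by rewrite -map_mxM UtU map_mx1.
rewrite [in LHS](_ : 'X%:M = map_mx polyC U^T *m 'X%:M *m map_mx polyC U); last first.
  by rewrite scalar_mxC -mulmxA UtUp mulmx1.
have UtUd : \det (map_mx polyC U^T) * \det (map_mx polyC U) = 1.
  by rewrite -det_mulmx UtUp det1.
rewrite -mulmxBl -mulmxBr !det_mulmx mulrAC UtUd mul1r.
by [].

Qed.

(** The definition runs over distinct roots weighted by multiplicity. Over any orthogonal
    diagonalization of the Gram matrix this becomes a plain sum along the diagonal, which is the
    form used from here on. *)
Lemma nuclear_norm_spectral (R : realType) p q (X : 'M[R]_(p, q))
    (U : 'M[R]_q) (d : 'rV[R]_q) :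
  U *m U^T = 1%:M -> X^T *m X = U^T *m diag_mx d *m U ->
  nuclear_norm X = \sum_i Num.sqrt (d 0 i).
Proof.
move=> UU EX; rewrite /nuclear_norm /singular_values EX char_poly_spectral //.
set chi := \prod_i _.
have Echi : chi = \prod_(x <- [seq d 0 i | i : 'I_q]) ('X - x%:P).
  by rewrite big_map big_enum.
have chi0 : chi != 0 by rewrite Echi monic_neq0 ?monic_prod_XsubC.
rewrite big_flatten big_map.
have -> : \sum_i Num.sqrt (d 0 i) =
    \sum_(x <- [seq d 0 i | i : 'I_q]) Num.sqrt x by rewrite big_map big_enum.
rewrite -[RHS]big_undup_iterop_count /= (perm_big (undup [seq d 0 i | i : 'I_q])).
  apply: eq_bigr => x _; rewrite big_nseq iter_addr_0.
  by rewrite Echi mu_prod_XsubC.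
apply: uniq_perm; rewrite ?uniq_roots ?undup_uniq // => x.
rewrite mem_undup -(roots_on_rootsR chi0) in_itv /=.
by rewrite Echi root_prod_XsubC.
Qed.

Lemma mxdot_col_spectral (R : realType) p q (X : 'M[R]_(p, q))
    (U : 'M[R]_q) (d : 'rV[R]_q) i :
  U *m U^T = 1%:M -> X^T *m X = U^T *m diag_mx d *m U ->
  mxdot (X *m col i U^T) (X *m col i U^T) = d 0 i.
Proof.
move=> UU E.
rewrite mxdot_mull mulmxA E colE -!mulmxA (mulmxA U) UU mul1mx mxdot_mull trmxK.
rewrite mulmxA UU mul1mx -colE mxdotE.
rewrite (bigD1 i) //= !big_ord1 !mxE !eqxx mul1r mulr1n big1 ?addr0 // => k ki.
by rewrite big_ord1 !mxE (negPf ki) mul0r.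
Qed.

Lemma gram_spectral (R : realType) p q (X : 'M[R]_(p, q)) :
  exists (U : 'M[R]_q) (d : 'rV[R]_q),
  [/\ U *m U^T = 1%:M, X^T *m X = U^T *m diag_mx d *m U &
      forall i, 0 <= d 0 i].
Proof.
have [|U [d [UU E]]] := @symmetric_spectral R q (X^T *m X).
  by rewrite trmx_mul trmxK.
by exists U, d; split=> // i; rewrite -(mxdot_col_spectral i UU E) mxdot_ge0.
Qed.

Lemma mxdot_orthogonal (R : realType) p q (A B : 'M[R]_(p, q)) (U : 'M[R]_q) :
  U *m U^T = 1%:M ->
  mxdot A B = \sum_i mxdot (A *m col i U^T) (B *m col i U^T).
Proof.
move=> UU; have UtU : U^T *m U = 1%:M by apply: mulmx1C.
have -> : mxdot A B = mxdot (A *m U^T) (B *m U^T).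
  by rewrite mxdot_mulr -mulmxA trmxK UtU mulmx1.
rewrite mxdotE exchange_big; apply: eq_bigr => i _; rewrite !colE !mulmxA -!colE.
by rewrite mxdotE; apply: eq_bigr => j _; rewrite big_ord1 !mxE.
Qed.

Lemma nuclear_norm_ge0 (R : realType) p q (X : 'M[R]_(p, q)) :
  0 <= nuclear_norm X.
Proof.
have [U [d [UU E d0]]] := gram_spectral X.
by rewrite (nuclear_norm_spectral UU E) sumr_ge0 // => i _; apply: sqrtr_ge0.
Qed.

Lemma nuclear_norm_eq0 (R : realType) p q (X : 'M[R]_(p, q)) :
  nuclear_norm X = 0 -> X = 0.
Proof.
have [U [d [UU E d0]]] := gram_spectral X.
rewrite (nuclear_norm_spectral UU E) => /eqP.
rewrite psumr_eq0 => [/allP H|i _]; last exact: sqrtr_ge0.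
apply/eqP; rewrite -mxdot_eq0 (mxdot_orthogonal _ _ UU) big1 // => i _.
rewrite (mxdot_col_spectral i UU E) -[LHS](sqr_sqrtr (d0 i)).
by rewrite (eqP (H i (mem_index_enum i))) expr0n.
Qed.

(** Duality of operator and nuclear norm. In the basis of right singular vectors [col i U^T],
    Cauchy-Schwarz applies to each term, and [X] maps the [i]-th vector to one of norm
    [Num.sqrt (d 0 i)]. *)
Lemma mxdot_nuclear_norm_le (R : realType) p q (G X : 'M[R]_(p, q)) rho :
  (forall x : 'cV[R]_q, frob_norm (G *m x) <= rho * frob_norm x) ->
  mxdot G X <= rho * nuclear_norm X.
Proof.
move=> HG; have [U [d [UU E d0]]] := gram_spectral X.
rewrite (nuclear_norm_spectral UU E) (mxdot_orthogonal _ _ UU) mulr_sumr.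
apply: ler_sum => i _; rewrite (le_trans (mxdot_le _ _)) //.
rewrite [X in _ * X]/frob_norm (mxdot_col_spectral i UU E).
rewrite ler_wpM2r ?sqrtr_ge0 // (le_trans (HG _)) //.
suff -> : frob_norm (col i U^T) = 1 by rewrite mulr1.
rewrite colE frob_norm_orthogonal ?trmxK ?(mulmx1C UU) //.
rewrite /frob_norm mxdotE (bigD1 i) //= big_ord1 !mxE !eqxx mul1r.
rewrite big1 ?addr0 ?sqrtr1 //.
by move=> k ki; rewrite big_ord1 !mxE (negPf ki) mul0r.
Qed.

(* [X *m K] is the partial isometry of the polar decomposition of [X]. *)
Lemma polar_factor (R : realType) p q (X : 'M[R]_(p, q)) :
  exists K : 'M[R]_q,
  [/\ forall x : 'cV[R]_q, frob_norm (X *m K *m x) <= frob_norm x,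
      mxdot (X *m K) X = nuclear_norm X
    & forall y : 'cV[R]_q, X *m y = 0 -> K *m y = 0].
Proof.
have [U [d [UU E d0]]] := gram_spectral X.
have UtU : U^T *m U = 1%:M by apply: mulmx1C.
(* [g] vanishes at the zero eigenvalues, as [0^-1 = 0] *)
pose g := \row_i (Num.sqrt (d 0 i))^-1.
pose K := U^T *m diag_mx g *m U.
have Ks : K^T = K by rewrite /K !trmx_mul trmxK tr_diag_mx mulmxA.
have EK : X^T *m X *m K = U^T *m diag_mx (\row_i Num.sqrt (d 0 i)) *m U.
  rewrite E /K !mulmxA -(mulmxA _ U U^T) UU mulmx1 -(mulmxA U^T) mulmx_diag.
  congr (_ *m diag_mx _ *m _); apply/rowP => i; rewrite !mxE.
  have [->|di] := eqVneq (d 0 i) 0; first by rewrite mul0r sqrtr0.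
  have s0 : Num.sqrt (d 0 i) != 0 by rewrite sqrtr_eq0 -ltNge lt_def di d0.
  by rewrite -{1}(sqr_sqrtr (d0 i)) expr2 mulfK.
have KE : K = U^T *m diag_mx g *m U by []; clearbody K.
exists K; split=> [x||y Xy].
- rewrite frob_norm_le ?frob_norm_ge0 // frob_norm_sqr.
  rewrite -(mulmxA X K x) [leLHS]mxdot_mull !mulmxA EK [leLHS]mxdot_mull Ks.
  rewrite !mulmxA KE -(mulmxA _ U U^T) UU mulmx1 -(mulmxA U^T) mulmx_diag.
  rewrite -!mulmxA [leLHS]mxdotC [leLHS]mxdot_mull trmxK.
  rewrite -(frob_norm_sqr x) -(frob_norm_orthogonal _ UU) frob_norm_sqr.
  set z := U *m x; rewrite mxdotE [leRHS]mxdotE; apply: ler_sum => i _.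
  rewrite !big_ord1 mul_diag_mx !mxE -mulrA ler_piMl //.
    by rewrite -expr2 sqr_ge0.
  have [->|di] := eqVneq (d 0 i) 0; first by rewrite sqrtr0 mulr0.
  have s0 : Num.sqrt (d 0 i) != 0 by rewrite sqrtr_eq0 -ltNge lt_def di d0.
  by rewrite mulVf.
- rewrite (nuclear_norm_spectral UU E) mxdotC /mxdot mulmxA EK mxtrace_mulC.
  rewrite mulmxA UU mul1mx mxtrace_diag.
  by apply: eq_bigr => i _; rewrite mxE.
have dUy : diag_mx d *m (U *m y) = 0.
  have : U *m (X^T *m X *m y) = 0 by rewrite -mulmxA Xy !mulmx0.
  by rewrite E !mulmxA UU mul1mx -mulmxA.
rewrite KE -!mulmxA (_ : diag_mx g *m (U *m y) = 0) ?mulmx0 //.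
apply/matrixP => i j; rewrite mul_diag_mx !mxE.
have /matrixP/(_ i j) := dUy; rewrite mul_diag_mx !mxE => /eqP.
rewrite mulf_eq0 => /orP[/eqP->|/eqP->]; last by rewrite mulr0.
by rewrite sqrtr0 invr0 mul0r.
Qed.

(** * Tangent space and dual certificates *)

Definition span_proj (R : realType) n r (u : 'I_r -> 'cV[R]_n) : 'M[R]_n :=
  \sum_k u k *m (u k)^T.

Lemma tr_mul_mxdot (R : realType) n (x y : 'cV[R]_n) :
  x^T *m y = (mxdot x y)%:M.
Proof. by rewrite [LHS]mx11_scalar /mxdot /mxtrace big_ord1. Qed.

Lemma mxdot_outer (R : realType) n1 n2 (x : 'cV[R]_n1) (y : 'cV[R]_n2)
    (W : 'M[R]_(n1, n2)) : mxdot (x *m y^T) W = mxdot x (W *m y).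
Proof. by rewrite mxdot_mulr trmxK. Qed.

Lemma span_proj_tr (R : realType) n r (u : 'I_r -> 'cV[R]_n) :
  (span_proj u)^T = span_proj u.
Proof.
rewrite /span_proj linear_sum; apply: eq_bigr => k _ /=.
by rewrite trmx_mul trmxK.
Qed.

Lemma span_proj_id (R : realType) n r (u : 'I_r -> 'cV[R]_n) k :
  orthonormal_family u -> span_proj u *m u k = u k.
Proof.
move=> ou; rewrite /span_proj mulmx_suml (bigD1 k) //= big1 => [|l lk].
  by rewrite -mulmxA tr_mul_mxdot ou eqxx mulmx1 addr0.
by rewrite -mulmxA tr_mul_mxdot ou (negPf lk) -scalemx1 scale0r mulmx0.
Qed.

Lemma span_projK (R : realType) n r (u : 'I_r -> 'cV[R]_n) :
  orthonormal_family u -> span_proj u *m span_proj u = span_proj u.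
Proof.
move=> ou; rewrite {2 3}/span_proj mulmx_sumr; apply: eq_bigr => k _.
by rewrite mulmxA span_proj_id.
Qed.

Lemma svd_E_mull (R : realType) n1 n2 r (u : 'I_r -> 'cV[R]_n1)
    (v : 'I_r -> 'cV[R]_n2) :
  orthonormal_family u -> span_proj u *m svd_E u v = svd_E u v.
Proof.
move=> ou; rewrite /svd_E mulmx_sumr; apply: eq_bigr => k _.
by rewrite mulmxA span_proj_id.
Qed.

Lemma svd_E_tr (R : realType) n1 n2 r (u : 'I_r -> 'cV[R]_n1)
    (v : 'I_r -> 'cV[R]_n2) : (svd_E u v)^T = svd_E v u.
Proof.
rewrite /svd_E linear_sum; apply: eq_bigr => k _ /=.
by rewrite trmx_mul trmxK.
Qed.

Lemma svd_E_mulr (R : realType) n1 n2 r (u : 'I_r -> 'cV[R]_n1)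
    (v : 'I_r -> 'cV[R]_n2) :
  orthonormal_family v -> svd_E u v *m span_proj v = svd_E u v.
Proof.
move=> ov; apply: trmx_inj.
by rewrite trmx_mul span_proj_tr !svd_E_tr svd_E_mull.
Qed.

Lemma svd_E_gram (R : realType) n1 n2 r (u : 'I_r -> 'cV[R]_n1)
    (v : 'I_r -> 'cV[R]_n2) :
  orthonormal_family u -> (svd_E u v)^T *m svd_E u v = span_proj v.
Proof.
move=> ou; rewrite svd_E_tr {1}/svd_E mulmx_suml; apply: eq_bigr => k _.
rewrite -mulmxA /svd_E mulmx_sumr (bigD1 k) //= big1 => [|l lk].
  by rewrite mulmxA tr_mul_mxdot ou eqxx mul1mx addr0.
by rewrite mulmxA tr_mul_mxdot ou eq_sym (negPf lk) -scalemx1 scale0r mul0mx.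
Qed.

Lemma frob_norm_proj_split (R : realType) n (P : 'M[R]_n) q (X : 'M[R]_(n, q)) :
  P^T = P -> P *m P = P ->
  mxdot X X = mxdot (P *m X) (P *m X) + mxdot (X - P *m X) (X - P *m X).
Proof.
move=> Pt PP; have E : mxdot (P *m X) (P *m X) = mxdot X (P *m X).
  by rewrite mxdot_mull Pt mulmxA PP.
rewrite !(mxdotBl, mxdotBr) E (mxdotC (P *m X) X); ring.
Qed.

Definition tangent_proj (R : realType) n1 n2 r (u : 'I_r -> 'cV[R]_n1)
    (v : 'I_r -> 'cV[R]_n2) (X : 'M[R]_(n1, n2)) : 'M[R]_(n1, n2) :=
  span_proj u *m X + X *m span_proj v - span_proj u *m X *m span_proj v.

Lemma tangent_proj_compl (R : realType) n1 n2 r (u : 'I_r -> 'cV[R]_n1)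
    (v : 'I_r -> 'cV[R]_n2) (X : 'M[R]_(n1, n2)) :
  X - tangent_proj u v X =
  (1%:M - span_proj u) *m X *m (1%:M - span_proj v).
Proof.
rewrite /tangent_proj mulmxBl mul1mx mulmxBr mulmx1 mulmxBl.
set a := span_proj u *m X; set b := X *m span_proj v; set c := a *m span_proj v.
by move: a b c => a b c; apply/matrixP => i j; rewrite !mxE; ring.
Qed.

Lemma compl_proj (R : realType) n (P : 'M[R]_n) : P^T = P -> P *m P = P ->
  (1%:M - P)^T = 1%:M - P /\ (1%:M - P) *m (1%:M - P) = 1%:M - P.
Proof.
move=> Pt PP; split; first by rewrite linearB /= trmx1 Pt.
by rewrite mulmxBr mulmx1 mulmxBl mul1mx PP subrr subr0.
Qed.

Lemma mxdot_two_sided_proj (R : realType) n1 n2 (P : 'M[R]_n1) (Q : 'M[R]_n2)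
    (Y Z : 'M[R]_(n1, n2)) :
  P^T = P -> P *m P = P -> Q^T = Q -> Q *m Q = Q ->
  mxdot (P *m Y *m Q) Z = mxdot (P *m Y *m Q) (P *m Z *m Q).
Proof.
move=> Pt PP Qt QQ.
rewrite -{1}QQ -{1}PP mulmxA mxdot_mulr Qt -!mulmxA [LHS]mxdot_mull Pt !mulmxA.
by [].
Qed.

Lemma mxdot_svd (R : realType) n1 n2 r (sigma : 'I_r -> R)
    (u : 'I_r -> 'cV[R]_n1) (v : 'I_r -> 'cV[R]_n2) (M : 'M[R]_(n1, n2)) :
  is_svd M sigma u v -> mxdot (svd_E u v) M = \sum_k sigma k.
Proof.
move=> [ou ov s0 ->]; rewrite /svd_E mxdot_suml; apply: eq_bigr => k _.
rewrite mxdot_sumr (bigD1 k) //= big1 => [|l lk].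
  rewrite addr0 mxdotZr mxdot_outer -mulmxA tr_mul_mxdot ov eqxx mulmx1.
  by rewrite ou eqxx mulr1.
rewrite mxdotZr mxdot_outer -mulmxA tr_mul_mxdot ov (negPf lk).
by rewrite -scalemx1 scale0r mulmx0 mxdot0r mulr0.
Qed.

(** Tests [M] against its own polar factor: a contraction pairs with each unit rank-one term
    [u k *m (v k)^T] to at most [1]. *)
Lemma nuclear_norm_svd_le (R : realType) n1 n2 r (sigma : 'I_r -> R)
    (u : 'I_r -> 'cV[R]_n1) (v : 'I_r -> 'cV[R]_n2) (M : 'M[R]_(n1, n2)) :
  is_svd M sigma u v -> nuclear_norm M <= \sum_k sigma k.
Proof.
move=> [ou ov s0 EM]; have [K [Wle <- _]] := polar_factor M.
rewrite {2}EM mxdot_sumr; apply: ler_sum => k _; rewrite mxdotZr mxdotC.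
have nu1 : frob_norm (u k) = 1 by rewrite /frob_norm ou eqxx sqrtr1.
have nv1 : frob_norm (v k) = 1 by rewrite /frob_norm ov eqxx sqrtr1.
rewrite ler_piMr ?(ltW (s0 k)) // mxdot_outer (le_trans (mxdot_le _ _)) //.
by rewrite nu1 mul1r -nv1.
Qed.

Lemma certificate_gap (R : realFieldType) (nM nX S g n0 rho : R) :
  0 < n0 -> rho < 1 -> g <= rho * n0 -> nM <= S -> S - g + n0 <= nX -> nM < nX.
Proof.
move=> n00 rho1 gn nS SX; have : rho * n0 < n0 by rewrite gtr_pMl.
lra.
Qed.

(** Subgradient argument. For a competitor [X = M + Z], let [Z0] be the part of [Z] off the tangent
    space and [W] its polar factor. Then [E + W] is a contraction, so its pairing with [X] is at
    most the nuclear norm of [X]. That pairing is the sum of the [sigma k], minus the pairing of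
    [Y - E] with [Z0], plus the nuclear norm of [Z0]; as [rho < 1], the last term wins strictly once
    [Z0] is nonzero. *)
Lemma dual_certificate_unique (R : realType) n1 n2 r h (M : 'M[R]_(n1, n2))
    (sigma : 'I_r -> R) (u : 'I_r -> 'cV[R]_n1) (v : 'I_r -> 'cV[R]_n2)
    (A : 'I_h -> 'M[R]_(n1, n2)) (b : 'I_h -> R)
    (Omega : {set 'I_n1 * 'I_n2}) (Y : 'M[R]_(n1, n2)) rho :
  is_svd M sigma u v -> (forall l, mxdot (A l) M = b l) ->
  let ker (Z : 'M[R]_(n1, n2)) := (forall i j, (i, j) \in Omega -> Z i j = 0) /\
               (forall l, mxdot (A l) Z = 0) in
  (forall Z, ker Z -> mxdot Y Z = 0) ->
  tangent_proj u v Y = svd_E u v ->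
  rho < 1 ->
  (forall x : 'cV[R]_n2, frob_norm ((Y - svd_E u v) *m x) <= rho * frob_norm x) ->
  (forall Z, ker Z -> tangent_proj u v Z = Z -> Z = 0) ->
  minimizers A b M Omega = [set M].
Proof.
move=> svdM AM ker kerY TY rho1 HG inj; have [ou ov s0 EM] := svdM.
have feasM : feasible A b M Omega M by [].
suff lt_nuc X : feasible A b M Omega X -> X <> M -> nuclear_norm M < nuclear_norm X.
  apply/seteqP; split=> [X [fX minX]|X ->].
    apply: contrapT => XM; have := minX M feasM.
    by rewrite leNgt lt_nuc.
  split=> // X' fX'; have [->//|/eqP X'M] := eqVneq X' M.
  exact/ltW/lt_nuc.
move=> [XO XA] XM; set E := svd_E u v in TY HG; pose Z := X - M.
have kZ : ker Z.
  split=> [i j ij|l]; first by rewrite !mxE XO // subrr.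
  by rewrite mxdotBr XA AM subrr.
set PU := span_proj u; set PV := span_proj v.
have PUt : PU^T = PU by apply: span_proj_tr.
have PVt : PV^T = PV by apply: span_proj_tr.
have PUP : PU *m PU = PU by apply: span_projK.
have PVP : PV *m PV = PV by apply: span_projK.
pose Z0 := Z - tangent_proj u v Z.
have Z0E : Z0 = (1%:M - PU) *m Z *m (1%:M - PV) by apply: tangent_proj_compl.
have UZ0 : PU *m Z0 = 0.
  have PUc : PU *m (1%:M - PU) = 0 by rewrite mulmxBr mulmx1 PUP subrr.
  by rewrite Z0E !mulmxA PUc !mul0mx.
have Z0V : Z0 *m PV = 0.
  have PVc : (1%:M - PV) *m PV = 0 by rewrite mulmxBl mul1mx PVP subrr.
  by rewrite Z0E -mulmxA PVc mulmx0.
(* If [Z0] vanished, [Z] would lie in the tangent space and injectivity would give [X = M]. *)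
have Z0n : Z0 != 0.
  apply/eqP => Z00; apply: XM; apply/eqP; rewrite -subr_eq0; apply/eqP.
  by apply: inj => //; apply/eqP; rewrite eq_sym -subr_eq0 -/Z -/Z0 Z00.
have [K [Wle WZ Kker]] := polar_factor Z0.
pose W := Z0 *m K.
have UW : PU *m W = 0 by rewrite /W mulmxA UZ0 mul0mx.
(* The columns of [PV] lie in the kernel of [Z0], hence in that of [K] by the last property of the
   polar factor. *)
have WV : W *m PV = 0.
  apply/matrixP => i j; have := Kker (col j PV).
  rewrite colE mulmxA Z0V mul0mx mulmxA => /(_ erefl) KV.
  have /matrixP/(_ i 0) : W *m PV *m delta_mx j (0 : 'I_1) = 0.
    by rewrite /W -!mulmxA (mulmxA K) KV mulmx0.
  by rewrite -colE !mxE => ->.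
(* [E] maps the span of the [v k] into that of the [u k], and [W] maps between the orthogonal
   complements; Pythagoras on the source and on the target gives norm at most [1]. *)
have EW (x : 'cV[R]_n2) : frob_norm ((E + W) *m x) <= 1 * frob_norm x.
  rewrite mul1r frob_norm_le ?frob_norm_ge0 // frob_norm_sqr.
  rewrite (frob_norm_proj_split _ PUt PUP).
  have -> : PU *m ((E + W) *m x) = E *m x.
    by rewrite mulmxA mulmxDr UW addr0 svd_E_mull.
  have -> : (E + W) *m x - E *m x = W *m x by rewrite mulmxDl addrC addKr.
  rewrite (frob_norm_proj_split x PVt PVP); apply: lerD.
    rewrite mxdot_mull mulmxA svd_E_gram // -/PV mxdot_mull PVt.
    by rewrite !mulmxA PVP.
  have -> : W *m x = W *m (x - PV *m x).
    by rewrite mulmxBr mulmxA WV mul0mx subr0.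
  by rewrite -!frob_norm_sqr; apply: lerXn2r; rewrite ?nnegrE ?frob_norm_ge0 //.
have nZ0 : 0 < nuclear_norm Z0.
  rewrite lt_def nuclear_norm_ge0 andbT; apply: contra_neq Z0n.
  exact: nuclear_norm_eq0.
have H1 : mxdot (E + W) X <= nuclear_norm X.
  by rewrite -[leRHS]mul1r; apply: mxdot_nuclear_norm_le.
have XE : X = M + Z by rewrite addrC subrK.
have EMs : mxdot E M = \sum_k sigma k by apply: mxdot_svd svdM.
have WM : mxdot W M = 0.
  have MV : M *m PV = M.
    rewrite {1}EM mulmx_suml [RHS]EM; apply: eq_bigr => k _.
    rewrite -scalemxAl -mulmxA; congr (_ *: (_ *m _)).
    by apply: trmx_inj; rewrite trmx_mul trmxK PVt span_proj_id.
  by rewrite -MV mxdotC mxdot_mulr PVt WV mxdot0r.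
have [P1 P2] := compl_proj PUt PUP; have [P3 P4] := compl_proj PVt PVP.
have WZE : mxdot W Z = nuclear_norm Z0.
  have WE : (1%:M - PU) *m W *m (1%:M - PV) = W.
    by rewrite mulmxBl mul1mx UW subr0 mulmxBr mulmx1 WV subr0.
  by rewrite -WZ -/W -[in LHS]WE mxdot_two_sided_proj // WE -Z0E.
have GZ : mxdot (Y - E) Z = mxdot (Y - E) Z0.
  have -> : Y - E = (1%:M - PU) *m Y *m (1%:M - PV).
    by rewrite -TY tangent_proj_compl.
  by rewrite Z0E mxdot_two_sided_proj.
have EZ : mxdot E Z = - mxdot (Y - E) Z0.
  by rewrite -GZ mxdotBl kerY // sub0r opprK.
have H2 := mxdot_nuclear_norm_le Z0 HG.
have H3 := nuclear_norm_svd_le svdM.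
move: H1; rewrite {1}XE mxdotDl (mxdotDr M Z E) (mxdotDr M Z W) EMs WM WZE EZ => H1.
rewrite add0r in H1.
exact: certificate_gap nZ0 rho1 H2 H3 H1.
Qed.

(** * Orthogonal projections as matrices acting on vectorized matrices *)

Lemma mxdot_delta (R : realType) p q i j (W : 'M[R]_(p, q)) :
  mxdot (delta_mx i j) W = W i j.
Proof.
rewrite mxdotE (bigD1 i) //= (bigD1 j) //= !mxE !eqxx mul1r.
rewrite big1 => [|l lj]; last by rewrite !mxE eqxx (negPf lj) mul0r.
rewrite big1 ?addr0 // => k ki.
by rewrite big1 // => l _; rewrite mxE (negPf ki) mul0r.
Qed.

(** Two candidates for the choice made by [oproj] differ by an element of [S]; it is orthogonal to
    both residuals, hence to itself. *)
Lemma oproj_eq (R : realType) p q (S : set 'M[R]_(p, q)) (X Y : 'M[R]_(p, q)) :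
  (forall A B, S A -> S B -> S (A - B)) -> S Y -> orthocomp S (X - Y) ->
  oproj S X = Y.
Proof.
move=> SB SY XY; rewrite /oproj; case: xgetP => [Y' _ [SY' XY']|/(_ Y)]; last first.
  by case.
apply/eqP; rewrite -subr_eq0 -mxdot_eq0; apply/eqP.
have SD := SB _ _ SY' SY.
have -> : mxdot (Y' - Y) (Y' - Y) =
    mxdot (Y' - Y) (X - Y) - mxdot (Y' - Y) (X - Y').
  by rewrite -mxdotBr; congr mxdot; apply/matrixP => i j; rewrite !mxE; ring.
by rewrite XY // XY' // subr0.
Qed.

Lemma tangent_projP (R : realType) n1 n2 r (u : 'I_r -> 'cV[R]_n1)
    (v : 'I_r -> 'cV[R]_n2) (X : 'M[R]_(n1, n2)) :
  orthonormal_family u -> orthonormal_family v ->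
  oproj (svd_T u v) X = tangent_proj u v X.
Proof.
move=> ou ov; apply: oproj_eq => [A B [x [y ->]] [x' [y' ->]]||].
- exists (fun k => x k - x' k), (fun k => y k - y' k).
  rewrite -sumrB; apply: eq_bigr => k _.
  by rewrite raddfB mulmxBr mulmxBl opprD addrACA.
(* The first family produces [span_proj u *m X]; the second is [(1 - span_proj u) *m X] applied to
   [v k] and produces the two remaining terms. *)
- exists (fun k => X^T *m u k), (fun k => X *m v k - span_proj u *m X *m v k).
  rewrite big_split /= /tangent_proj -addrA; congr (_ + _).
    rewrite /span_proj mulmx_suml; apply: eq_bigr => k _.
    by rewrite trmx_mul trmxK mulmxA.
  rewrite -mulmxBl {2}/span_proj mulmx_sumr; apply: eq_bigr => k _.
  by rewrite -mulmxBl mulmxA.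
move=> Z [x [y ->]]; rewrite tangent_proj_compl mxdot_suml big1 // => k _.
rewrite mxdotDl -mulmxA mxdot_mulr trmxK -[X in mxdot X _ + _]mul1mx.
have uk : (1%:M - span_proj u)^T *m u k = 0.
  by rewrite linearB /= trmx1 span_proj_tr mulmxBl mul1mx span_proj_id // subrr.
have vk : (1%:M - span_proj v) *m v k = 0.
  by rewrite mulmxBl mul1mx span_proj_id // subrr.
rewrite mul1mx -mulmxA mxdotC mxdot_mull uk mxdot0r add0r.
by rewrite mxdot_mulr trmxK -!mulmxA vk !mulmx0 mxdot0r.
Qed.

Lemma span_closed_ind (K : fieldType) (vT : vectType K) (s : seq vT)
    (P : vT -> Prop) :
  P 0 -> (forall c x y, P x -> P y -> P (c *: x + y)) ->
  (forall x, x \in s -> P x) -> forall z, z \in span s -> P z.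
Proof.
move=> P0 PD Ps z; rewrite -[s]in_tupleE => /coord_span ->.
elim/big_ind: _ => // [x y Px Py|i _].
  by rewrite -[x]scale1r; apply: PD.
by rewrite -[_ *: _]addr0; apply: PD => //; apply: Ps; rewrite mem_nth.
Qed.

Lemma span_projP (R : realType) n r (u : 'I_r -> 'cV[R]_n) (x : 'cV[R]_n) :
  orthonormal_family u -> oproj [set` <<codom u>>%VS] x = span_proj u *m x.
Proof.
move=> ou; apply: oproj_eq => [A B /= SA SB||].
- exact: rpredB.
- rewrite /= /span_proj mulmx_suml; apply: rpred_sum => k _.
  rewrite -mulmxA tr_mul_mxdot mul_mx_scalar; apply: rpredZ.
  by apply: memv_span; apply: codom_f.
move=> Z /=; apply: (@span_closed_ind _ _ (codom u)
    (fun Z => mxdot Z (x - span_proj u *m x) = 0)) => [|c a b Ha Hb|a /codomP[k ->]].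
- exact: mxdot0l.
- by rewrite mxdotDl mxdotZl Ha Hb mulr0 addr0.
rewrite mxdotBr -[X in _ - X]mxdotC mxdot_mull span_proj_tr span_proj_id //.
by rewrite mxdotC subrr.
Qed.

(** A diagonal entry of a projection is the squared norm of the projected basis vector. The
    definition normalizes by the dimension of the span; its positivity allows clearing the
    denominator, and its bound by [r] gives the stated form. *)
Lemma coherence_le (R : realType) n r (u : 'I_r -> 'cV[R]_n) (mu0 : R) i :
  orthonormal_family u -> (0 < r)%N -> 0 <= mu0 ->
  coherence <<codom u>>%VS <= mu0 ->
  (span_proj u) i i <= mu0 * r%:R / n%:R.
Proof.
move=> ou r0 mu00; rewrite /coherence; set D := \dim _; set m := \big[_/_]_i _.
have n0 : 0 < n%:R :> R by rewrite ltr0n (leq_trans _ (ltn_ord i)).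
have D0 : (0 < D)%N.
  rewrite lt0n dimv_eq0; apply/eqP => s0.
  have : u (Ordinal r0) \in <<codom u>>%VS by rewrite memv_span ?codom_f.
  rewrite s0 memv0 => /eqP u0; have := ou (Ordinal r0) (Ordinal r0).
  by rewrite u0 mxdot0l eqxx => /eqP; rewrite eq_sym oner_eq0.
have Dr : D%:R <= r%:R :> R.
  by rewrite ler_nat (leq_trans (dim_span _)) // size_codom card_ord.
have D0' : 0 < D%:R :> R by rewrite ltr0n.
move=> H; have mle : m <= mu0 * r%:R / n%:R.
  rewrite ler_pdivlMr // mulrC; apply: (@le_trans _ _ (mu0 * D%:R)).
    by rewrite -ler_pdivrMr // mulrAC.
  by rewrite ler_wpM2l.
apply: le_trans mle.
have -> : span_proj u i i =
    frob_norm (oproj [set` <<codom u>>%VS] (std_basis R i)) ^+ 2.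
  rewrite span_projP // frob_norm_sqr mxdot_mull span_proj_tr mulmxA span_projK //.
  by rewrite mxdot_delta -colE mxE.
exact: le_bigmax.
Qed.

Lemma mulmx_row_ext (R : pzSemiRingType) m n (A B : 'M[R]_(m, n)) :
  (forall x : 'rV_m, x *m A = x *m B) -> A = B.
Proof. by move=> AB; apply/row_matrixP => i; rewrite !rowE AB. Qed.

Lemma self_adjoint_tr (R : realType) n (P : 'M[R]_n) :
  (forall x y : 'rV_n, mxdot (x *m P) y = mxdot x (y *m P)) -> P^T = P.
Proof.
move=> PP; apply/matrixP => i j; rewrite mxE.
have := PP (delta_mx 0 i) (delta_mx 0 j).
by rewrite mxdotC !mxdot_delta -!rowE !mxE.
Qed.

(** Operators on matrices are encoded as square matrices acting from the right on [mxvec X], so that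
    the spectral and trace inequalities for symmetric matrices apply to them. *)
Definition tangent_mx (R : realType) n1 n2 r (u : 'I_r -> 'cV[R]_n1)
    (v : 'I_r -> 'cV[R]_n2) : 'M[R]_(n1 * n2) :=
  lin_mx (mulmx (span_proj u)) + lin_mx (mulmxr (span_proj v))
  - lin_mx (mulmx (span_proj u)) *m lin_mx (mulmxr (span_proj v)).

Lemma mxvec_tangent_mx (R : realType) n1 n2 r (u : 'I_r -> 'cV[R]_n1)
    (v : 'I_r -> 'cV[R]_n2) (X : 'M[R]_(n1, n2)) :
  mxvec X *m tangent_mx u v = mxvec (tangent_proj u v X).
Proof.
rewrite /tangent_mx mulmxBr mulmxDr mulmxA !mul_vec_lin /=.
by rewrite -linearD -linearB.
Qed.

Lemma tangent_mx_tr (R : realType) n1 n2 r (u : 'I_r -> 'cV[R]_n1)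
    (v : 'I_r -> 'cV[R]_n2) : (tangent_mx u v)^T = tangent_mx u v.
Proof.
apply: self_adjoint_tr => x y; rewrite -[x]vec_mxK -[y]vec_mxK.
move: (vec_mx x) (vec_mx y) => X Y; rewrite !mxvec_tangent_mx !mxdot_mxvec.
rewrite /tangent_proj !(mxdotBl, mxdotBr, mxdotDl, mxdotDr).
rewrite (mxdot_mulr X) (mxdot_mulr (_ *m X)) !(mxdot_mull _ X) !span_proj_tr.
by rewrite !mulmxA.
Qed.

Lemma tangent_mx_idem (R : realType) n1 n2 r (u : 'I_r -> 'cV[R]_n1)
    (v : 'I_r -> 'cV[R]_n2) : orthonormal_family u -> orthonormal_family v ->
  tangent_mx u v *m tangent_mx u v = tangent_mx u v.
Proof.
move=> ou ov; apply: mulmx_row_ext => x; rewrite mulmxA -[x]vec_mxK.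
move: (vec_mx x) => X; rewrite !mxvec_tangent_mx; congr mxvec.
set T := tangent_proj u v; apply/eqP; rewrite eq_sym -subr_eq0; apply/eqP.
have PUc : (1%:M - span_proj u) *m span_proj u = 0.
  by rewrite mulmxBl mul1mx span_projK // subrr.
have PVc : span_proj v *m (1%:M - span_proj v) = 0.
  by rewrite mulmxBr mulmx1 span_projK // subrr.
rewrite /T tangent_proj_compl /tangent_proj (mulmxBr (1%:M - span_proj u)).
rewrite (mulmxDr (1%:M - span_proj u)) !mulmxA PUc !mul0mx add0r subr0 -mulmxA PVc.
by rewrite mulmx0.
Qed.

(** The least-squares formula [B^T (B B^T)^-1 B], taken on a row basis of [G] so that the Gram
    matrix is invertible even for linearly dependent constraints. *)
Definition row_proj (R : realType) m n (G : 'M[R]_(m, n)) : 'M[R]_n :=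
  (row_base G)^T *m invmx (row_base G *m (row_base G)^T) *m row_base G.

Lemma row_base_gram_unit (R : realType) m n (G : 'M[R]_(m, n)) :
  row_base G *m (row_base G)^T \in unitmx.
Proof.
rewrite -row_free_unit -kermx_eq0; apply/rowV0P => x /sub_kermxP.
move=> /(congr1 (mulmx^~ x^T)) /=; rewrite mul0mx => E.
have : x *m row_base G == 0.
  rewrite -mulmx_tr_eq0 trmx_mul; apply/eqP.
  by rewrite mulmxA -(mulmxA x) E mxE.
by rewrite mulmx_free_eq0 ?row_base_free // => /eqP.
Qed.

Lemma row_proj_tr (R : realType) m n (G : 'M[R]_(m, n)) :
  (row_proj G)^T = row_proj G.
Proof.
rewrite /row_proj; move: (row_base G) => B.
have Bs : (B *m B^T)^T = B *m B^T by rewrite trmx_mul trmxK.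
by rewrite 2!trmx_mul trmxK trmx_inv Bs mulmxA.
Qed.

Lemma row_proj_id (R : realType) m n p (G : 'M[R]_(m, n)) (X : 'M[R]_(p, n)) :
  (X <= G)%MS -> X *m row_proj G = X.
Proof.
rewrite -(eq_row_base G) => /submxP[D ->].
rewrite /row_proj; have := row_base_gram_unit G.
move: (row_base G) D => B D U.
by rewrite -(mulmxA D) -(mulmxA B^T) (mulmxA B) mulKVmx.
Qed.

Lemma row_proj_sub (R : realType) m n p (G : 'M[R]_(m, n)) (X : 'M[R]_(p, n)) :
  (X *m row_proj G <= G)%MS.
Proof. by rewrite -(eq_row_base G) /row_proj mulmxA submxMl. Qed.

Lemma row_proj_idem (R : realType) m n (G : 'M[R]_(m, n)) :
  row_proj G *m row_proj G = row_proj G.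
Proof. by apply: row_proj_id; rewrite -{1}[row_proj G]mul1mx row_proj_sub. Qed.

Definition constraint_mx (R : realType) n1 n2 h (A : 'I_h -> 'M[R]_(n1, n2)) :
  'M[R]_(h, n1 * n2) := \matrix_l mxvec (A l).

Lemma constraint_mx_kernel (R : realType) n1 n2 h (A : 'I_h -> 'M[R]_(n1, n2))
    (Z : 'M[R]_(n1, n2)) (y : 'rV[R]_(n1 * n2)) :
  (forall l, mxdot (A l) Z = 0) -> (y <= constraint_mx A)%MS ->
  mxdot y (mxvec Z) = 0.
Proof.
move=> AZ /submxP[w ->]; rewrite mxdot_mulr.
suff -> : mxvec Z *m (constraint_mx A)^T = 0 by rewrite mxdot0r.
apply/rowP => l; rewrite [RHS]mxE -(AZ l) -mxdot_mxvec mxdotC mxdotE big_ord1 mxE.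
by apply: eq_bigr => k _; rewrite !mxE.
Qed.

Definition qperp_mx (R : realType) n1 n2 h (A : 'I_h -> 'M[R]_(n1, n2)) :
  'M[R]_(n1 * n2) := 1%:M - row_proj (constraint_mx A).

Lemma qperp_mx_tr (R : realType) n1 n2 h (A : 'I_h -> 'M[R]_(n1, n2)) :
  (qperp_mx A)^T = qperp_mx A.
Proof. by have [] := compl_proj (row_proj_tr (constraint_mx A)) (row_proj_idem _). Qed.

Lemma qperp_mx_idem (R : realType) n1 n2 h (A : 'I_h -> 'M[R]_(n1, n2)) :
  qperp_mx A *m qperp_mx A = qperp_mx A.
Proof. by have [] := compl_proj (row_proj_tr (constraint_mx A)) (row_proj_idem _). Qed.

Lemma QperpP (R : realType) n1 n2 h (A : 'I_h -> 'M[R]_(n1, n2)) X :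
  Qperp A X <-> forall l, mxdot (A l) X = 0.
Proof.
split=> [QX l|AX Z]; first by apply: QX; apply: memv_span; apply: codom_f.
apply: (@span_closed_ind _ _ (codom A) (fun Z => mxdot Z X = 0))
  => [|c a b Ha Hb|a /codomP[k ->]] //; first exact: mxdot0l.
by rewrite mxdotDl mxdotZl Ha Hb mulr0 addr0.
Qed.

Lemma constraint_orthogonal_row_proj (R : realType) n1 n2 h
    (A : 'I_h -> 'M[R]_(n1, n2)) Z :
  (forall l, mxdot (A l) Z = 0) -> mxvec Z *m row_proj (constraint_mx A) = 0.
Proof.
move=> AZ; apply/eqP; rewrite -mxdot_eq0 mxdot_mulr row_proj_tr.
rewrite -mulmxA row_proj_idem mxdotC.
by rewrite (constraint_mx_kernel AZ) ?row_proj_sub.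
Qed.

Lemma oproj_Qperp (R : realType) n1 n2 h (A : 'I_h -> 'M[R]_(n1, n2)) X :
  mxvec (oproj (Qperp A) X) = mxvec X *m qperp_mx A.
Proof.
rewrite (@oproj_eq _ _ _ _ _ (vec_mx (mxvec X *m qperp_mx A))) ?vec_mxK //.
- move=> B C /QperpP AB /QperpP AC; apply/QperpP => l.
  by rewrite mxdotBr AB AC subrr.
- apply/QperpP => l; rewrite -mxdot_mxvec vec_mxK mxdotC mxdot_mulr qperp_mx_tr.
  rewrite /qperp_mx mulmxBr mulmx1 row_proj_id ?subrr ?mxdot0r //.
  by rewrite -(rowK (fun l => mxvec (A l)) l) row_sub.
move=> Z /QperpP AZ; rewrite -mxdot_mxvec linearB /= vec_mxK mxdotC.
rewrite -[X in mxdot (X - _)]mulmx1 -mulmxBr /qperp_mx opprB addrC subrK.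
by rewrite (constraint_mx_kernel AZ) ?row_proj_sub.
Qed.

Definition unit_vec (R : realType) n1 n2 (k : 'I_n1 * 'I_n2) : 'rV[R]_(n1 * n2) :=
  mxvec (delta_mx k.1 k.2).

Definition sample_mx (R : realType) n1 n2 (Omega : {set 'I_n1 * 'I_n2}) :
  'M[R]_(n1 * n2) := \sum_(k in Omega) (unit_vec R k)^T *m unit_vec R k.

Definition sample (R : realType) n1 n2 (Omega : {set 'I_n1 * 'I_n2})
    (X : 'M[R]_(n1, n2)) : 'M[R]_(n1, n2) :=
  \sum_(k in Omega) X k.1 k.2 *: delta_mx k.1 k.2.

Lemma sampleE (R : realType) n1 n2 (Omega : {set 'I_n1 * 'I_n2})
    (X : 'M[R]_(n1, n2)) i j :
  sample Omega X i j = if (i, j) \in Omega then X i j else 0.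
Proof.
have other (k : 'I_n1 * 'I_n2) : k != (i, j) ->
    (X k.1 k.2 *: delta_mx k.1 k.2 : 'M[R]_(_, _)) i j = 0.
  case: k => k l; rewrite xpair_eqE negb_and !mxE /= (eq_sym i) (eq_sym j).
  by case/orP => /negPf ->; rewrite ?andbF mulr0.
rewrite /sample summxE; case: ifPn => ij.
  rewrite (bigD1 (i, j)) //= !mxE !eqxx mulr1 big1 ?addr0 // => k /andP[_].
  exact: other.
rewrite big1 // => k kO; apply: other.
by apply: contraNneq ij => <-.
Qed.

Lemma mxvec_sample_mx (R : realType) n1 n2 (Omega : {set 'I_n1 * 'I_n2})
    (X : 'M[R]_(n1, n2)) :
  mxvec X *m sample_mx R Omega = mxvec (sample Omega X).
Proof.
rewrite /sample_mx /sample mulmx_sumr linear_sum; apply: eq_bigr => k _.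
rewrite linearZ /= mulmxA /unit_vec -mul_scalar_mx; congr (_ *m _).
apply/matrixP => i j; rewrite !ord1 mxE [RHS]mxE eqxx mulr1n.
rewrite -[RHS](mxdot_delta k.1 k.2) -mxdot_mxvec mxdotE big_ord1.
by apply: eq_bigr => l _; rewrite [_^T _ _]mxE mulrC.
Qed.

Lemma sample_mx_tr (R : realType) n1 n2 (Omega : {set 'I_n1 * 'I_n2}) :
  (sample_mx R Omega)^T = sample_mx R Omega.
Proof.
rewrite /sample_mx linear_sum; apply: eq_bigr => k _ /=.
by rewrite trmx_mul trmxK.
Qed.

Lemma sample_mx_idem (R : realType) n1 n2 (Omega : {set 'I_n1 * 'I_n2}) :
  sample_mx R Omega *m sample_mx R Omega = sample_mx R Omega.
Proof.
apply: mulmx_row_ext => x; rewrite mulmxA -[x]vec_mxK !mxvec_sample_mx.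
congr mxvec; apply/matrixP => i j; rewrite !sampleE.
by case: (_ \in _).
Qed.

(** The series is summed as an inverse: [D] halves norms, so [1 - D] has trivial kernel. The error
    satisfies [f - e = e D + (f - e) D], and absorbing the last term produces the factor [2]. *)
Lemma neumann_solution (R : realType) n (D : 'M[R]_n) (e : 'rV[R]_n) :
  (forall x : 'rV_n, frob_norm (x *m D) <= 2^-1 * frob_norm x) ->
  exists f, f = e + f *m D /\ frob_norm (f - e) <= 2 * frob_norm (e *m D).
Proof.
move=> HD; have U : 1%:M - D \in unitmx.
  rewrite -row_free_unit -kermx_eq0; apply/rowV0P => x /sub_kermxP.
  rewrite mulmxBr mulmx1 => /eqP; rewrite subr_eq0 => /eqP xD.
  have := HD x; rewrite -xD => H; have := frob_norm_ge0 x => x0.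
  by apply/eqP; rewrite -frob_norm_eq0; apply/eqP; lra.
pose f := e *m invmx (1%:M - D).
have fE : f = e + f *m D.
  have : f *m (1%:M - D) = e by rewrite /f mulmxKV.
  by rewrite mulmxBr mulmx1 => <-; rewrite subrK.
exists f; split=> //.
have E : f - e = e *m D + (f - e) *m D.
  by rewrite -mulmxDl (addrC e) subrK {1}fE addrC addKr.
have := HD (f - e); have := frob_normD (e *m D) ((f - e) *m D).
rewrite -E; lra.
Qed.

Lemma frob_norm_proj_le (R : realType) n (P : 'M[R]_n) (x : 'rV[R]_n) :
  P^T = P -> P *m P = P -> frob_norm (x *m P) <= frob_norm x.
Proof.
move=> Pt PP; rewrite frob_norm_le ?frob_norm_ge0 // frob_norm_sqr.
rewrite -[in leLHS]mxdot_tr -[in leRHS]mxdot_tr trmx_mul Pt.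
by rewrite [leRHS](frob_norm_proj_split _ Pt PP) lerDl mxdot_ge0.
Qed.

Lemma frob_norm_trmx (R : realType) p q (X : 'M[R]_(p, q)) :
  frob_norm X^T = frob_norm X.
Proof. by rewrite /frob_norm mxdot_tr. Qed.

(* The certificate is [c F (O + q (1 - Q))], where [F] in the tangent space solves
   [F = E + F D] and [D = P (1 - c (O + q (1 - Q))) P]. Only the leading term
   [F = E] is estimated in operator norm (through [t2]); the remainder [F - E] is
   estimated in Frobenius norm. *)
Lemma recovery_criterion (R : realType) n1 n2 r h (M : 'M[R]_(n1, n2))
    (sigma : 'I_r -> R) (u : 'I_r -> 'cV[R]_n1) (v : 'I_r -> 'cV[R]_n2)
    (A : 'I_h -> 'M[R]_(n1, n2)) (b : 'I_h -> R)
    (Omega : {set 'I_n1 * 'I_n2}) (p q t t2 : R) :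
  is_svd M sigma u v -> (forall l, mxdot (A l) M = b l) ->
  0 <= p -> 0 < q -> 0 <= t -> 0 <= t2 ->
  let E := svd_E u v in
  let P := tangent_mx u v in
  let O := sample_mx R Omega in
  let Q := qperp_mx A in
  let c := (p + q)^-1 in
  let s := frob_norm (P *m Q) in
  (forall x : 'rV_(n1 * n2),
     frob_norm (x *m (P *m (O - p%:M) *m P)) <= t * frob_norm x) ->
  (forall x : 'cV_n2,
     frob_norm ((sample Omega E - p *: E) *m x) <= t2 * frob_norm x) ->
  c * (t + q * s ^+ 2) <= 2^-1 ->
  c * t2 + c * q * frob_norm (mxvec E *m Q)
    + c * (Num.sqrt (p + t) + q * s)
      * (2 * (c * (t + q * s ^+ 2)) * frob_norm (mxvec E)) < 1 ->
  minimizers A b M Omega = [set M].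
Proof.
move=> svdM AM p0 q0 t0 t20 E P O Q c s H1 H2 H3 H4; have [ou ov _ _] := svdM.
have Pt : P^T = P by apply: tangent_mx_tr.
have PP : P *m P = P by apply: tangent_mx_idem.
have Qt : Q^T = Q by apply: qperp_mx_tr.
have QQ : Q *m Q = Q by apply: qperp_mx_idem.
have Ot : O^T = O by apply: sample_mx_tr.
have OO : O *m O = O by apply: sample_mx_idem.
have pq0 : 0 < p + q by rewrite ltr_wpDl.
have c0 : 0 < c by rewrite invr_gt0.
have cpq : c * (p + q) = 1 by rewrite mulVf ?gt_eqF.
have s0 : 0 <= s by apply: frob_norm_ge0.
have kerQ Z : (forall l, mxdot (A l) Z = 0) -> mxvec Z *m Q = mxvec Z.
  by move=> AZ; rewrite mulmxBr mulmx1 constraint_orthogonal_row_proj // subr0.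
have TP X : mxvec X *m P = mxvec (tangent_proj u v X) by apply: mxvec_tangent_mx.
have OS X : mxvec X *m O = mxvec (sample Omega X) by apply: mxvec_sample_mx.
have sE : s = frob_norm (P *m Q) by [].
clearbody s c; clearbody P O Q.
pose e := mxvec E.
have eP : e *m P = e.
  rewrite TP /tangent_proj svd_E_mull // svd_E_mulr //.
  by rewrite addrK.
have xPQ (x : 'rV_(n1 * n2)) : x *m P = x -> frob_norm (x *m Q) <= s * frob_norm x.
  by move=> <-; rewrite -{1}PP mulmxA -mulmxA mulrC sE frob_norm_mulmx.
have xQP (x : 'rV_(n1 * n2)) : frob_norm (x *m Q *m P) <= s * frob_norm x.
  rewrite -mulmxA mulrC; apply: le_trans (frob_norm_mulmx _ _) _.
  by rewrite -[frob_norm (Q *m P)]frob_norm_trmx trmx_mul Pt Qt sE.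
(* [c *: K] is the deviation of the weighted sampling operator from the identity *)
pose K := p%:M - O + q *: Q.
have xK (x : 'rV_(n1 * n2)) : x *m K = p *: x - x *m O + q *: (x *m Q).
  by rewrite /K mulmxDr mulmxBr mul_mx_scalar -scalemxAr.
pose D := c *: (P *m K *m P).
have xDK (x : 'rV_(n1 * n2)) : x *m D = c *: (x *m P *m K *m P).
  by rewrite /D -scalemxAr !mulmxA.
have xD (x : 'rV_(n1 * n2)) : x *m D =
    - c *: (x *m (P *m (O - p%:M) *m P)) + (c * q) *: (x *m P *m Q *m P).
  rewrite xDK xK !mulmxA mulmxBr mul_mx_scalar !mulmxDl !mulNmx.
  rewrite -!scalemxAl.
  set a := _ *m P *m P; set a1 := _ *m O *m P; set a2 := _ *m Q *m P.
  by apply/rowP => l; rewrite !mxE; ring.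
clearbody K.
have nD (x : 'rV_(n1 * n2)) : frob_norm (x *m D) <= c * (t + q * s ^+ 2) * frob_norm x.
  rewrite xD (le_trans (frob_normD _ _)) // !frob_normZ normrN.
  rewrite !ger0_norm ?mulr_ge0 ?(ltW c0) ?(ltW q0) //.
  have h1 := ler_wpM2l (ltW c0) (H1 x).
  have h2 : frob_norm (x *m P *m Q *m P) <= s ^+ 2 * frob_norm x.
    rewrite -{1}QQ mulmxA (le_trans (xQP _)) // expr2 -mulrA ler_wpM2l //.
    rewrite (le_trans (xPQ _ _)) -?mulmxA ?PP // ler_wpM2l //.
    exact: frob_norm_proj_le.
  have h3 := ler_wpM2l (mulr_ge0 (ltW c0) (ltW q0)) h2.
  lra.
have nD2 (x : 'rV_(n1 * n2)) : frob_norm (x *m D) <= 2^-1 * frob_norm x.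
  by rewrite (le_trans (nD x)) // ler_wpM2r // frob_norm_ge0.
have [f [fE nf]] := neumann_solution e nD2.
have DP : D *m P = D by rewrite /D -scalemxAl -[_ *m P *m P]mulmxA PP.
clearbody D.
have fP : f *m P = f by rewrite {1}fE mulmxDl eP -mulmxA DP -fE.
pose f' := f - e.
have f'P : f' *m P = f' by rewrite mulmxBl fP eP.
have nf' : frob_norm f' <= 2 * (c * (t + q * s ^+ 2)) * frob_norm e.
  by rewrite (le_trans nf) // -mulrA ler_wpM2l.
have fe : f = e + f' by rewrite addrC subrK.
clearbody f'.
pose y := c *: (f *m O + q *: (f *m (1%:M - Q))).
(* [K] is [(p + q)%:M] minus the weighted operator [O + q (1 - Q)], and [c * (p + q) = 1]. *)
have yK : y = f - c *: (f *m K).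
  rewrite /y xK mulmxBr mulmx1 [X in _ = X - _](_ : f = (c * (p + q)) *: f).
    set a := f *m O; set a' := f *m Q.
    by apply/rowP => l; rewrite !mxE; ring.
  by rewrite cpq scale1r.
have yP : y *m P = e.
  have fD : c *: (f *m K *m P) = f - e.
    by rewrite -{1}fP -xDK {2}fE addrC addKr.
  by rewrite yK mulmxBl fP -scalemxAl fD opprB addrC subrK.
have kerE (Z : 'M[R]_(n1, n2)) : (forall i j, (i, j) \in Omega -> Z i j = 0) ->
    mxvec Z *m O = 0.
  move=> ZO; rewrite OS (_ : sample _ _ = 0) ?linear0 //.
  apply/matrixP => i j; rewrite sampleE mxE; case: ifP => // ij.
  exact: ZO.
apply: (@dual_certificate_unique _ _ _ _ _ M sigma u v A b Omega (vec_mx y)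
  (c * t2 + c * q * frob_norm (e *m Q)
   + c * (Num.sqrt (p + t) + q * s) * frob_norm f')) => //.
- move=> Z [ZO AZ]; rewrite -mxdot_mxvec vec_mxK mxdotZl mxdotDl mxdotZl !mxdot_mulr.
  rewrite Ot linearB /= trmx1 Qt mulmxBr mulmx1 kerE // kerQ // subrr.
  by rewrite !mxdot0r mulr0 addr0 mulr0.
- apply: (can_inj mxvecK); rewrite -TP vec_mxK -/e.
  exact: yP.
- rewrite (le_lt_trans _ H4) // lerD2l ler_wpM2l //.
  by rewrite mulr_ge0 ?(ltW c0) // addr_ge0 ?sqrtr_ge0 // mulr_ge0 // ltW.
- move=> x.
  (* Removing the tangent part multiplies by a projection on each side, so it does not increase the
     operator norm. *)
  have nC (W : 'M[R]_(n1, n2)) w : 0 <= w ->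
      (forall z : 'cV_n2, frob_norm (W *m z) <= w * frob_norm z) ->
      frob_norm ((W - tangent_proj u v W) *m x) <= w * frob_norm x.
    move=> w0 Ww; rewrite tangent_proj_compl.
    have [Ut UU] := compl_proj (span_proj_tr u) (span_projK ou).
    have [Vt VV] := compl_proj (span_proj_tr v) (span_projK ov).
    have nU z : frob_norm ((1%:M - span_proj u) *m z) <= frob_norm (z : 'cV_n1).
      by rewrite -frob_norm_trmx trmx_mul Ut -[leRHS]frob_norm_trmx frob_norm_proj_le.
    have nV z : frob_norm ((1%:M - span_proj v) *m z) <= frob_norm (z : 'cV_n2).
      by rewrite -frob_norm_trmx trmx_mul Vt -[leRHS]frob_norm_trmx frob_norm_proj_le.
    rewrite -!mulmxA (le_trans (nU _)) // (le_trans (Ww _)) //.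
    by rewrite ler_wpM2l.
  pose S := sample Omega E - p *: E.
  pose W1 := vec_mx (e *m Q) : 'M[R]_(n1, n2).
  pose W2 := vec_mx (f' *m O - q *: (f' *m Q)) : 'M[R]_(n1, n2).
  (* As [y] projects to [E], only its off-tangent part counts. [S] is the sampling error of [E],
     [W1] its constraint error, and [W2] carries the remainder [f']; the multiples of [f] and [f']
     are tangent and cancel. *)
  have -> : vec_mx y - svd_E u v = c *: (S - tangent_proj u v S)
      - (c * q) *: (W1 - tangent_proj u v W1) + c *: (W2 - tangent_proj u v W2).
    have TC W : mxvec (W - tangent_proj u v W) = mxvec W - mxvec W *m P.
      by rewrite raddfB /= TP.
    have mS : mxvec S = e *m O - p *: e by rewrite raddfB /= linearZ /= OS.
    apply: (can_inj mxvecK); rewrite raddfB /= vec_mxK -/e.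
    rewrite raddfD /= raddfB /= !linearZ /= !TC !vec_mxK mS -{1}yP yK.
    have fK : f *m K =
        p *: f' - (e *m O - p *: e) + q *: (e *m Q) - (f' *m O - q *: (f' *m Q)).
      rewrite {1}fe mulmxDl !xK.
      set a1 := e *m O; set a2 := e *m Q; set a3 := f' *m O; set a4 := f' *m Q.
      by apply/rowP => l; rewrite !mxE; ring.
    move: fK; set a1 := _ - p *: e; set a2 := e *m Q; set a3 := _ - q *: _ => fK.
    have fKP : f *m K *m P = p *: f' - a1 *m P + q *: (a2 *m P) - a3 *m P.
      by rewrite fK mulmxBl mulmxDl mulmxBl -!scalemxAl f'P.
    rewrite mulmxBl fP -scalemxAl fKP fK.
    move: (a1 *m P) (a2 *m P) (a3 *m P) => b1 b2 b3.
    by move: a1 a2 a3 fK fKP => a1 a2 a3 _ _; apply/rowP => l; rewrite !mxE; ring.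
  have nS := nC S t2 t20 H2.
  have nW1 := nC W1 (frob_norm W1) (frob_norm_ge0 _) (fun z => frob_norm_mulmx _ _).
  have nW2 := nC W2 (frob_norm W2) (frob_norm_ge0 _) (fun z => frob_norm_mulmx _ _).
  have eW1 : frob_norm W1 = frob_norm (e *m Q).
    by rewrite -frob_norm_mxvec vec_mxK.
  (* Since [O] is a projection, the square of this norm is the pairing of [f'] with [f' O], which
     differs from [p] times the squared norm of [f'] by a deviation of size [t]. This improves the
     trivial factor [1] to [sqrt (p + t)]. *)
  have nf'O : frob_norm (f' *m O) <= Num.sqrt (p + t) * frob_norm f'.
    rewrite frob_norm_le ?mulr_ge0 ?sqrtr_ge0 ?frob_norm_ge0 //.
    rewrite exprMn sqr_sqrtr ?addr_ge0 // frob_norm_sqr.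
    rewrite mxdot_mulr Ot -mulmxA OO.
    have -> : mxdot f' (f' *m O) =
        p * mxdot f' f' + mxdot f' (f' *m (P *m (O - p%:M) *m P)).
      rewrite !mulmxA f'P mulmxBr mulmxBl mul_mx_scalar mxdotBr.
      rewrite -scalemxAl f'P mxdotZr [X in _ + (X - _)]mxdotC mxdot_mulr Pt f'P.
      by rewrite [mxdot (f' *m O) _]mxdotC addrC subrK.
    have h1 := mxdot_le f' (f' *m (P *m (O - p%:M) *m P)).
    have h2 := ler_wpM2l (frob_norm_ge0 f') (H1 f').
    rewrite -frob_norm_sqr mulrDl lerD2l (le_trans h1) // (le_trans h2) //.
    by rewrite mulrCA expr2.
  have nW2' : frob_norm W2 <= (Num.sqrt (p + t) + q * s) * frob_norm f'.
    rewrite -frob_norm_mxvec vec_mxK (le_trans (frob_normD _ _)) //.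
    rewrite frob_normN frob_normZ ger0_norm ?(ltW q0) // mulrDl lerD //.
    by rewrite -mulrA ler_wpM2l ?(ltW q0) // xPQ.
  rewrite !mulmxDl mulNmx -!scalemxAl.
  apply: le_trans (frob_normD _ _) _; rewrite !frob_normZ.
  apply: le_trans (lerD (frob_normD _ _) (lexx _)) _.
  rewrite frob_normN !frob_normZ !ger0_norm ?mulr_ge0 ?(ltW c0) ?(ltW q0) //.
  rewrite !mulrDl; apply: lerD; first apply: lerD.
  - by rewrite -mulrA ler_wpM2l ?(ltW c0).
  - by rewrite -[leRHS]mulrA -eW1 ler_wpM2l // mulr_ge0 ?(ltW c0) ?(ltW q0).
  rewrite -[leRHS]mulrA -[leRHS]mulrA ler_wpM2l ?(ltW c0) // mulrA (le_trans nW2) //.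
  by rewrite ler_wpM2r ?frob_norm_ge0.
(* A tangent matrix in the kernel of all measurements is fixed by [D], which halves norms. *)
move=> Z [ZO AZ] TZ; have zP : mxvec Z *m P = mxvec Z by rewrite TP TZ.
have zD : mxvec Z *m D = mxvec Z.
  rewrite xDK zP xK kerE // kerQ // subr0 -scalerDl -scalemxAl zP scalerA cpq.
  by rewrite scale1r.
have := nD2 (mxvec Z); rewrite zD => H.
have z0 : mxvec Z = 0.
  apply/eqP; rewrite -frob_norm_eq0; apply/eqP.
  have := frob_norm_ge0 (mxvec Z); lra.
by rewrite -[Z]mxvecK z0 linear0.
Qed.

(** * Concentration of the sampling operators *)

(** All eigenvalues of an even power are nonnegative, so each is bounded by the trace. *)
Lemma frob_norm_spectrum_le (R : realType) n (Z : 'M[R]_n) (t : R) l :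
  Z^T = Z -> 0 <= t -> (0 < l)%N -> \tr (Z ^+ l.*2) <= t ^+ l.*2 ->
  forall x : 'rV_n, frob_norm (x *m Z) <= t * frob_norm x.
Proof.
move=> Zs t0 l0 HZ x; have [U [d [UU EZ]]] := symmetric_spectral Zs.
have UtU : U^T *m U = 1%:M by apply: mulmx1C.
have d_le i : d 0 i ^+ 2 <= t ^+ 2.
  rewrite -(ler_pXn2r l0) ?nnegrE ?sqr_ge0 // -!exprM !mul2n.
  apply: le_trans HZ; rewrite EZ diag_conj_exp // mxtrace_mulC mulmxA UU mul1mx.
  rewrite mxtrace_diag (bigD1 i) //= mxE lerDl sumr_ge0 // => j _.
  by rewrite mxE exprn_double_sqr exprn_ge0 ?sqr_ge0.
rewrite frob_norm_le ?mulr_ge0 ?frob_norm_ge0 // exprMn frob_norm_sqr.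
have isom (y : 'rV[R]_n) : mxdot (y *m U^T) (y *m U^T) = mxdot y y.
  by rewrite mxdot_mulr trmxK -mulmxA UtU mulmx1.
rewrite -(isom x) EZ !mulmxA; set z := x *m U^T.
rewrite mxdot_mulr -mulmxA UU mulmx1 !mxdotE !big_ord1 mulr_sumr.
apply: ler_sum => i _; rewrite mul_mx_diag mxE mulrACA -!expr2 mulrC.
by rewrite ler_wpM2r ?sqr_ge0.
Qed.

Lemma markov_subsets (R : realType) (I : finType) m (f : {set I} -> R) (c T : R) :
  (forall S, 0 <= f S) -> 0 < T ->
  let K := #|[set S : {set I} | #|S| == m]%SET|%:R in
  \sum_(S : {set I} | #|S| == m) f S <= K * c * T ->
  #|[set S : {set I} | (#|S| == m) && (T < f S)]%SET|%:R <= K * c.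
Proof.
move=> f0 T0 K H; rewrite -(ler_pM2r T0) (le_trans _ H) //.
rewrite mulr_natl -sumr_const big_mkcond [leRHS]big_mkcond /=.
apply: ler_sum => S _; rewrite inE; case: (#|S| == m) => //=.
by case: ifP => // /ltW.
Qed.

Lemma unif_subset_prob_ge (R : realType) (I : finType) m (P : {set I} -> Prop)
    (B1 B2 : {set I} -> bool) (c1 c2 : R) :
  (m <= #|I|)%N ->
  (forall S : {set I}, #|S| = m -> ~~ B1 S -> ~~ B2 S -> P S) ->
  let K := #|[set S : {set I} | #|S| == m]%SET|%:R in
  #|[set S : {set I} | (#|S| == m) && B1 S]%SET|%:R <= K * c1 ->
  #|[set S : {set I} | (#|S| == m) && B2 S]%SET|%:R <= K * c2 ->
  1 - (c1 + c2) <= unif_subset_prob R m P.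
Proof.
move=> mI HP K H1 H2.
have K0 : 0 < K by rewrite ltr0n card_draws bin_gt0.
rewrite /unif_subset_prob ler_pdivlMr // mulrBl mul1r lerBlDr.
set G := [set S | _ && `[< P S >]]%SET.
set S1 := [set S | _ && B1 S]%SET in H1; set S2 := [set S | _ && B2 S]%SET in H2.
have : (#|[set S : {set I} | #|S| == m]%SET| <= #|G| + (#|S1| + #|S2|))%N.
  apply: (@leq_trans #|G :|: (S1 :|: S2)|).
    apply: subset_leq_card; apply/fintype.subsetP => S; rewrite !inE => /eqP mS.
    rewrite mS eqxx /=; case b1 : (B1 S); case b2 : (B2 S); rewrite ?orbT //=.
    by rewrite !orbF; apply/asboolP; apply: HP; rewrite ?b1 ?b2.
  by rewrite (leq_trans (leq_card_setU _ _)) // leq_add2l leq_card_setU.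
rewrite -(ler_nat R) !natrD -/K => /le_trans; apply.
by rewrite lerD2l mulrDl !(mulrC _ K) lerD.
Qed.

Lemma mulmx_tr_mxdot (R : realType) n (x y : 'rV[R]_n) :
  x *m y^T = (mxdot x y)%:M.
Proof. by rewrite -{1}[x]trmxK tr_mul_mxdot mxdot_tr. Qed.

Lemma quad_form_gram (R : realType) n (y x : 'rV[R]_n) :
  quad_form (y^T *m y) x = mxdot x y ^+ 2.
Proof.
rewrite /quad_form mulmxA -mulmxA !mulmx_tr_mxdot (mxdotC y x).
by rewrite -scalar_mxM mxE eqxx mulr1n expr2.
Qed.

Lemma quad_form_idem (R : realType) n (P : 'M[R]_n) x :
  P^T = P -> P *m P = P -> quad_form P x = mxdot (x *m P) (x *m P).
Proof.
move=> Pt PP.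
have -> : mxdot (x *m P) (x *m P) = ((mxdot (x *m P) (x *m P))%:M : 'M[R]_1) 0 0.
  by rewrite mxE eqxx mulr1n.
by rewrite -mulmx_tr_mxdot /quad_form trmx_mul Pt !mulmxA -(mulmxA x P P) PP.
Qed.

Lemma sample_mxT (R : realType) n1 n2 :
  \sum_k (unit_vec R k)^T *m unit_vec R k = 1%:M :> 'M[R]_(n1 * n2).
Proof.
apply: mulmx_row_ext => x; rewrite mulmx1 -[x]vec_mxK.
have -> : \sum_k (unit_vec R k)^T *m unit_vec R k =
    sample_mx R [set: 'I_n1 * 'I_n2]%SET.
  by apply: eq_bigl => k; rewrite inE.
rewrite mxvec_sample_mx; congr mxvec; apply/matrixP => i j.
by rewrite sampleE inE.
Qed.

(** The terms are the rank-one matrices of the projected units [unit_vec R k *m P], which sum to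
    [P]. The square of such a term is its squared length, at most [B], times the term itself, so
    [positive_moment_bound] applies. *)
Lemma projected_sampling_moment (R : realType) n1 n2 m p (P : 'M[R]_(n1 * n2))
    (B L : R) :
  P^T = P -> P *m P = P -> (0 < n1 * n2)%N -> 0 <= B -> 0 < L ->
  (forall k, mxdot (unit_vec R k *m P) (unit_vec R k *m P) <= B) ->
  p.*2.+1%:R * B * (L + 2 * (m%:R / (n1 * n2)%:R)) <= L ^+ 2 / 2 ->
  \sum_(S : {set 'I_n1 * 'I_n2} | #|S| == m)
    \tr ((P *m (sample_mx R S - (m%:R / (n1 * n2)%:R)%:M) *m P) ^+ p.*2.+2) <=
  #|[set S : {set 'I_n1 * 'I_n2} | #|S| == m]%SET|%:R * (n1 * n2)%:R * L ^+ p.*2.+2.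
Proof.
move=> Pt PP N0 B0 L0 HB HL.
have cI : #|{: 'I_n1 * 'I_n2}| = (n1 * n2)%N by rewrite card_prod !card_ord.
pose Y (k : 'I_n1 * 'I_n2) := (unit_vec R k *m P)^T *m (unit_vec R k *m P).
have YE k : Y k = P *m ((unit_vec R k)^T *m unit_vec R k) *m P.
  by rewrite /Y trmx_mul Pt !mulmxA.
have sumY : \sum_k Y k = P.
  transitivity (P *m 1%:M *m P); last by rewrite mulmx1 PP.
  rewrite -(sample_mxT R n1 n2) mulmx_sumr mulmx_suml.
  by apply: eq_bigr => k _; rewrite YE.
have ZE S : centered_sum m Y S =
    P *m (sample_mx R S - (m%:R / (n1 * n2)%:R)%:M) *m P.
  rewrite /centered_sum sumY cI mulmxBr mulmxBl mul_mx_scalar -scalemxAl PP.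
  congr (_ - _); rewrite /sample_mx mulmx_sumr mulmx_suml.
  by apply: eq_bigr => k _; rewrite YE.
under eq_bigr do rewrite -ZE.
apply: (@positive_moment_bound _ _ _ _ _ Y B (m%:R / (n1 * n2)%:R)) => //.
- by rewrite cI.
- by move=> k; rewrite /Y trmx_mul trmxK.
- move=> k x; rewrite /Y; have := HB k; move: (unit_vec R k *m P) => y yB.
  have -> : y^T *m y *m (y^T *m y) = mxdot y y *: (y^T *m y).
    rewrite mulmxA -(mulmxA y^T) (_ : y *m y^T = (mxdot y y)%:M).
      by rewrite mul_mx_scalar -scalemxAl.
    exact: mulmx_tr_mxdot.
  by rewrite quad_formZ quad_form_gram ler_wpM2r ?sqr_ge0.
move=> x; rewrite sumY cI ler_wpM2l // quad_form1.
rewrite quad_form_idem // mulmx_tr_mxdot mxE eqxx mulr1n.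
by rewrite -!frob_norm_sqr lerXn2r ?nnegrE ?frob_norm_ge0 // frob_norm_proj_le.
Qed.

(** The Hermitian dilation: it reduces operator-norm bounds for rectangular matrices to symmetric
    ones. *)
Definition dilation (R : realType) n1 n2 (G : 'M[R]_(n1, n2)) : 'M[R]_(n1 + n2) :=
  block_mx 0 G G^T 0.

Lemma dilation_tr (R : realType) n1 n2 (G : 'M[R]_(n1, n2)) :
  (dilation G)^T = dilation G.
Proof. by rewrite /dilation tr_block_mx !trmx0 trmxK. Qed.

Lemma dilationD (R : realType) n1 n2 (G H : 'M[R]_(n1, n2)) :
  dilation (G + H) = dilation G + dilation H.
Proof. by rewrite /dilation add_block_mx !addr0 -linearD. Qed.

Lemma dilationZ (R : realType) n1 n2 c (G : 'M[R]_(n1, n2)) :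
  dilation (c *: G) = c *: dilation G.
Proof. by rewrite /dilation scale_block_mx !scaler0 -linearZ. Qed.

Lemma dilation_sum (R : realType) n1 n2 (I : finType) (Q : pred I)
    (G : I -> 'M[R]_(n1, n2)) :
  dilation (\sum_(i | Q i) G i) = \sum_(i | Q i) dilation (G i).
Proof.
elim/big_rec2: _ => [|i a b _ <-]; last by rewrite dilationD.
by rewrite /dilation trmx0 block_mx0.
Qed.

Lemma dilation_norm_le (R : realType) n1 n2 (G : 'M[R]_(n1, n2)) t :
  (forall x : 'rV_(n1 + n2), frob_norm (x *m dilation G) <= t * frob_norm x) ->
  forall z : 'cV_n2, frob_norm (G *m z) <= t * frob_norm z.
Proof.
move=> H z; have := H (row_mx 0 z^T).
rewrite mul_row_block !mul0mx !mulmx0 !add0r -trmx_mul.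
have row0 p q (X : 'M[R]_(p, 1)) :
    frob_norm (row_mx (0 : 'rV_q) X^T) = frob_norm X.
  rewrite -[RHS]frob_norm_trmx /frob_norm !mxdotE !big_ord1 big_split_ord /=.
  rewrite big1 ?add0r => [|i _]; last by rewrite row_mxEl mxE mul0r.
  by congr Num.sqrt; apply: eq_bigr => i _; rewrite row_mxEr.
have row1 p q (X : 'M[R]_(p, 1)) :
    frob_norm (row_mx X^T (0 : 'rV_q)) = frob_norm X.
  rewrite -[RHS]frob_norm_trmx /frob_norm !mxdotE !big_ord1 big_split_ord /=.
  rewrite [X in _ + X]big1 ?addr0 => [|i _]; last by rewrite row_mxEr mxE mul0r.
  by congr Num.sqrt; apply: eq_bigr => i _; rewrite row_mxEl.
by rewrite row0 row1.
Qed.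

(* The square of the dilation of a matrix unit. *)
Definition diag_pair (R : realType) n1 n2 (k : 'I_n1 * 'I_n2) : 'M[R]_(n1 + n2) :=
  block_mx (delta_mx k.1 k.1) 0 0 (delta_mx k.2 k.2).

Lemma diag_pair_tr (R : realType) n1 n2 (k : 'I_n1 * 'I_n2) :
  (diag_pair R k)^T = diag_pair R k.
Proof. by rewrite /diag_pair tr_block_mx !trmx0 !trmx_delta. Qed.

Lemma diag_pair_idem (R : realType) n1 n2 (k : 'I_n1 * 'I_n2) :
  diag_pair R k *m diag_pair R k = diag_pair R k.
Proof.
by rewrite /diag_pair mulmx_block !(mulmx0, mul0mx, addr0, add0r) !mul_delta_mx.
Qed.

Lemma dilation_delta_sqr (R : realType) n1 n2 (k : 'I_n1 * 'I_n2) c :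
  dilation (c *: delta_mx k.1 k.2) *m dilation (c *: delta_mx k.1 k.2) =
  c ^+ 2 *: diag_pair R k.
Proof.
rewrite dilationZ -scalemxAl -scalemxAr scalerA -expr2; congr (_ *: _).
rewrite /dilation mulmx_block !(mulmx0, mul0mx, addr0, add0r) trmx_delta.
by rewrite !mul_delta_mx.
Qed.

Lemma sum_diag_pair (R : realType) n1 n2 :
  \sum_k diag_pair R k =
  block_mx (n2%:R%:M) 0 0 (n1%:R%:M) :> 'M[R]_(n1 + n2).
Proof.
have sum_delta n : \sum_i delta_mx i i = 1%:M :> 'M[R]_n.
  rewrite -diag_const_mx; apply/matrixP => i j; rewrite summxE (bigD1 i) //= big1.
    by rewrite !mxE !eqxx addr0 eq_sym.
  by move=> l li; rewrite mxE eq_sym (negPf li).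
have E1 : \sum_(k : 'I_n1 * 'I_n2) delta_mx k.1 k.1 = n2%:R%:M :> 'M[R]_n1.
  rewrite -(pair_bigA _ (fun i (j : 'I_n2) => delta_mx i i)) /=.
  under eq_bigr do rewrite sumr_const card_ord.
  by rewrite sumrMnl sum_delta -scaler_nat scalemx1.
have E2 : \sum_(k : 'I_n1 * 'I_n2) delta_mx k.2 k.2 = n1%:R%:M :> 'M[R]_n2.
  rewrite -(pair_bigA _ (fun (i : 'I_n1) j => delta_mx j j)) /=.
  by rewrite sumr_const card_ord sum_delta -scaler_nat scalemx1.
rewrite -E1 -E2 /diag_pair.
elim/big_rec3: _ => [|k a b c _ ->]; first by rewrite block_mx0.
by rewrite add_block_mx !addr0.
Qed.

(** The square of each dilated entry is at most [a ^+ 2] times a [diag_pair]. These are projections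
    whose full sum has blocks [n2] and [n1], the larger being [n1]; their own moment comes from
    [positive_moment_bound] with [B = 1]. *)
Lemma sampled_entries_moment (R : realType) n1 n2 m p (E : 'M[R]_(n1, n2))
    (a V : R) :
  (0 < n1 * n2)%N -> (n2 <= n1)%N -> (forall i j, `|E i j| <= a) ->
  0 < V ->
  2 * (m%:R / (n1 * n2)%:R * n1%:R) <= V ->
  p.*2.+1%:R * (V + 2 * (m%:R / (n1 * n2)%:R * n1%:R)) <= V ^+ 2 / 2 ->
  \sum_(S : {set 'I_n1 * 'I_n2} | #|S| == m)
    \tr (dilation (sample S E - (m%:R / (n1 * n2)%:R) *: E) ^+ p.*2.+2) <=
  #|[set S : {set 'I_n1 * 'I_n2} | #|S| == m]%SET|%:R * (2 * (n1 + n2)%:R)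
    * (4 * (p.*2.+1%:R * a ^+ 2) * V) ^+ p.+1.
Proof.
move=> N0 n21 Ea V0 wV HV.
have cI : #|{: 'I_n1 * 'I_n2}| = (n1 * n2)%N by rewrite card_prod !card_ord.
pose Y (k : 'I_n1 * 'I_n2) := dilation (E k.1 k.2 *: delta_mx k.1 k.2).
have sumY : \sum_k Y k = dilation E.
  rewrite -dilation_sum {2}[E]matrix_sum_delta pair_bigA /=; congr dilation.
have ZE S : centered_sum m Y S =
    dilation (sample S E - (m%:R / (n1 * n2)%:R) *: E).
  rewrite /centered_sum sumY cI -scaleNr -dilationZ -dilation_sum.
  by rewrite -dilationD scaleNr.
under eq_bigr do rewrite -ZE.
set w := m%:R / (n1 * n2)%:R * n1%:R in wV HV *.
have w0 : 0 <= w by rewrite mulr_ge0.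
have Dw x : m%:R / #|{: 'I_n1 * 'I_n2}|%:R *
    quad_form (\sum_k diag_pair R (k : 'I_n1 * 'I_n2)) x <= w * quad_form 1%:M x.
  rewrite cI /w -[leRHS]mulrA ler_wpM2l // sum_diag_pair -[x]hsubmxK -quad_formZ.
  rewrite scalemx1 [in leRHS]scalar_mx_block /quad_form tr_row_mx.
  rewrite !mul_row_block !mulmx0 !addr0 !add0r !mul_row_col !mul_mx_scalar.
  rewrite -!scalemxAl !mulmx_tr_mxdot !mxE eqxx !mulr1n lerD2r.
  by rewrite ler_wpM2r ?mxdot_ge0 // ler_nat.
apply: (@dominated_moment_bound _ _ _ _ _ Y (@diag_pair R n1 n2) (a ^+ 2) w V) => //.
- by rewrite cI.
- by move=> k; apply: dilation_tr.
- by move=> k; apply: diag_pair_tr.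
- exact: sqr_ge0.
- move=> k x; rewrite dilation_delta_sqr quad_formZ ler_wpM2r //.
    rewrite quad_form_idem ?diag_pair_tr ?diag_pair_idem //; exact: mxdot_ge0.
  rewrite -[E _ _ ^+ 2]ger0_norm ?sqr_ge0 // normrX lerXn2r ?nnegrE //.
  exact: le_trans (Ea k.1 k.2).
apply: (@positive_moment_bound _ _ _ _ _ (@diag_pair R n1 n2) 1 w) => //.
- by rewrite cI.
- by move=> k; apply: diag_pair_tr.
- by move=> k x; rewrite diag_pair_idem mul1r.
by rewrite mulr1.
Qed.

Lemma frob_norm_sqr_units (R : realType) n1 n2 q (X : 'M[R]_(n1 * n2, q)) :
  frob_norm X ^+ 2 = \sum_i \sum_j frob_norm (unit_vec R (i, j) *m X) ^+ 2.
Proof.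
rewrite frob_norm_sqr mxdotE (reindex _ (curry_mxvec_bij n1 n2)) [RHS]pair_bigA /=.
apply: eq_bigr => -[i j] _; rewrite /unit_vec mxvec_delta -rowE frob_norm_sqr.
by rewrite mxdotE big_ord1; apply: eq_bigr => l _; rewrite !mxE.
Qed.

Lemma span_proj_diag_ge0 (R : realType) n r (u : 'I_r -> 'cV[R]_n) i :
  0 <= span_proj u i i.
Proof.
rewrite /span_proj summxE sumr_ge0 // => k _.
by rewrite mxE big_ord1 mxE -expr2 sqr_ge0.
Qed.

(** By idempotence the squared norm is the entry at [k] of the projected unit, namely
    [x + y - x * y] for the two diagonal entries [x] and [y]. *)
Lemma unit_tangent_norm (R : realType) n1 n2 r (u : 'I_r -> 'cV[R]_n1)
    (v : 'I_r -> 'cV[R]_n2) (k : 'I_n1 * 'I_n2) :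
  orthonormal_family u -> orthonormal_family v ->
  mxdot (unit_vec R k *m tangent_mx u v) (unit_vec R k *m tangent_mx u v) <=
  span_proj u k.1 k.1 + span_proj v k.2 k.2.
Proof.
move=> ou ov; rewrite mxdot_mulr tangent_mx_tr -mulmxA tangent_mx_idem //.
rewrite /unit_vec mxvec_tangent_mx mxdot_mxvec mxdot_delta /tangent_proj !mxE.
have E1 : \sum_j span_proj u k.1 j * (delta_mx k.1 k.2 : 'M[R]_(n1, n2)) j k.2 =
    span_proj u k.1 k.1.
  rewrite (bigD1 k.1) //= mxE !eqxx mulr1 big1 ?addr0 // => l lk.
  by rewrite mxE (negPf lk) mulr0.
have E2 : \sum_j (delta_mx k.1 k.2 : 'M[R]_(n1, n2)) k.1 j * span_proj v j k.2 =
    span_proj v k.2 k.2.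
  rewrite (bigD1 k.2) //= mxE !eqxx mul1r big1 ?addr0 // => l lk.
  by rewrite mxE (negPf lk) andbF mul0r.
have E3 : \sum_j (span_proj u *m (delta_mx k.1 k.2 : 'M[R]_(n1, n2))) k.1 j *
    span_proj v j k.2 = span_proj u k.1 k.1 * span_proj v k.2 k.2.
  rewrite (bigD1 k.2) //= mxE E1 big1 ?addr0 // => l lk.
  rewrite mxE big1 ?mul0r // => l' _.
  by rewrite mxE (negPf lk) andbF mulr0.
by rewrite E1 E2 E3 gerBl mulr_ge0 // span_proj_diag_ge0.
Qed.

Lemma unit_tangent_norm_le (R : realType) n1 n2 r (u : 'I_r -> 'cV[R]_n1)
    (v : 'I_r -> 'cV[R]_n2) (mu0 : R) (k : 'I_n1 * 'I_n2) :
  orthonormal_family u -> orthonormal_family v ->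
  (0 < r)%N -> (n2 <= n1)%N -> 0 <= mu0 ->
  Num.max (coherence <<codom u>>%VS) (coherence <<codom v>>%VS) <= mu0 ->
  mxdot (unit_vec R k *m tangent_mx u v) (unit_vec R k *m tangent_mx u v) <=
  2 * mu0 * r%:R / n2%:R.
Proof.
move=> ou ov r0 n21 mu00; rewrite ge_max => /andP[cu cv].
apply: le_trans (unit_tangent_norm k ou ov) _.
have h1 := coherence_le k.1 ou r0 mu00 cu.
have h2 := coherence_le k.2 ov r0 mu00 cv.
have n20 : 0 < n2%:R :> R by rewrite ltr0n (leq_trans _ (ltn_ord k.2)).
have h3 : mu0 * r%:R / n1%:R <= mu0 * r%:R / n2%:R.
  rewrite ler_wpM2l ?mulr_ge0 // lef_pV2 ?ler_nat // posrE //.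
  by rewrite (lt_le_trans n20) ?ler_nat.
have -> : 2 * mu0 * r%:R / n2%:R = mu0 * r%:R / n2%:R + mu0 * r%:R / n2%:R.
  by rewrite -!mulrA mulr_natl mulr2n.
by apply: lerD => //; apply: le_trans h3.
Qed.

Lemma std_basis_outer (R : realType) n1 n2 (i : 'I_n1) (j : 'I_n2) :
  std_basis R i *m (std_basis R j)^T = delta_mx i j.
Proof. by rewrite /std_basis trmx_delta mul_delta_mx. Qed.

Lemma mu_Qperp_ge0 (R : realType) n1 n2 r h (u : 'I_r -> 'cV[R]_n1)
    (v : 'I_r -> 'cV[R]_n2) (A : 'I_h -> 'M[R]_(n1, n2)) : 0 <= mu_Qperp u v A.
Proof.
by apply: divr_ge0; apply: sumr_ge0 => i _; apply: sumr_ge0 => j _; apply: sqr_ge0.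
Qed.

(** Summed over matrix units, numerator and denominator of [mu_Qperp] are squared Frobenius norms of
    operator matrices. If the denominator is zero, the tangent projection vanishes and both sides
    are [0]. *)
Lemma mu_QperpE (R : realType) n1 n2 r h (u : 'I_r -> 'cV[R]_n1)
    (v : 'I_r -> 'cV[R]_n2) (A : 'I_h -> 'M[R]_(n1, n2)) :
  orthonormal_family u -> orthonormal_family v ->
  frob_norm (tangent_mx u v *m qperp_mx A) ^+ 2 =
  mu_Qperp u v A * frob_norm (tangent_mx u v) ^+ 2.
Proof.
move=> ou ov; rewrite /mu_Qperp; set a := \sum_i _; set b := \sum_i _.
have Ea : a = frob_norm (tangent_mx u v *m qperp_mx A) ^+ 2.
  rewrite -frob_norm_trmx trmx_mul tangent_mx_tr qperp_mx_tr frob_norm_sqr_units.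
  apply: eq_bigr => i _; apply: eq_bigr => j _.
  rewrite tangent_projP // -frob_norm_mxvec -mxvec_tangent_mx oproj_Qperp.
  by rewrite std_basis_outer mulmxA.
have Eb : b = frob_norm (tangent_mx u v) ^+ 2.
  rewrite frob_norm_sqr_units; apply: eq_bigr => i _; apply: eq_bigr => j _.
  by rewrite tangent_projP // -frob_norm_mxvec -mxvec_tangent_mx std_basis_outer.
rewrite -Eb -Ea; have [b0|b0] := eqVneq b 0; last by rewrite divfK.
rewrite b0 mulr0 Ea; move/eqP: b0; rewrite Eb sqrf_eq0 frob_norm_eq0 => /eqP ->.
by rewrite mul0mx frob_norm0 expr0n.
Qed.

Lemma frob_norm_svd_E (R : realType) n1 n2 r (u : 'I_r -> 'cV[R]_n1)
    (v : 'I_r -> 'cV[R]_n2) :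
  orthonormal_family u -> orthonormal_family v ->
  frob_norm (mxvec (svd_E u v)) = Num.sqrt r%:R.
Proof.
move=> ou ov; rewrite frob_norm_mxvec /frob_norm; congr Num.sqrt.
have /mxdot_svd -> : is_svd (svd_E u v) (fun=> 1) u v.
  by split=> //; rewrite /svd_E; apply: eq_bigr => k _; rewrite scale1r.
by rewrite sumr_const card_ord.
Qed.

Lemma nu_QperpE (R : realType) n1 n2 r h (u : 'I_r -> 'cV[R]_n1)
    (v : 'I_r -> 'cV[R]_n2) (A : 'I_h -> 'M[R]_(n1, n2)) : (0 < r)%N ->
  frob_norm (mxvec (svd_E u v) *m qperp_mx A) = Num.sqrt (nu_Qperp u v A * r%:R).
Proof.
move=> r0; rewrite /nu_Qperp mulrAC mulVf ?pnatr_eq0 -?lt0n // mul1r.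
by rewrite sqrtr_sqr ger0_norm ?frob_norm_ge0 // -oproj_Qperp frob_norm_mxvec.
Qed.

(** * Numerical estimates *)

Lemma sqrtr_prod_le (R : rcfType) (a b : R) : 0 <= a <= b -> Num.sqrt (a * b) <= b.
Proof.
move=> /andP[a0 ab]; have b0 := le_trans a0 ab.
rewrite -[leRHS](ger0_norm b0) -sqrtr_sqr ler_wsqrtr // expr2.
by rewrite ler_wpM2r.
Qed.

(** As [sqrt (b * y)] and [p] are at most [y], the left side is at most
    [12 * 28 * b * y = 336 * b * y], against [26 ^ 2 / 2 = 338] on the right. *)
Lemma moment_scale_admissible (R : rcfType) (b y p c : R) :
  0 <= b <= y -> 0 <= p <= y -> 0 <= c <= 12 * b ->
  c * (26 * Num.sqrt (b * y) + 2 * p) <= (26 * Num.sqrt (b * y)) ^+ 2 / 2.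
Proof.
move=> /[dup] /sqrtr_prod_le sy /andP[b0 y0] /andP[p0 py] /andP[c0 cb].
have by0 : 0 <= b * y by rewrite mulr_ge0 // (le_trans b0).
rewrite exprMn sqr_sqrtr //.
apply: (@le_trans _ _ (12 * b * (26 * y + 2 * y))); last by lra.
have s0 := sqrtr_ge0 (b * y).
by apply: ler_pM => //; lra.
Qed.

Lemma ler_of_sqr (R : realDomainType) (a b : R) : 0 <= b -> a ^+ 2 <= b ^+ 2 -> a <= b.
Proof.
move=> b0 ab; have [a0|/ltW a0] := lerP 0 a; last exact: le_trans a0 b0.
by rewrite -ler_sqr ?nnegrE.
Qed.

(** Everything is measured in units of [sqrt (p + q)]: [k] stands for the sampling deviation, with
    [c * t = 26 / 100 * k] and [k <= 1 / 4]; [X] for the constraint deviation, with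
    [X ^ 2 <= 1 / 8]; [U] for [sqrt (c * (p + t))], slightly above [1]. *)
Lemma certificate_numerics (R : rcfType) (p q c b s rho C : R) :
  let t := C / 100 * (26 * Num.sqrt (b * (p + q))) in
  0 < C -> 0 <= p -> 0 < q -> c * (p + q) = 1 -> 0 <= b -> 0 <= s -> 0 <= rho ->
  16 * C ^+ 2 * b <= p + q ->
  c * (q * s ^+ 2) <= 8^-1 ->
  c * (3 * C * Num.sqrt b * rho * (1 + Num.sqrt q)) <= 1 ->
  c * (2 * s * rho * Num.sqrt q * (1 + Num.sqrt q)) <= 1 ->
  c * (t + q * s ^+ 2) <= 2^-1 /\
  c * (Num.sqrt (p + t) + q * s) * (2 * (c * (t + q * s ^+ 2)) * rho) <= 3 / 5.
Proof.
move=> t C0 p0 q0 cpq b0 s0 r0 hb hx h2a h2b.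
have y0 : 0 < p + q by rewrite ltr_wpDl.
have c0 : 0 < c by rewrite -(pmulr_lgt0 _ y0) cpq.
set B := Num.sqrt b in h2a; have B0 : 0 <= B by apply: sqrtr_ge0.
have bE : b = B ^+ 2 by rewrite sqr_sqrtr.
set S := Num.sqrt q in h2a h2b; have S0 : 0 <= S by apply: sqrtr_ge0.
have qE : q = S ^+ 2 by rewrite sqr_sqrtr // ltW.
set Y := Num.sqrt (p + q); have Y0 : 0 < Y by rewrite sqrtr_gt0.
have yE : p + q = Y ^+ 2 by rewrite sqr_sqrtr // ltW.
have tE : t = C / 100 * (26 * (B * Y)) by rewrite /t sqrtrM.
clearbody t B S Y.
pose g := Y^-1; have g0 : 0 < g by rewrite invr_gt0.
have gY : g * Y = 1 by rewrite mulVf // gt_eqF.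
clearbody g.
have cE : c = g ^+ 2.
  have : c * (p + q) = g ^+ 2 * (p + q) by rewrite cpq yE -exprMn gY expr1n.
  by apply: mulIf; rewrite gt_eqF.
pose k := C * B * g.
have CB0 : 0 <= C * B by rewrite mulr_ge0 // ltW.
have k0 : 0 <= k by rewrite /k mulr_ge0 // ltW.
have ct : c * t = 26 / 100 * k.
  have -> : c * t = 26 / 100 * k * (g * Y) by rewrite cE tE /k; ring.
  by rewrite gY mulr1.
have kBg : 4 * k <= 1.
  have h : 4 * (C * B) <= Y.
    apply: ler_of_sqr; first exact: ltW.
    by rewrite -yE (le_trans _ hb) // le_eqVlt bE; apply/orP; left; apply/eqP; ring.
  have -> : 4 * k = g * (4 * (C * B)) by rewrite /k; ring.
  by rewrite -[leRHS]gY ler_wpM2l // ltW.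
pose X := g * s * S.
have X0 : 0 <= X by rewrite /X !mulr_ge0 // ltW.
have X2 : c * (q * s ^+ 2) = X ^+ 2 by rewrite cE qE /X; ring.
have X1 : X <= 36 / 100.
  by apply: ler_of_sqr; [lra|rewrite -X2 (le_trans hx) //; lra].
set V := Num.sqrt (p + t); have V0 : 0 <= V by apply: sqrtr_ge0.
have t0 : 0 <= t by rewrite -(pmulr_rge0 _ c0) ct mulr_ge0.
have V2 : V ^+ 2 = p + t by rewrite sqr_sqrtr ?addr_ge0.
clearbody V.
pose U := g * V; have U0 : 0 <= U by rewrite /U mulr_ge0 // ltW.
have U1 : U <= 11 / 10.
  apply: ler_of_sqr; first by lra.
  have : c * p <= 1 by rewrite -cpq ler_wpM2l ?(ltW c0) // lerDl ltW.
  rewrite /U exprMn -cE V2 mulrDr ct; lra.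
split; first by rewrite mulrDr ct X2; lra.
pose al := c * C * B * rho; pose eta := c * s * rho * S.
have al0 : 0 <= al by rewrite /al !mulr_ge0 // ltW.
have eta0 : 0 <= eta by rewrite /eta !mulr_ge0 // ltW.
have alS0 : 0 <= al * S by rewrite mulr_ge0.
have etaS0 : 0 <= eta * S by rewrite mulr_ge0.
have hal : 3 * (al + al * S) <= 1.
  by rewrite (le_trans _ h2a) // le_eqVlt /al; apply/orP; left; apply/eqP; ring.
have heta : 2 * (eta + eta * S) <= 1.
  by rewrite (le_trans _ h2b) // le_eqVlt /eta; apply/orP; left; apply/eqP; ring.
(* With [al + al * S <= 1 / 3] and [eta + eta * S <= 1 / 2], the first two terms contribute less
   than [0.2] and the last two less than [0.4]. *)
have -> : c * (V + q * s) * (2 * (c * (t + q * s ^+ 2)) * rho) =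
    52 / 100 * (U * al) + 52 / 100 * (X * (al * S)) + 2 * (U * X * eta)
    + 2 * (eta * S * X ^+ 2).
  by rewrite (mulrDr c t) ct X2 qE /al /eta cE /X /U /k; ring.
have h1 : U * al <= 11 / 10 * al by rewrite ler_wpM2r.
have h2 : X * (al * S) <= 36 / 100 * (al * S) by rewrite ler_wpM2r.
have h3 : U * X * eta <= 11 / 10 * (36 / 100) * eta.
  by rewrite ler_wpM2r // ler_pM.
have h4 : eta * S * X ^+ 2 <= eta * S * 8^-1.
  by rewrite ler_wpM2l // -X2.
clearbody al eta U X k.
lra.
Qed.

(* [y] is the effective sampling rate [p + q] and [b] the variance scale
   [beta ln n1 mu0 r / n2]. *)
Lemma sample_size_consequences (R : rcfType) (m q N1 N2 r lam mu0 mu s C : R) :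
  0 < N1 -> 0 < N2 -> 0 <= m -> 0 < q -> 0 < r -> r <= N2 -> 0 < lam ->
  0 < mu0 -> 0 <= mu -> 0 <= s -> 0 < C ->
  s ^+ 2 <= 2 * mu * mu0 * r * N1 ->
  Num.sqrt (10 * mu0 * r * N1 * N2)
    * (C * Num.sqrt (lam * r * N1) + N1 * N2 * Num.sqrt (mu * q))
    * (1 + Num.sqrt q) <= m + q * N1 * N2 ->
  16 * C ^+ 2 * lam * mu0 * r * N1 <= m + q * N1 * N2 ->
  16 * mu * mu0 * q * N1 ^+ 2 * N2 ^+ 2 <= m + q * N1 * N2 ->
  let y := m / (N1 * N2) + q in
  let b := lam * mu0 * r / N2 in
  [/\ 16 * C ^+ 2 * b <= y,
      y^-1 * (q * s ^+ 2) <= 8^-1,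
      y^-1 * (3 * C * Num.sqrt b * Num.sqrt r * (1 + Num.sqrt q)) <= 1
    & y^-1 * (2 * s * Num.sqrt r * Num.sqrt q * (1 + Num.sqrt q)) <= 1].
Proof.
move=> N10 N20 m0 q0 r0 rN2 lam0 mu00 mug0 s0 C0 hs h2 h3 h4 y b.
have N0 : 0 < N1 * N2 by rewrite mulr_gt0.
have yN : y * (N1 * N2) = m + q * N1 * N2.
  by rewrite /y mulrDl divfK ?gt_eqF // mulrA.
have y0 : 0 < y by rewrite ltr_wpDl // divr_ge0 // ltW.
have b0 : 0 < b by rewrite /b divr_gt0 // !mulr_gt0.
have bN : b * N2 = lam * mu0 * r by rewrite /b divfK // gt_eqF.
rewrite -yN in h2 h3 h4; clearbody y b.
have le1 (z : R) : z * (N1 * N2) <= y * (N1 * N2) -> y^-1 * z <= 1.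
  by rewrite ler_pM2r // mulrC ler_pdivrMr // mul1r.
set S := Num.sqrt q in h2 *; have S0 : 0 <= S by apply: sqrtr_ge0.
have S2 : S ^+ 2 = q by rewrite sqr_sqrtr // ltW.
set rho := Num.sqrt r; have rho0 : 0 <= rho by apply: sqrtr_ge0.
have rho2 : rho ^+ 2 = r by rewrite sqr_sqrtr // ltW.
set B := Num.sqrt b; have B0 : 0 <= B by apply: sqrtr_ge0.
have B2 : B ^+ 2 = b by rewrite sqr_sqrtr // ltW.
set G := Num.sqrt (10 * _ * _ * _ * _) in h2.
have G0 : 0 <= G by apply: sqrtr_ge0.
have G2 : G ^+ 2 = 10 * mu0 * r * N1 * N2.
  by rewrite sqr_sqrtr // !mulr_ge0 // ltW.
set H := Num.sqrt (lam * _ * _) in h2; have H0 : 0 <= H by apply: sqrtr_ge0.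
have H2 : H ^+ 2 = lam * r * N1 by rewrite sqr_sqrtr // !mulr_ge0 // ltW.
set K := Num.sqrt (mu * q) in h2; have K0 : 0 <= K by apply: sqrtr_ge0.
have K2 : K ^+ 2 = mu * q by rewrite sqr_sqrtr // mulr_ge0 // ltW.
clearbody S rho B G H K.
have S1 : 0 <= 1 + S by rewrite addr_ge0.
split.
- rewrite -(ler_pM2r N0) (le_trans _ h3) //.
  have -> : 16 * C ^+ 2 * b * (N1 * N2) = 16 * C ^+ 2 * N1 * (b * N2) by ring.
  by rewrite bN le_eqVlt; apply/orP; left; apply/eqP; ring.
- have h : 8 * (q * s ^+ 2) <= y.
    rewrite -(ler_pM2r N0) (le_trans _ h4) //.
    have e1 : 0 <= q * (N1 * N2) * 8 by rewrite !mulr_ge0 // ltW.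
    have e2 := ler_wpM2l e1 hs.
    have e3 : 0 <= 16 * mu * mu0 * q * N1 ^+ 2 * N2 by rewrite !mulr_ge0 // ltW.
    have e4 := ler_wpM2l e3 rN2.
    apply: (@le_trans _ _ (q * (N1 * N2) * 8 * (2 * mu * mu0 * r * N1))).
      by rewrite (le_trans _ e2) // le_eqVlt; apply/orP; left; apply/eqP; ring.
    apply: (@le_trans _ _ (16 * mu * mu0 * q * N1 ^+ 2 * N2 * r)).
      by rewrite le_eqVlt; apply/orP; left; apply/eqP; ring.
    by rewrite (le_trans e4) // le_eqVlt; apply/orP; left; apply/eqP; ring.
  by rewrite mulrC ler_pdivrMr //; lra.
- apply: le1; apply: le_trans h2.
  (* After squaring, [9] on the left meets the [10] under the root [G]. *)
  have h : 3 * (N1 * N2) * B * rho <= G * H.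
    apply: ler_of_sqr; first exact: mulr_ge0.
    rewrite !exprMn B2 rho2 G2 H2.
    have e : 0 <= lam * mu0 * r ^+ 2 * N1 ^+ 2 * N2.
      by rewrite !mulr_ge0 ?sqr_ge0 // ltW.
    have -> : 3 ^+ 2 * (N1 ^+ 2 * N2 ^+ 2) * b * r = 9 * (N1 ^+ 2 * N2 * r) * (b * N2).
      by ring.
    by rewrite bN; lra.
  apply: (@le_trans _ _ (C * (1 + S) * (G * H))).
    have e : 0 <= C * (1 + S) by rewrite mulr_ge0 // ltW.
    rewrite (le_trans _ (ler_wpM2l e h)) // le_eqVlt; apply/orP; left; apply/eqP.
    by ring.
  have -> : C * (1 + S) * (G * H) = G * (C * H) * (1 + S) by ring.
  by rewrite ler_wpM2r // ler_wpM2l // lerDl !mulr_ge0 // ltW.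
apply: le1; apply: le_trans h2.
(* After squaring, the bound on [s ^+ 2] and [r <= N2] give [8] on the left against the [10] under
   [G]. *)
have h : 2 * s * rho * S <= G * K.
  apply: ler_of_sqr; first exact: mulr_ge0.
  rewrite !exprMn rho2 S2 G2 K2.
  have e1 : 0 <= 4 * r * q by rewrite !mulr_ge0 // ltW.
  have e2 := ler_wpM2l e1 hs.
  have e3 : 0 <= 8 * mu * mu0 * r * N1 * q by rewrite !mulr_ge0 // ltW.
  have e4 := ler_wpM2l e3 rN2.
  have e5 : 0 <= mu * mu0 * r * N1 * q * N2 by rewrite !mulr_ge0 // ltW.
  have -> : 2 ^+ 2 * s ^+ 2 * r * q = 4 * r * q * s ^+ 2 by ring.
  apply: le_trans e2 _.
  have -> : 4 * r * q * (2 * mu * mu0 * r * N1) = 8 * mu * mu0 * r * N1 * q * r.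
    by ring.
  by apply: le_trans e4 _; lra.
apply: (@le_trans _ _ ((N1 * N2) * (1 + S) * (G * K))).
  have e : 0 <= (N1 * N2) * (1 + S) by rewrite !mulr_ge0 // ltW.
  rewrite (le_trans _ (ler_wpM2l e h)) // le_eqVlt; apply/orP; left; apply/eqP.
  by ring.
have -> : N1 * N2 * (1 + S) * (G * K) = G * (N1 * N2 * K) * (1 + S) by ring.
by rewrite ler_wpM2r // ler_wpM2l // lerDr mulr_ge0 // ltW.
Qed.

(** Dropping the cross term of the square separates the two conclusions. In the first, [2 ^ 2] gives
    the quarter. In the second, [(10 * 16) ^ 2 = 100 * 256]: the [100] gives the tenth, and [256]
    dominates the [224] in the bound on [W]. *)
Lemma entrywise_size_consequences (R : rcfType)
    (m q N1 N2 r lam nu0 snr kappa e W : R) :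
  0 < N1 -> 0 < N2 -> 0 <= m -> 0 < q -> 0 < r -> 0 < lam -> 0 < nu0 ->
  0 <= snr -> 0 < kappa -> 1 <= e -> 0 <= W ->
  (10 * 16 * kappa * nu0 * Num.sqrt (lam * r * N1) * e
    + 2 * Num.sqrt (q * N1 * N2 * snr)) ^+ 2 <= m + q * N1 * N2 ->
  W <= 224 * lam * (nu0 * Num.sqrt (r / (N1 * N2))) ^+ 2 * (m / (N1 * N2) * N1) ->
  let y := m / (N1 * N2) + q in
  y^-1 * q * snr <= 4^-1 /\ y^-1 * (kappa * Num.sqrt W) <= 10^-1.
Proof.
move=> N10 N20 m0 q0 r0 lam0 nu00 snr0 k0 e1 W0 hX hW y.
have N0 : 0 < N1 * N2 by rewrite mulr_gt0.
have yN : y * (N1 * N2) = m + q * N1 * N2.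
  by rewrite /y mulrDl divfK ?gt_eqF // mulrA.
have my : m / (N1 * N2) <= y by rewrite /y lerDl ltW.
have y0 : 0 < y by rewrite ltr_wpDl // divr_ge0 // ltW.
have p0 : 0 <= m / (N1 * N2) by rewrite divr_ge0 // ltW.
rewrite -yN in hX; clearbody y.
set X := 10 * 16 * kappa * nu0 * _ * e in hX; set Y := 2 * Num.sqrt _ in hX.
have X0 : 0 <= X.
  by rewrite /X !mulr_ge0 ?sqrtr_ge0 ?(ltW k0) ?(ltW nu00) // (le_trans _ e1).
have Y0 : 0 <= Y by rewrite mulr_ge0 // sqrtr_ge0.
have XY : X ^+ 2 + Y ^+ 2 <= y * (N1 * N2).
  by rewrite (le_trans _ hX) // sqrrD lerD2r lerDl mulrn_wge0 // mulr_ge0.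
have Y2 : Y ^+ 2 = 4 * (q * snr) * (N1 * N2).
  rewrite /Y exprMn sqr_sqrtr; first by ring.
  by rewrite !mulr_ge0 // ltW.
have X2 : 0 <= X ^+ 2 by rewrite sqr_ge0.
have Y20 : 0 <= Y ^+ 2 by rewrite sqr_ge0.
split.
  have h : 4 * (q * snr) <= y.
    by rewrite -(ler_pM2r N0) -Y2 (le_trans _ XY) // lerDr.
  by rewrite -mulrA mulrC ler_pdivrMr //; lra.
pose z := kappa ^+ 2 * nu0 ^+ 2 * lam * r / N2.
have z0 : 0 <= z.
  by rewrite /z divr_ge0 ?(ltW N20) // !mulr_ge0 ?sqr_ge0 // ltW.
have zy : 100 * (256 * z) <= y.
  rewrite -(ler_pM2r N0); apply: le_trans XY.
  apply: (@le_trans _ _ (X ^+ 2)); last by rewrite lerDl.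
  pose X1 := kappa * nu0 * Num.sqrt (lam * r * N1).
  have X10 : 0 <= X1.
    by rewrite /X1 !mulr_ge0 ?sqrtr_ge0 ?(ltW k0) ?(ltW nu00).
  have -> : 100 * (256 * z) * (N1 * N2) = (10 * 16 * X1) ^+ 2.
    rewrite /X1 !exprMn sqr_sqrtr; last by rewrite !mulr_ge0 // ltW.
    by rewrite /z; field; rewrite gt_eqF.
  have XE : X = 10 * 16 * X1 * e by rewrite /X /X1 !mulrA.
  have X100 : 0 <= 10 * 16 * X1 by apply: mulr_ge0 => //; apply: mulr_ge0.
  apply: lerXn2r; rewrite ?nnegrE //.
  by rewrite XE ler_peMr.
have hW2 : kappa ^+ 2 * W <= 224 * z * y.
  apply: (@le_trans _ _ (224 * z * (m / (N1 * N2)))); last first.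
    exact: (ler_wpM2l (mulr_ge0 (ler0n _ 224) z0) my).
  apply: le_trans (ler_wpM2l (sqr_ge0 kappa) hW) _.
  rewrite exprMn sqr_sqrtr; last by rewrite divr_ge0 // ltW.
  rewrite le_eqVlt /z; apply/orP; left; apply/eqP.
  by field; rewrite !gt_eqF.
have h : 10 * (kappa * Num.sqrt W) <= y.
  apply: ler_of_sqr; first exact: ltW.
  rewrite !exprMn sqr_sqrtr //.
  have := ler_wpM2r (ltW y0) zy.
  have : 0 <= z * y by rewrite mulr_ge0 // ltW.
  rewrite -[y ^+ 2]/(y * y).
  by move: hW2; move: (kappa ^+ 2 * W) => w; lra.
by rewrite mulrC ler_pdivrMr //; lra.
Qed.

(** The exponents compare as [(2 + beta) ln N1 <= 4 beta ln N1 <= 4 l], using [beta >= 1]; [N1 ^+ 2]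
    stands for the dimension in the trace bounds. *)
Lemma moment_tail_power (R : realType) (N1 beta : R) l :
  1 <= N1 -> 1 <= beta -> beta * ln N1 <= l%:R ->
  N1 ^+ 2 <= N1 `^ (- beta) * expR 2 ^+ l.*2.
Proof.
move=> N11 b1 hl; have N10 : 0 < N1 by apply: lt_le_trans N11.
have x0 : 0 <= ln N1 by apply: ln_ge0.
rewrite -{1}(lnK (_ : N1 \is Num.pos)) ?posrE // -!expRM_natl.
rewrite /powR gt_eqF // -expRD ler_expR.
rewrite -muln2 natrM.
have : ln N1 <= beta * ln N1 by rewrite ler_peMl.
lra.
Qed.

Lemma trace_even_power_ge0 (R : realType) n (Z : 'M[R]_n) k :
  Z^T = Z -> 0 <= \tr (Z ^+ k.*2.+2).
Proof.
move=> Zs; have := @trace_sqr_exp_ge0 R n Z 1%:M k.+1 Zs (trmx1 _ _).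
by rewrite !mul1mx.
Qed.

(** From [expR (- 1/2) >= 1 - 1/2] follows [expR (1/2) <= 2]. *)
Lemma ln_ge_half (R : realType) (x : R) : 2 <= x -> 2^-1 <= ln x.
Proof.
move=> x2; have x0 : 0 < x by apply: lt_le_trans x2.
rewrite -ler_expR lnK ?posrE // (le_trans _ x2) //.
have h := expR_ge1Dx (- 2^-1 : R).
have e0 := expR_gt0 (2^-1 : R).
have e1 : expR (2^-1) * expR (- 2^-1) = 1 :> R by rewrite -expRD subrr expR0.
have e2 : 0 <= expR (2^-1) * (expR (- 2^-1) - 2^-1) :> R.
  by rewrite mulr_ge0 ?(ltW e0) //; lra.
by rewrite mulrBr e1 in e2; lra.
Qed.

Lemma entry_weight_le (R : realFieldType) (d lam x w : R) :
  0 <= x -> 0 <= w -> d <= 4 * lam -> 4 * (d * x) * (14 * w) <= 224 * lam * x * w.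
Proof.
move=> x0 w0 dl; have := ler_wpM2r (mulr_ge0 x0 w0) dl.
have -> : 4 * (d * x) * (14 * w) = 56 * (d * (x * w)) by ring.
have -> : 224 * lam * x * w = 56 * (4 * lam * (x * w)) by ring.
by rewrite ler_pM2l // ltr0n.
Qed.

(** The level [14 * w] is admissible because [4 * 16 = 64 <= 98 = 14 ^ 2 / 2]; it enters
    [entry_weight_le] as [4 * 4 * 14 = 224]. *)
Lemma linear_moment_scale (R : realFieldType) (d w : R) :
  0 <= w -> d <= 4 * w -> d * (14 * w + 2 * w) <= (14 * w) ^+ 2 / 2.
Proof.
move=> w0 dw; have w16 : 0 <= 14 * w + 2 * w by lra.
apply: le_trans (ler_wpM2r w16 dw) _.
by have := sqr_ge0 w; rewrite exprMn; lra.
Qed.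

Lemma dilation_size_le (R : realFieldType) (N1 N2 : R) :
  2 <= N1 -> N2 <= N1 -> 2 * (N1 + N2) <= 5 * N1 ^+ 2.
Proof.
move=> N12 N21; rewrite expr2.
have : 2 * N1 <= N1 * N1 by rewrite ler_wpM2r // (le_trans _ N12).
lra.
Qed.

Lemma error_budget (R : realFieldType) (x1 x2 x3 : R) :
  x1 <= 10^-1 -> x2 <= 4^-1 -> x3 <= 3 / 5 -> x1 + x2 + x3 < 1.
Proof. lra. Qed.

(** * Exact recovery *)

Lemma minimizers_rank0 (R : realType) n1 n2 h (M : 'M[R]_(n1, n2))
    (sigma : 'I_0 -> R) (u : 'I_0 -> 'cV[R]_n1) (v : 'I_0 -> 'cV[R]_n2)
    (A : 'I_h -> 'M[R]_(n1, n2)) (b : 'I_h -> R) (Omega : {set 'I_n1 * 'I_n2}) :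
  is_svd M sigma u v -> (forall l, mxdot (A l) M = b l) ->
  minimizers A b M Omega = [set M].
Proof.
move=> svdM AM; have M0 : M = 0 by have [_ _ _ ->] := svdM; rewrite big_ord0.
have nM : nuclear_norm M <= 0.
  by have := nuclear_norm_svd_le svdM; rewrite big_ord0.
have fM : feasible A b M Omega M by [].
apply/seteqP; split=> [X [fX minX]|X ->].
  rewrite /= M0; apply: nuclear_norm_eq0; apply/eqP.
  by rewrite eq_le nuclear_norm_ge0 andbT (le_trans (minX _ fM)).
split=> // Y fY; apply: le_trans nM _; exact: nuclear_norm_ge0.
Qed.

Lemma unif_subset_prob_all (R : realType) (I : finType) m (P : {set I} -> Prop) :
  (m <= #|I|)%N -> (forall S, P S) -> 1 <= unif_subset_prob R m P.
Proof.
move=> mI HP; have := @unif_subset_prob_ge R I m P pred0 pred0 0 0 mI.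
have E0 : [set S : {set I} | (#|S| == m) && pred0 S]%SET = finset.set0.
  by apply/setP => S; rewrite !inE andbF.
rewrite addr0 subr0; apply=> [S _ _ _||]; first exact: HP.
  by rewrite E0 cards0 mulr0.
by rewrite E0 cards0 mulr0.
Qed.

Lemma unif_subset_prob_ge0 (R : realType) (I : finType) m (P : {set I} -> Prop) :
  0 <= unif_subset_prob R m P.
Proof. by rewrite divr_ge0. Qed.

Theorem theorem1 (R : realType) :
  exists C_R C_K : R, [/\ 0 < C_R, 0 < C_K &
  forall (n1 n2 r h m : nat) (M : 'M[R]_(n1, n2))
    (sigma : 'I_r -> R) (u : 'I_r -> 'cV[R]_n1) (v : 'I_r -> 'cV[R]_n2)
    (A : 'I_h -> 'M[R]_(n1, n2)) (b : 'I_h -> R) (mu0 nu0 beta q : R),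
  let N1 : R := n1%:R in
  let N2 : R := n2%:R in
  let r' : R := r%:R in
  let m' : R := m%:R in
  let mu : R := mu_Qperp u v A in
  let nu : R := nu_Qperp u v A in
  (n2 <= n1)%N ->
  \rank M = r ->
  is_svd M sigma u v ->
  (forall l, mxdot (A l) M = b l) ->
  0 < mu0 ->
  Num.max (coherence <<codom u>>%VS) (coherence <<codom v>>%VS) <= mu0 ->
  (forall i j, `|svd_E u v i j| <= nu0 * Num.sqrt (r' / (N1 * N2))) ->
  1 <= beta ->
  0 < q ->
  (m <= n1 * n2)%N ->
  m' > (C_K * expR 1 ^+ 2 * nu0 * Num.sqrt (beta * r' * N1 * ln N1)
          * 2 `^ (2 / (beta * ln N1) + 5 / 2)
        + 2 * Num.sqrt (q * N1 * N2 * Num.sqrt (nu * r'))) ^+ 2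
       - q * N1 * N2 ->
  m' > Num.sqrt (10 * mu0 * r' * N1 * N2)
       * (C_R * Num.sqrt (beta * r' * N1 * ln N1)
          + N1 * N2 * Num.sqrt (mu * q))
       * (1 + Num.sqrt q)
       - q * N1 * N2 ->
  m' >= 2 ^+ 4 * C_R ^+ 2 * beta * mu0 * r' * N1 * ln N1 - q * N1 * N2 ->
  m' >= 2 ^+ 4 * mu * mu0 * q * N1 ^+ 2 * N2 ^+ 2 - q * N1 * N2 ->
  m' >= q * N1 * N2 * Num.sqrt (nu * r') - q * N1 * N2 ->
  m' >= Num.max 2 beta * N1 * ln N1 ->
  1 - 6 * N1 `^ (- beta) <=
    unif_subset_prob R m
      (fun Omega : {set 'I_n1 * 'I_n2} => minimizers A b M Omega = [set M])].
Proof.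
have k0 : 0 < expR 2 :> R by apply: expR_gt0.
(* [expR 2] pays for Markov's inequality, and [100] is the slack divided out in
   [certificate_numerics]. The other constant is the one squared in [entrywise_size_consequences],
   where the [expR 1 ^+ 2] of the hypothesis plays the part of [kappa]. *)
exists (100 * expR 2), (10 * 16); split; rewrite ?mulr_gt0 //.
move=> n1 n2 r h m M sigma u v A b mu0 nu0 beta q N1 N2 r' m' mu nu n21 rM svdM AM
  mu00 coh Ebound beta1 q0 mN c1 c2 c3 c4 _ c6.
have mI : (m <= #|{: 'I_n1 * 'I_n2}|)%N by rewrite card_prod !card_ord.
(* For [r = 0] the normalizations by [r] and by the dimension degenerate, but [M = 0] is then the
   unique minimizer for every sample. *)
have [r0|r_gt0] := posnP r.
  move: r0 rM sigma u v @mu @nu svdM coh Ebound c1 c2 c3 c4 => r0; subst r.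
  move=> rM sigma u v mu nu svdM _ _ _ _ _ _.
  apply: (@le_trans _ _ 1); first by rewrite gerBl mulr_ge0 // powR_ge0.
  apply: unif_subset_prob_all => // S; exact: minimizers_rank0 svdM AM.
have [ou ov _ _] := svdM.
have rn2 : (r <= n2)%N by rewrite -rM rank_leq_col.
have n2_gt0 : (0 < n2)%N by apply: leq_trans rn2.
have n1_gt0 : (0 < n1)%N by apply: leq_trans n21.
(* For [n1 = 1] the claimed probability is negative; otherwise [ln N1] is bounded below, which the
   choice of moment order relies on. *)
have [n11|n1_gt1] := leqP n1 1.
  have -> : N1 = 1 by rewrite /N1 (_ : n1 = 1%N) //; apply/eqP; rewrite eqn_leq n11.
  rewrite powR1; apply: le_trans (unif_subset_prob_ge0 _ _ _); lra.
have N10 : 0 < N1 by rewrite ltr0n.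
have N20 : 0 < N2 by rewrite ltr0n.
have r'0 : 0 < r' by rewrite ltr0n.
have rN2 : r' <= N2 by rewrite ler_nat.
have m'0 : 0 <= m' by apply: ler0n.
have N12 : 2 <= N1 by rewrite ler_nat.
have N21 : N2 <= N1 by rewrite ler_nat.
have NE : (n1 * n2)%:R = N1 * N2 :> R by rewrite natrM.
pose lam := beta * ln N1.
have ln2 : 2^-1 <= ln N1 by apply: ln_ge_half.
have lam2 : 2^-1 <= lam.
  by rewrite /lam (le_trans ln2) // ler_peMl // (le_trans _ ln2).
have lam0 : 0 < lam by apply: lt_le_trans lam2.
have lamdef : lam = beta * ln N1 by [].
clearbody lam.
(* moments of order [2 pn + 2], with [pn + 1] just above [beta ln n1], turn the
   factor [expR 2] lost in Markov's inequality into a power of [n1] *)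
pose pn := Num.truncn lam.
have /andP[pn1 pn2] : pn%:R <= lam < pn.+1%:R by apply: truncn_itv; apply: ltW.
(* Uses [lam >= 1 / 2] to absorb the [1] in [2 * pn + 1 <= 2 * lam + 1]. *)
have pn4 : pn.*2.+1%:R <= 4 * lam by rewrite -addn1 -mul2n natrD natrM; lra.
pose P := tangent_mx u v; pose Q := qperp_mx A; pose E := svd_E u v.
pose p := m' / (N1 * N2); pose y := p + q.
have p0 : 0 <= p by rewrite divr_ge0 // mulr_ge0 // ltW.
have y0 : 0 < y by rewrite ltr_wpDl.
pose B := 2 * mu0 * r' / N2; pose bb := lam * mu0 * r' / N2.
have bb0 : 0 < bb by rewrite divr_gt0 // !mulr_gt0.
have B0 : 0 <= B by rewrite divr_ge0 ?(ltW N20) // !mulr_ge0 // ltW.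
pose s := frob_norm (P *m Q).
have units k : mxdot (unit_vec R k *m P) (unit_vec R k *m P) <= B.
  by apply: unit_tangent_norm_le => //; apply: ltW.
have mu_ge0 : 0 <= mu by apply: mu_Qperp_ge0.
have s2 : s ^+ 2 <= 2 * mu * mu0 * r' * N1.
  rewrite /s mu_QperpE // -/mu.
  have : frob_norm P ^+ 2 <= N1 * N2 * B.
    rewrite frob_norm_sqr_units.
    apply: (@le_trans _ _ (\sum_(i < n1) \sum_(j < n2) B)).
      by do 2!apply: ler_sum => ? _; rewrite frob_norm_sqr.
    by rewrite !sumr_const !card_ord -mulrnA mulnC -[leLHS]mulr_natl NE.
  move=> /(ler_wpM2l mu_ge0)/le_trans; apply.
  by rewrite le_eqVlt; apply/orP; left; apply/eqP; rewrite /B; field; rewrite gt_eqF.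
have C0 : 0 < 100 * expR 2 :> R by apply: mulr_gt0 => //; rewrite ltr0n.
have lamE : beta * r' * N1 * ln N1 = lam * r' * N1 by rewrite lamdef; ring.
have [] := @sample_size_consequences _ m' q N1 N2 r' lam mu0 mu s (100 * expR 2)
  N10 N20 m'0 q0 r'0 rN2 lam0 mu00 mu_ge0 (frob_norm_ge0 _) C0 s2.
- move: c2; rewrite lamE ltrBlDr => /ltW; by [].
- rewrite lerBlDr in c3; apply: le_trans c3; rewrite le_eqVlt lamdef.
  by apply/orP; left; apply/eqP; ring.
- rewrite lerBlDr in c4; apply: le_trans c4; rewrite le_eqVlt.
  by apply/orP; left; apply/eqP; ring.
rewrite -/p -/y -/bb => hb hx h2a h2b.
pose t := expR 2 * (26 * Num.sqrt (bb * y)).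
have [hD hsum] : y^-1 * (t + q * s ^+ 2) <= 2^-1 /\
    y^-1 * (Num.sqrt (p + t) + q * s) * (2 * (y^-1 * (t + q * s ^+ 2)) * Num.sqrt r')
    <= 3 / 5.
  have := @certificate_numerics _ p q y^-1 bb s (Num.sqrt r') (100 * expR 2)
    C0 p0 q0 _ (ltW bb0) (frob_norm_ge0 _) (sqrtr_ge0 _) hb hx h2a h2b.
  rewrite (_ : 100 * expR 2 / 100 = expR 2); last by field.
  rewrite -/t.
  by apply; rewrite mulVf ?gt_eqF.
(* A nonpositive [nu0] would force [svd_E] to vanish, although its Frobenius norm is [sqrt r]. *)
have nu00 : 0 < nu0.
  rewrite ltNge; apply/negP => nu00.
  have : Num.sqrt r' = 0.
    rewrite -(frob_norm_svd_E ou ov) frob_norm_mxvec; apply/eqP.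
    rewrite frob_norm_eq0; apply/eqP/matrixP => i j; rewrite [RHS]mxE.
    apply/eqP; rewrite -normr_le0 (le_trans (Ebound i j)) //.
    by rewrite mulr_le0_ge0 // sqrtr_ge0.
  by move/eqP; rewrite sqrtr_eq0 leNgt r'0.
pose a := nu0 * Num.sqrt (r' / (N1 * N2)).
have a0 : 0 < a by rewrite mulr_gt0 // sqrtr_gt0 divr_gt0 // mulr_gt0.
pose w := m%:R / (n1 * n2)%:R * n1%:R : R.
have wE : w = m' / N2.
  by rewrite /w NE -/m' -/N1; field; rewrite !gt_eqF.
(* [w = m / n2] is the mean number of samples per column; the last sample-size condition and
   [n2 <= n1] make it at least the moment order scale [lam]. *)
have lamw : lam <= w.
  rewrite wE ler_pdivlMr //.
  have h1 : lam * N1 <= m'.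
    apply: le_trans c6; rewrite lamdef -mulrA (mulrC (ln N1)) mulrA.
    by rewrite !ler_wpM2r ?(ltW N10) ?(le_trans _ ln2) // le_max lexx orbT.
  by rewrite (le_trans _ h1) // ler_wpM2l // ltW.
have w0 : 0 < w by apply: lt_le_trans lamw.
pose V := 14 * w; have V0 : 0 < V by rewrite mulr_gt0.
pose W := 4 * (pn.*2.+1%:R * a ^+ 2) * V.
have W0 : 0 < W.
  apply: mulr_gt0 => //; apply: mulr_gt0 => //.
  by apply: mulr_gt0; rewrite ?exprn_gt0 // ltr0n.
have W224 : W <= 224 * lam * a ^+ 2 * (m' / (N1 * N2) * N1).
  have -> : m' / (N1 * N2) * N1 = w by rewrite /w NE.
  exact: entry_weight_le (sqr_ge0 a) (ltW w0) pn4.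
pose t2 := expR 2 * Num.sqrt W.
pose snr := Num.sqrt (nu * r').
have [hsnr ht2] : y^-1 * q * snr <= 4^-1 /\ y^-1 * t2 <= 10^-1.
  pose e : R := 2 `^ (2 / (beta * ln N1) + 5 / 2).
  apply: (@entrywise_size_consequences _ m' q N1 N2 r' lam nu0 snr (expR 2) e W) => //.
  - exact: sqrtr_ge0.
  - apply: (@le_trans _ _ (2 `^ 0)); first by rewrite powRr0.
    by apply: ler_powR; rewrite ?ler1n // addr_ge0 ?divr_ge0 // -lamdef ltW.
  - exact: ltW.
  move: c1; rewrite lamE ltrBlDr -expRM_natl mulr1 => /ltW.
  by [].
pose K : R := #|[set S : {set 'I_n1 * 'I_n2} | #|S| == m]%SET|%:R.
have K0 : 0 <= K by apply: ler0n.
pose Z1 (S : {set 'I_n1 * 'I_n2}) :=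
  P *m (sample_mx R S - (m%:R / (n1 * n2)%:R)%:M) *m P.
pose Z2 (S : {set 'I_n1 * 'I_n2}) :=
  dilation (sample S E - (m%:R / (n1 * n2)%:R) *: E).
have Pt : P^T = P by apply: tangent_mx_tr.
have PP : P *m P = P by apply: tangent_mx_idem.
have Z1s S : (Z1 S)^T = Z1 S.
  have Ds (x : R) : (sample_mx R S - x%:M)^T = sample_mx R S - x%:M.
    by rewrite raddfB /= sample_mx_tr tr_scalar_mx.
  by rewrite /Z1 trmx_mul trmx_mul Pt Ds mulmxA.
have Z2s S : (Z2 S)^T = Z2 S by apply: dilation_tr.
pose L := 26 * Num.sqrt (bb * y).
have L0 : 0 < L by rewrite mulr_gt0 // sqrtr_gt0 mulr_gt0.
have t0 : 0 < t by rewrite /t mulr_gt0.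
have t20 : 0 < t2 by rewrite /t2 mulr_gt0 // sqrtr_gt0.
have N11 : 1 <= N1 by apply: le_trans N12; rewrite ler1n.
have tail : N1 ^+ 2 <= N1 `^ (- beta) * expR 2 ^+ pn.*2.+2.
  by rewrite -doubleS; apply: moment_tail_power; rewrite // -lamdef ltW.
have by_y : bb <= y.
  apply: le_trans hb; rewrite ler_peMl ?(ltW bb0) //.
  have e1 : 1 <= expR 2 :> R by rewrite (le_trans _ (expR_ge1Dx _)) // lerDl.
  have e2 : 1 <= (100 * expR 2) ^+ 2 :> R.
    by rewrite exprn_ege1 // (le_trans e1) // ler_peMl ?(ltW k0) // ler1n.
  by rewrite (le_trans e2) // ler_peMl ?ler1n // (le_trans _ e2).
pose c5 := N1 `^ (- beta).
have c50 : 0 <= c5 by apply: powR_ge0.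
have bad1 : #|[set S : {set 'I_n1 * 'I_n2} |
    (#|S| == m) && (t ^+ pn.*2.+2 < \tr (Z1 S ^+ pn.*2.+2))]%SET|%:R <= K * c5.
  apply: markov_subsets => [S||]; rewrite ?exprn_gt0 //.
    exact: trace_even_power_ge0.
  apply: (@le_trans _ _ (K * (n1 * n2)%:R * L ^+ pn.*2.+2)).
    apply: (@projected_sampling_moment R n1 n2 m pn P B L) => //.
      by rewrite muln_gt0 n1_gt0.
    rewrite NE -/m' -/p; apply: moment_scale_admissible.
    - by rewrite (ltW bb0) by_y.
    - by rewrite p0 lerDl ltW.
    rewrite mulr_ge0 //=.
    have := ler_wpM2r B0 pn4.
    have -> : 4 * lam * B = 8 * bb by rewrite /B /bb; ring.
    by move/le_trans; apply; rewrite ler_wpM2r ?(ltW bb0) // ler_nat.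
  have -> : t ^+ pn.*2.+2 = expR 2 ^+ pn.*2.+2 * L ^+ pn.*2.+2 by rewrite -exprMn.
  rewrite [leRHS]mulrA; apply: ler_wpM2r; first by rewrite exprn_ge0 // ltW.
  rewrite -[leRHS]mulrA; apply: ler_wpM2l => //.
  by apply: le_trans tail; rewrite NE expr2 ler_wpM2l // ltW.
have bad2 : #|[set S : {set 'I_n1 * 'I_n2} |
    (#|S| == m) && (t2 ^+ pn.*2.+2 < \tr (Z2 S ^+ pn.*2.+2))]%SET|%:R <= K * (5 * c5).
  apply: markov_subsets => [S||]; rewrite ?exprn_gt0 //.
    exact: trace_even_power_ge0.
  apply: (@le_trans _ _ (K * (2 * (n1 + n2)%:R) * W ^+ pn.+1)).
    apply: (@sampled_entries_moment R n1 n2 m pn E a V) => //.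
    - by rewrite muln_gt0 n1_gt0.
    - by rewrite -/w /V ler_wpM2r ?(ltW w0) // ler_nat.
    rewrite -/w /V.
    apply: linear_moment_scale; first exact: ltW.
    by apply: le_trans pn4 _; rewrite ler_wpM2l.
  have -> : t2 ^+ pn.*2.+2 = expR 2 ^+ pn.*2.+2 * W ^+ pn.+1.
    by rewrite exprMn -[in LHS]doubleS [X in _ * X]exprn_double_sqr sqr_sqrtr // ltW.
  rewrite [leRHS]mulrA; apply: ler_wpM2r; first by rewrite exprn_ge0 // ltW.
  rewrite -[leRHS]mulrA; apply: ler_wpM2l => //; rewrite -[leRHS]mulrA.
  apply: (@le_trans _ _ (5 * N1 ^+ 2)); last by apply: ler_wpM2l.
  by rewrite natrD -/N1 -/N2 dilation_size_le.
(* The tangent-space event costs one unit of [c5]; the entrywise event costs five, from the bound of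
   its dimension factor by [5 * N1 ^+ 2]. *)
have -> : 6 * N1 `^ (- beta) = c5 + 5 * c5 by rewrite /c5; ring.
apply: (unif_subset_prob_ge mI _ bad1 bad2) => S mS; rewrite -!leNgt => g1 g2.
apply: (@recovery_criterion _ _ _ _ _ M sigma u v A b S p q t t2) => //.
- exact: ltW.
- exact: ltW.
- have := @frob_norm_spectrum_le _ _ (Z1 S) t pn.+1 (Z1s S) (ltW t0) isT g1.
  by rewrite /Z1 NE.
- apply: dilation_norm_le => x.
  have := @frob_norm_spectrum_le _ _ (Z2 S) t2 pn.+1 (Z2s S) (ltW t20) isT g2 x.
  by rewrite /Z2 NE.
(* The budget is [1 / 10] for the sampling error of [svd_E], [1 / 4] for its constraint error and
   [3 / 5] for the Neumann remainder. *)
rewrite frob_norm_svd_E // nu_QperpE // -/nu -/snr -/s.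
exact: error_budget ht2 hsnr hsum.
Qed.
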